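(* Let $G$ be a signed graph on the vertex set $[\ell]$ that does not contain a subgraph isomorphic to $B_2$, and let $\mathcal{A}(G)$ be the associated signed graphic arrangement in $\mathbb{C}^\ell$. Then the Falk invariant of $\mathcal{A}(G)$ is $$\phi_3=2\,(k_3+k_4+d_3+d_{2,1}+k_{2,2}+k_{3,3}+g_\circ)+5\,d_{3,1},$$ where $k_l$ is the number of subgraphs of $G$ isomorphic to a $\overline{K_l}$; $d_3$ is the number of subgraphs of $G$ isomorphic to $D_3$ that are not contained in a subgraph of $G$ isomorphic to $D_3^1$; $d_{l,1}$ is the number of subgraphs of $G$ isomorphic to $D_l^1$; $k_{l,l}$ is the number of subgraphs of $G$ isomorphic to a $\overline{K_l^l}$; and $g_\circ$ is the number of subgraphs of $G$ isomorphic to a $\overline{G_\circ}$ that are not contained in a subgraph of $G$ isomorphic to $D_3^1$.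
   Context: Signed graphs. A signed graph is a tuple $G=(V_G,E_G^+,E_G^-,L_G)$ with $V_G$ a finite set, $E_G^+,E_G^-\subseteq\binom{V_G}{2}$ (positive and negative edges; a pair may be in both, giving a double edge) and $L_G\subseteq V_G$ (loops). Its edge set is the disjoint union $E_G^+\sqcup E_G^-\sqcup L_G$. If $G^\pm=(V_G,E_G^\pm)$, one also writes $G=(G^+,G^-,L_G)$. Subgraphs are obtained by taking subsets of the vertices, positive edges, negative edges and loops (not necessarily induced); isomorphisms are vertex bijections preserving positive edges, negative edges and loops. For $V_G=[\ell]=\{1,\dots,\ell\}$, the signed graphic arrangement $\mathcal{A}(G)$ in $\mathbb{C}^\ell$ consists of the hyperplanes $\{x_i-x_j=0\}$ for $\{i,j\}\in E_G^+$, $\{x_i+x_j=0\}$ for $\{i,j\}\in E_G^-$, and $\{x_i=0\}$ for $i\in L_G$. Switching. For $\sigma\colon V_G\to\{+,-\}$, the switching $G^\sigma$ has the same vertices, loops and underlying (multi)graph as $G$, and each edge on $\{i,j\}$ with sign $s$ in $G$ gets sign $\sigma(i)\,s\,\sigma(j)$. Two signed graphs $G_1,G_2$ are switching equivalent if $G_2=G_1^\sigma$ for some $\sigma$. For a signed graph $H$, $\overline{H}$ denotes any signed graph switching equivalent to $H$. Special graphs. With $K_\ell$ the complete simple graph and $K_\ell^\circ$ the edgeless graph on $\ell$ vertices: $K_\ell=(K_\ell,K_\ell^\circ,\emptyset)$ (all edges positive, no loops), $K_\ell^\ell=(K_\ell,K_\ell^\circ,[\ell])$, $D_\ell=(K_\ell,K_\ell,\emptyset)$,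 $D_\ell^1=(K_\ell,K_\ell,\{1\})$, $B_\ell=(K_\ell,K_\ell,[\ell])$. $G_\circ$ is the signed graph on three vertices $a,b,c$ with both a positive and a negative edge on $\{a,b\}$ and on $\{b,c\}$, a single positive edge on $\{a,c\}$, and exactly one loop, at $b$. Falk invariant. For a central arrangement $\{H_1,\dots,H_n\}$ of distinct hyperplanes with $H_i=\ker\alpha_i$, let $E=\bigwedge E^1$ be the exterior algebra over $\mathbb{C}$ on $E^1=\bigoplus_{i=1}^n\mathbb{C}e_i$, with the derivation $\partial$ of degree $-1$, $\partial e_i=1$, so that for $S=\{i_1<\dots<i_p\}$ and $e_S=e_{i_1}\wedge\cdots\wedge e_{i_p}$ one has $\partial e_S=\sum_{j=1}^p(-1)^{j-1}e_{S\setminus\{i_j\}}$. The Orlik-Solomon ideal $I$ is the ideal of $E$ generated by all $\partial e_S$ with $\{\alpha_i\mid i\in S\}$ linearly dependent; $I^p=I\cap E^p$. The Falk invariant is $\phi_3=\dim_{\mathbb{C}}\ker(d)$, where $d\colon E^1\otimes I^2\to E^3$, $d(a\otimes b)=a\wedge b$. *)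

(* Defs.v *)
From HB Require Import structures.
From mathcomp Require Import all_boot all_order all_algebra all_field.
From mathcomp Require Import reals complex.
Set Implicit Arguments.
Unset Strict Implicit.
Unset Printing Implicit Defensive.
Import Order.TTheory GRing.Theory Num.Theory.
Local Open Scope ring_scope.

(* Signed graphs whose vertices lie in an ambient finite type T.  The vertex  *)
(* set is part of the data, so that the subgraphs of a graph (with possibly   *)
(* fewer vertices) form a finite type of objects of the same kind and can be  *)
(* counted.  A pair of vertices may occur in both edge sets.                  *)

Definition sgraph_data (T : finType) : Type :=
  ({set T} * {set {set T}} * {set {set T}} * {set T})%type.

Definition sgraph_wf (T : finType) : pred (sgraph_data T) :=
  fun d => let: (V, Ep, Em, L) := d in
    [&& [forall e in Ep, (#|e| == 2%N) && (e \subset V)],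
        [forall e in Em, (#|e| == 2%N) && (e \subset V)] & L \subset V].

Record sgraph (T : finType) : Type := SGraph {
  sgraph_val :> sgraph_data T;
  sgraphP : sgraph_wf sgraph_val
}.

HB.instance Definition _ (T : finType) := [isSub for @sgraph_val T].
HB.instance Definition _ (T : finType) := [Finite of sgraph T by <:].

Definition vertices (T : finType) (G : sgraph T) : {set T} :=
  (val G).1.1.1.
Definition pos_edges (T : finType) (G : sgraph T) : {set {set T}} :=
  (val G).1.1.2.
Definition neg_edges (T : finType) (G : sgraph T) : {set {set T}} :=
  (val G).1.2.
Definition loops (T : finType) (G : sgraph T) : {set T} :=
  (val G).2.

Definition subgraph (T : finType) (H G : sgraph T) : bool :=
  [&& vertices H \subset vertices G, pos_edges H \subset pos_edges G,
      neg_edges H \subset neg_edges G & loops H \subset loops G].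

(* The bijection is the restriction of f to the vertices of G; this requires  *)
(* T' to be inhabited (or T to be empty) when G has no vertex at all.         *)
Definition sgraph_iso (T T' : finType) (G : sgraph T) (G' : sgraph T') : bool :=
  [exists f : {ffun T -> T'},
    [&& dinjectiveb f (vertices G),
        f @: vertices G == vertices G',
        [set f @: (e : {set T}) | e in pos_edges G] == pos_edges G',
        [set f @: (e : {set T}) | e in neg_edges G] == neg_edges G' &
        f @: loops G == loops G']].

(* A map from vertices to signs is a boolean function, true standing for the  *)
(* sign -.  An edge {i, j} changes sign iff sigma(i) sigma(j) = -, that is,   *)
(* iff exactly one of i and j is mapped to -.                                 *)
Definition flips (T : finType) (sigma : {ffun T -> bool}) (e : {set T}) : bool :=
  odd #|[set x in e | sigma x]|.

Definition switch_data (T : finType) (sigma : {ffun T -> bool}) (G : sgraph T) :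
    sgraph_data T :=
  (vertices G,
   [set e in pos_edges G | ~~ flips sigma e]
     :|: [set e in neg_edges G | flips sigma e],
   [set e in neg_edges G | ~~ flips sigma e]
     :|: [set e in pos_edges G | flips sigma e],
   loops G).

Lemma switch_wf (T : finType) (sigma : {ffun T -> bool}) (G : sgraph T) :
  sgraph_wf (switch_data sigma G).
Proof.
have := sgraphP G; rewrite /switch_data /vertices /pos_edges /neg_edges /loops.
rewrite -[sgraph_val G]/(val G); case: (val G) => -[[V Ep] Em] L; case/and3P=> HEp HEm HL.
move/forall_inP in HEp; move/forall_inP in HEm.
apply/and3P; split=> //=; apply/forall_inP=> e.
  by rewrite !inE => /orP[] /andP[He _]; [exact: HEp | exact: HEm].
by rewrite !inE => /orP[] /andP[He _]; [exact: HEm | exact: HEp].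
Qed.

Definition switch (T : finType) (sigma : {ffun T -> bool}) (G : sgraph T) :
    sgraph T :=
  SGraph (switch_wf sigma G).

Definition switching_equiv (T : finType) (G1 G2 : sgraph T) : bool :=
  [exists sigma : {ffun T -> bool}, G2 == switch sigma G1].

(* G is isomorphic to some graph switching equivalent to H, i.e. to a         *)
(* "H with a bar".                                                            *)
Definition sgraph_iso_bar (T T' : finType) (G : sgraph T) (H : sgraph T') : bool :=
  [exists H' : sgraph T', switching_equiv H H' && sgraph_iso G H'].

Definition complete_edges (l : nat) : {set {set 'I_l}} :=
  [set e : {set 'I_l} | #|e| == 2%N].

Lemma full_wf (l : nat) (Ep Em : {set {set 'I_l}}) (L : {set 'I_l}) :
    Ep \subset complete_edges l -> Em \subset complete_edges l ->
  sgraph_wf ([set: 'I_l], Ep, Em, L).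
Proof.
move=> /subsetP HEp /subsetP HEm; apply/and3P; split; last exact: subsetT.
  by apply/forall_inP=> e /HEp; rewrite inE subsetT andbT.
by apply/forall_inP=> e /HEm; rewrite inE subsetT andbT.
Qed.

Definition graph_K (l : nat) : sgraph 'I_l :=
  SGraph (full_wf set0 (subxx (complete_edges l)) (sub0set _)).
Definition graph_Kl (l : nat) : sgraph 'I_l :=
  SGraph (full_wf [set: 'I_l] (subxx (complete_edges l)) (sub0set _)).
Definition graph_D (l : nat) : sgraph 'I_l :=
  SGraph (full_wf set0 (subxx (complete_edges l)) (subxx (complete_edges l))).
Definition graph_D1 (l : nat) : sgraph 'I_l :=
  SGraph (full_wf [set i : 'I_l | val i == 0%N]
    (subxx (complete_edges l)) (subxx (complete_edges l))).
Definition graph_B (l : nat) : sgraph 'I_l :=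
  SGraph (full_wf [set: 'I_l]
    (subxx (complete_edges l)) (subxx (complete_edges l))).

(* The vertices a, b, c are 0, 1, 2; the negative edges are the two pairs     *)
(* containing b.                                                              *)
Definition graph_Gcirc : sgraph 'I_3 :=
  SGraph (full_wf [set inord 1 : 'I_3] (subxx (complete_edges 3))
    (subsetIl (complete_edges 3) [set e : {set 'I_3} | inord 1 \in e])).

Definition count_subgraphs (T : finType) (G : sgraph T) (P : pred (sgraph T)) : nat :=
  #|[set H : sgraph T | subgraph H G && P H]|.

Definition in_D31 (T : finType) (G H : sgraph T) : bool :=
  [exists H' : sgraph T,
    [&& subgraph H' G, sgraph_iso H' (graph_D1 3) & subgraph H H']].

Definition nb_K (T : finType) (G : sgraph T) (l : nat) : nat :=
  count_subgraphs G (fun H => sgraph_iso_bar H (graph_K l)).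
Definition nb_Kl (T : finType) (G : sgraph T) (l : nat) : nat :=
  count_subgraphs G (fun H => sgraph_iso_bar H (graph_Kl l)).
Definition nb_D1 (T : finType) (G : sgraph T) (l : nat) : nat :=
  count_subgraphs G (fun H => sgraph_iso H (graph_D1 l)).
Definition nb_D3 (T : finType) (G : sgraph T) : nat :=
  count_subgraphs G (fun H => sgraph_iso H (graph_D 3) && ~~ in_D31 G H).
Definition nb_Gcirc (T : finType) (G : sgraph T) : nat :=
  count_subgraphs G (fun H => sgraph_iso_bar H graph_Gcirc && ~~ in_D31 G H).

Definition coordinate (K : fieldType) (l : nat) (i : 'I_l) : 'Hom('rV[K]_l, K^o) :=
  linfun (fun x : 'rV[K]_l => x 0 i : K^o).

Definition signed_graphic_arrangement (K : fieldType) (l : nat) (G : sgraph 'I_l)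
    (H : {vspace 'rV[K]_l}) : Prop :=
  [\/ exists i j : 'I_l,
        [set i; j] \in pos_edges G /\ H = lker (coordinate K i - coordinate K j),
      exists i j : 'I_l,
        [set i; j] \in neg_edges G /\ H = lker (coordinate K i + coordinate K j) |
      exists i : 'I_l, i \in loops G /\ H = lker (coordinate K i)].

(* {ker alpha_0, ..., ker alpha_(n-1)} is an enumeration without repetition   *)
(* of the set A of hyperplanes.                                               *)
Definition defines_arrangement (K : fieldType) (V : vectType K) (n : nat)
    (alpha : 'I_n -> 'Hom(V, K^o)) (A : {vspace V} -> Prop) : Prop :=
  injective (fun i => lker (alpha i)) /\
  (forall H : {vspace V}, A H <-> exists i, H = lker (alpha i)).

(* The exterior algebra on e_0, ..., e_(n-1): an element is the family of its *)
(* coordinates in the basis e_S (see ext_base), S ranging over subsets of the *)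
(* indices.  The ring structure below is the wedge product.                   *)
Definition exterior (K : fieldType) (n : nat) : Type :=
  {ffun {set 'I_n} -> K^o}.

HB.instance Definition _ (K : fieldType) (n : nat) :=
  Vector.on (exterior K n).

Definition ext_base (K : fieldType) (n : nat) (S : {set 'I_n}) : exterior K n :=
  [ffun T => (T == S)%:R].

Definition inversions (n : nat) (S T : {set 'I_n}) : nat :=
  #|[set p in setX S T | (p.2 < p.1)%N]|.

Definition ext_base_mul (K : fieldType) (n : nat) (S T : {set 'I_n}) : exterior K n :=
  if [disjoint S & T] then (-1) ^+ inversions S T *: ext_base K (S :|: T) else 0.

Definition ext_mul (K : fieldType) (n : nat) (x y : exterior K n) : exterior K n :=
  \sum_(S : {set 'I_n}) \sum_(T : {set 'I_n}) (x S * y T) *: ext_base_mul K S T.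

Lemma ext_baseE (K : fieldType) (n : nat) (x : exterior K n) :
  x = \sum_(S : {set 'I_n}) x S *: ext_base K S.
Proof.
apply/ffunP=> T; rewrite sum_ffunE (bigD1 T) //= !ffunE eqxx [_ *: _]mulr1.
by rewrite big1 ?addr0 // => S nST; rewrite !ffunE eq_sym (negPf nST) scaler0.
Qed.

Lemma ext_mulDl (K : fieldType) (n : nat) :
  left_distributive (@ext_mul K n) +%R.
Proof.
move=> x y z; rewrite /ext_mul -big_split; apply: eq_bigr => S _ /=.
rewrite -big_split; apply: eq_bigr => T _ /=.
by rewrite ffunE mulrDl scalerDl.
Qed.

Lemma ext_mulDr (K : fieldType) (n : nat) :
  right_distributive (@ext_mul K n) +%R.
Proof.
move=> x y z; rewrite /ext_mul -big_split; apply: eq_bigr => S _ /=.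
rewrite -big_split; apply: eq_bigr => T _ /=.
by rewrite ffunE mulrDr scalerDl.
Qed.

Lemma ext_scalerAl (K : fieldType) (n : nat) (a : K) (x y : exterior K n) :
  a *: ext_mul x y = ext_mul (a *: x) y.
Proof.
rewrite /ext_mul scaler_sumr; apply: eq_bigr => S _.
rewrite scaler_sumr; apply: eq_bigr => T _.
by rewrite ffunE scalerA mulrA.
Qed.

Lemma ext_scalerAr (K : fieldType) (n : nat) (a : K) (x y : exterior K n) :
  a *: ext_mul x y = ext_mul x (a *: y).
Proof.
rewrite /ext_mul scaler_sumr; apply: eq_bigr => S _.
rewrite scaler_sumr; apply: eq_bigr => T _.
by rewrite ffunE scalerA /GRing.scale /= mulrCA.
Qed.

Lemma ext_mul_base (K : fieldType) (n : nat) (S T : {set 'I_n}) :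
  ext_mul (ext_base K S) (ext_base K T) = ext_base_mul K S T.
Proof.
rewrite /ext_mul (bigD1 S) //= (bigD1 T) //= !ffunE !eqxx mulr1 scale1r.
rewrite big1 ?addr0 => [|T' nT]; last first.
  by rewrite !ffunE (negPf nT) mulr0 scale0r.
rewrite big1 ?addr0 // => S' nS; rewrite big1 // => T' _.
by rewrite !ffunE (negPf nS) mul0r scale0r.
Qed.

Lemma ext_mul0r (K : fieldType) (n : nat) (x : exterior K n) : ext_mul 0 x = 0.
Proof. by rewrite -[X in ext_mul X](scale0r 0) -ext_scalerAl scale0r. Qed.

Lemma ext_mulr0 (K : fieldType) (n : nat) (x : exterior K n) : ext_mul x 0 = 0.
Proof. by rewrite -[X in ext_mul _ X](scale0r 0) -ext_scalerAr scale0r. Qed.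

Lemma ext_mul_suml (K : fieldType) (n : nat) (I : finType)
    (F : I -> exterior K n) (y : exterior K n) :
  ext_mul (\sum_i F i) y = \sum_i ext_mul (F i) y.
Proof.
by apply: (big_morph (fun x => ext_mul x y)) => [u v|];
  [exact: ext_mulDl | exact: ext_mul0r].
Qed.

Lemma ext_mul_sumr (K : fieldType) (n : nat) (I : finType)
    (F : I -> exterior K n) (x : exterior K n) :
  ext_mul x (\sum_i F i) = \sum_i ext_mul x (F i).
Proof.
by apply: (big_morph (ext_mul x)) => [u v|]; [exact: ext_mulDr | exact: ext_mulr0].
Qed.

Lemma inversionsUl (n : nat) (S T U : {set 'I_n}) : [disjoint S & T] ->
  inversions (S :|: T) U = (inversions S U + inversions T U)%N.
Proof.
move=> dST; rewrite /inversions -cardsUI -[LHS]addn0; congr (_ + _)%N.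
  apply: eq_card => p; rewrite !inE.
  by case: (p.1 \in S); case: (p.1 \in T); case: (p.2 \in U) => //=; rewrite ?orbb ?orbF.
apply/esym/eq_card0 => p; rewrite !inE; apply/negbTE/negP.
case/andP=> /andP[/andP[pS _] _] /andP[/andP[pT _] _].
by move/pred0P: dST => /(_ p.1) /=; rewrite pS pT.
Qed.

Lemma inversionsUr (n : nat) (S T U : {set 'I_n}) : [disjoint T & U] ->
  inversions S (T :|: U) = (inversions S T + inversions S U)%N.
Proof.
move=> dTU; rewrite /inversions -cardsUI -[LHS]addn0; congr (_ + _)%N.
  apply: eq_card => p; rewrite !inE.
  by case: (p.1 \in S); case: (p.2 \in T); case: (p.2 \in U) => //=; rewrite ?orbb ?orbF.
apply/esym/eq_card0 => p; rewrite !inE; apply/negbTE/negP.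
case/andP=> /andP[/andP[_ pT] _] /andP[/andP[_ pU] _].
by move/pred0P: dTU => /(_ p.2) /=; rewrite pT pU.
Qed.

Lemma disjointsUl (n : nat) (S T U : {set 'I_n}) :
  [disjoint S :|: T & U] = [disjoint S & U] && [disjoint T & U].
Proof. by rewrite !disjoints_subset subUset. Qed.

Lemma disjointsUr (n : nat) (S T U : {set 'I_n}) :
  [disjoint S & T :|: U] = [disjoint S & T] && [disjoint S & U].
Proof. by rewrite !disjoints_subset setCU subsetI. Qed.

Lemma ext_base_mulA (K : fieldType) (n : nat) (S T U : {set 'I_n}) :
  ext_mul (ext_base K S) (ext_base_mul K T U)
  = ext_mul (ext_base_mul K S T) (ext_base K U).
Proof.
rewrite /ext_base_mul; case dTU: [disjoint T & U]; last first.
  rewrite ext_mulr0; case: ifP => _; last by rewrite ext_mul0r.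
  by rewrite -ext_scalerAl ext_mul_base /ext_base_mul disjointsUl dTU andbF scaler0.
case dST: [disjoint S & T]; last first.
  rewrite ext_mul0r -ext_scalerAr ext_mul_base /ext_base_mul.
  by rewrite disjointsUr dST scaler0.
rewrite -ext_scalerAl -ext_scalerAr !ext_mul_base /ext_base_mul.
rewrite disjointsUl disjointsUr dTU dST andbT /=; case: ifP => _; last first.
  by rewrite !scaler0.
rewrite !scalerA -!exprD setUA inversionsUl // inversionsUr //.
by rewrite [in LHS]addnC -[in LHS]addnA.
Qed.

Lemma ext_mulA (K : fieldType) (n : nat) : associative (@ext_mul K n).
Proof.
move=> x y z; rewrite (ext_baseE x) ext_mul_suml.
rewrite [X in _ = ext_mul X _]ext_mul_suml [RHS]ext_mul_suml; apply: eq_bigr => S _.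
rewrite -[LHS]ext_scalerAl -[X in _ = ext_mul X _]ext_scalerAl -[RHS]ext_scalerAl.
congr (_ *: _); rewrite (ext_baseE y) [X in ext_mul _ X = _]ext_mul_suml.
rewrite [LHS]ext_mul_sumr [X in _ = ext_mul X _]ext_mul_sumr [RHS]ext_mul_suml.
apply: eq_bigr => T _; rewrite -[X in ext_mul _ X = _]ext_scalerAl.
rewrite -[LHS]ext_scalerAr -[X in _ = ext_mul X _]ext_scalerAr -[RHS]ext_scalerAl.
congr (_ *: _); rewrite (ext_baseE z) [X in ext_mul _ X = _]ext_mul_sumr.
rewrite [LHS]ext_mul_sumr [RHS]ext_mul_sumr; apply: eq_bigr => U _.
rewrite -[X in ext_mul _ X = _]ext_scalerAr -[LHS]ext_scalerAr -[RHS]ext_scalerAr.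
by rewrite !ext_mul_base ext_base_mulA.
Qed.

Lemma ext_mul1r (K : fieldType) (n : nat) :
  left_id (ext_base K set0) (@ext_mul K n).
Proof.
move=> x; rewrite [in RHS](ext_baseE x) (ext_baseE x) ext_mul_sumr.
rewrite -ext_baseE; apply: eq_bigr => S _.
rewrite -ext_scalerAr ext_mul_base /ext_base_mul disjoints_subset sub0set set0U.
suff -> : inversions set0 S = 0%N by rewrite scale1r.
by apply: eq_card0 => p; rewrite !inE.
Qed.

Lemma ext_mulr1 (K : fieldType) (n : nat) :
  right_id (ext_base K set0) (@ext_mul K n).
Proof.
move=> x; rewrite [in RHS](ext_baseE x) [in LHS](ext_baseE x) ext_mul_suml.
apply: eq_bigr => S _.
rewrite -ext_scalerAl ext_mul_base /ext_base_mul disjoints_subset setC0 subsetT setU0.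
suff -> : inversions S set0 = 0%N by rewrite scale1r.
by apply: eq_card0 => p; rewrite !inE andbF.
Qed.

Lemma ext_oner_neq0 (K : fieldType) (n : nat) : ext_base K (set0 : {set 'I_n}) != 0.
Proof.
apply/eqP=> /ffunP/(_ set0); rewrite !ffunE eqxx => /eqP.
by rewrite oner_eq0.
Qed.

HB.instance Definition _ (K : fieldType) (n : nat) :=
  GRing.Zmodule_isNzRing.Build (exterior K n) (@ext_mulA K n) (@ext_mul1r K n)
    (@ext_mulr1 K n) (@ext_mulDl K n) (@ext_mulDr K n) (@ext_oner_neq0 K n).
HB.instance Definition _ (K : fieldType) (n : nat) :=
  GRing.Lmodule_isLalgebra.Build K (exterior K n) (@ext_scalerAl K n).
HB.instance Definition _ (K : fieldType) (n : nat) :=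
  GRing.Lalgebra_isAlgebra.Build K (exterior K n) (@ext_scalerAr K n).
HB.instance Definition _ (K : fieldType) (n : nat) :=
  Algebra_isFalgebra.Build K (exterior K n).

Definition ext_grade (K : fieldType) (n p : nat) : {vspace exterior K n} :=
  <<[seq ext_base K A | A in [set A : {set 'I_n} | #|A| == p]]>>%VS.

(* The derivation, given on e_S by the alternating sum of the e_(S :\ j): if  *)
(* j is the k-th smallest element of S then the number of elements of S below *)
(* j is k - 1.                                                                *)
Definition ext_derive_base (K : fieldType) (n : nat) (S : {set 'I_n}) : exterior K n :=
  \sum_(j in S) (-1) ^+ #|[set i in S | (i < j)%N]| *: ext_base K (S :\ j).

Definition dependent_sets (K : fieldType) (V : vectType K) (n : nat)
    (alpha : 'I_n -> 'Hom(V, K^o)) : {set {set 'I_n}} :=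
  [set S : {set 'I_n} | ~~ free [seq alpha i | i <- enum S]].

(* The product of subspaces E * X * E of an algebra E is the two-sided ideal  *)
(* generated by X.                                                            *)
Definition OS_ideal (K : fieldType) (V : vectType K) (n : nat)
    (alpha : 'I_n -> 'Hom(V, K^o)) : {vspace exterior K n} :=
  (fullv * <<[seq ext_derive_base K A | A in dependent_sets alpha]>> * fullv)%VS.

Definition OS_ideal_grade (K : fieldType) (V : vectType K) (n p : nat)
    (alpha : 'I_n -> 'Hom(V, K^o)) : {vspace exterior K n} :=
  (OS_ideal alpha :&: ext_grade K n p)%VS.

(* The tensor product E (x) E, with basis e_S (x) e_T; for subspaces U and W, *)
(* U (x) W is the subspace spanned by the tensors u (x) w.                    *)
Definition ext_tensor (K : fieldType) (n : nat) : Type :=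
  {ffun {set 'I_n} * {set 'I_n} -> K^o}.

HB.instance Definition _ (K : fieldType) (n : nat) :=
  Vector.on (ext_tensor K n).

Definition tensor (K : fieldType) (n : nat) (x y : exterior K n) : ext_tensor K n :=
  [ffun p => x p.1 * y p.2].

Definition tensor_space (K : fieldType) (n : nat) (U W : {vspace exterior K n}) :
    {vspace ext_tensor K n} :=
  <<[seq tensor u w | u <- vbasis U, w <- vbasis W]>>%VS.

(* The linear map E (x) E -> E sending x (x) y to x * y (wedge_tensorE).      *)
Definition wedge (K : fieldType) (n : nat) (t : ext_tensor K n) : exterior K n :=
  \sum_(p : {set 'I_n} * {set 'I_n}) t p *: (ext_base K p.1 * ext_base K p.2).

Lemma wedge_is_linear (K : fieldType) (n : nat) : linear (@wedge K n).
Proof.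
move=> a s t; rewrite /wedge scaler_sumr -big_split; apply: eq_bigr => p _ /=.
by rewrite !ffunE scalerDl scalerA.
Qed.

HB.instance Definition _ (K : fieldType) (n : nat) :=
  GRing.isLinear.Build K (ext_tensor K n) (exterior K n) *:%R (@wedge K n)
    (@wedge_is_linear K n).

Lemma wedge_tensorE (K : fieldType) (n : nat) (x y : exterior K n) :
  wedge (tensor x y) = x * y.
Proof.
rewrite [RHS]/GRing.mul /= /ext_mul pair_bigA; apply: eq_bigr => p _ /=.
by rewrite ffunE [ext_base K _ * _]ext_mul_base.
Qed.

Lemma tensor_spaceP (K : fieldType) (n : nat) (U W : {vspace exterior K n})
    (x y : exterior K n) :
  x \in U -> y \in W -> tensor x y \in tensor_space U W.
Proof.
move=> xU yW; rewrite (coord_vbasis xU) (coord_vbasis yW).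
rewrite [tensor _ _](_ : _ = \sum_i \sum_j
  (coord (vbasis U) i x * coord (vbasis W) j y) *: tensor (vbasis U)`_i (vbasis W)`_j).
  apply: memv_suml => i _; apply: memv_suml => j _; apply: memvZ; apply: memv_span.
  by apply: allpairs_f; apply: mem_nth; rewrite size_tuple.
apply/ffunP=> p; rewrite ffunE !sum_ffunE big_distrl; apply: eq_bigr => i _ /=.
rewrite sum_ffunE big_distrr; apply: eq_bigr => j _ /=.
by rewrite !ffunE /GRing.scale /= mulrACA.
Qed.

(* The kernel of E^1 (x) I^2 -> E^3, a (x) b |-> a b.                         *)
Definition falk_invariant (K : fieldType) (V : vectType K) (n : nat)
    (alpha : 'I_n -> 'Hom(V, K^o)) : nat :=
  \dim (tensor_space (ext_grade K n 1) (OS_ideal_grade 2 alpha)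
          :&: lker (linfun (@wedge K n))).

(* Main.v *)
From HB Require Import structures.
Require Import Defs.
From mathcomp Require Import all_boot all_order all_algebra all_field.
From mathcomp Require Import reals complex.
From mathcomp Require Import zify ring.
(** Let C (x; y, z) be the coordinate of an element of E^1 (x) E^2 at
e_x (x) e_y e_z, made antisymmetric in y and z.  Without a subgraph B_2 every
flat of rank 2 has at most three hyperplanes, so the dependent triples of
hyperplanes are the lines of a partial linear space and the derivatives of the
e_S, S a line, form a basis of I^2.  Hence the kernel of E^1 (x) I^2 -> E^3 is
the space of functions C that vanish unless y and z lie on a line, take the same
value at the three cyclically ordered pairs of a line, and satisfy
C (x; y, z) + C (y; z, x) + C (z; x, y) = 0 (syzygy, coef_syzygy, syzygy_coef,
coef_eq0).

If x lies on the line through y and z, the relations only involve this line and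
leave a plane of solutions: lines are the subgraphs K_3, K_2^2 and D_2^1, and
each contributes 2.  If x is off the line and C (x; y, z) is not 0, the
three-term relations force further lines through x, and these put x and the line
into a complete quadrilateral (six points on four lines: K_4, D_3, K_3^3 or
G_circ, up to switching) or into a non-Fano plane (seven points on six lines:
D_3^1); this is syzygy_covered.  A non-collinear triple lies in at most one such
configuration, once the quadrilaterals inside a D_3^1 are discarded (overlap,
config_unique).  So the kernel is the direct sum of the local kernels of the
configurations, of dimension 2 for a line or a quadrilateral and 5 for a
D_3^1.

The local kernels are described by explicit tables of syzygies, dual to
evaluations at a few triples (model_ok).  The tables and evaluations of all
configurations together form a dual pair of families (conf_vect_syzygy,
conf_eval_vect) and the evaluations separate syzygies (conf_separate), which
gives the dimension (dim_dual_family, falk_configs); the summands are then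
sorted by isomorphism type (falk_formula).

All statements about the relative position of a few edges and loops concern at
most six vertices.  Edges and loops are coded by their ends and sign (code), a
relabelling moves the vertices to an initial segment of the natural numbers
(transfer), and there finitely many cases are decided by computation. *)

Set Implicit Arguments.
Unset Strict Implicit.
Unset Printing Implicit Defensive.
Import Order.TTheory GRing.Theory Num.Theory.
Local Open Scope ring_scope.

(** * Linear induction and homogeneous elements *)

Section LinearInduction.

Lemma span_closed_ind (K : fieldType) (vT : vectType K) (P : vT -> Prop) (X : seq vT) :
  P 0 -> (forall a u v, P u -> P v -> P (a *: u + v)) ->
  (forall x, x \in X -> P x) -> forall v, v \in <<X>>%VS -> P v.
Proof.
move=> P0 Plin PX v; rewrite -[X]/(tval (in_tuple X)) => /coord_span ->.
have PD u w : P u -> P w -> P (u + w) by move=> Pu; rewrite -[u]scale1r; exact: Plin.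
apply: big_ind => // i _; rewrite -[_ *: _]addr0; apply: Plin => //.
by apply: PX; apply: mem_nth; case: i => i /=.
Qed.

Lemma prod_closed_ind (K : fieldType) (aT : falgType K) (P : aT -> Prop) (U W : {vspace aT}) :
  P 0 -> (forall a u v, P u -> P v -> P (a *: u + v)) ->
  (forall u w, u \in U -> w \in W -> P (u * w)) -> forall v, v \in (U * W)%VS -> P v.
Proof.
move=> P0 Plin PUW v; rewrite (unlock (prodv_unlockable _)); apply: span_closed_ind => //.
move=> _ /allpairsP[[u w] [/= uU wW ->]].
by apply: PUW; exact: vbasis_mem.
Qed.

(** The family v is free by duality, and it spans: subtracting from u the
combination of the v b with coefficients ev b u leaves a vector at which all
evaluations vanish. *)
Lemma dim_dual_family (K : fieldType) (vT : vectType K) (U : {vspace vT}) (I : finType)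
    (B : {set I}) (ev : I -> vT -> K) (v : I -> vT) :
  (forall b a x y, ev b (a *: x + y) = a * ev b x + ev b y) ->
  (forall b, b \in B -> v b \in U) ->
  (forall a b, a \in B -> b \in B -> ev a (v b) = (a == b)%:R) ->
  (forall u, u \in U -> (forall b, b \in B -> ev b u = 0) -> u = 0) ->
  \dim U = #|B|.
Proof.
move=> lin vU dual sep.
have ev0 b : ev b 0 = 0.
  by have := lin b 1 0 0; rewrite scale1r addr0 mul1r => /eqP; rewrite -subr_eq0 opprD addNKr oppr_eq0 => /eqP.
have evD b x y : ev b (x + y) = ev b x + ev b y by rewrite -[x]scale1r lin mul1r scale1r.
have evZ b a x : ev b (a *: x) = a * ev b x by rewrite -[a *: x]addr0 lin ev0 addr0.
have evS b (r : seq I) (c : I -> K) : ev b (\sum_(a <- r) c a *: v a) = \sum_(a <- r) c a * ev b (v a).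
  by elim/big_rec2: _ => [|a x y _ <-]; rewrite ?ev0 // evD evZ.
pose X := [seq v b | b <- enum B].
suff bX : basis_of U X by rewrite (size_basis (X := in_tuple X) bX) size_map -cardE.
rewrite basisEdim; apply/andP; split.
  apply/subvP=> u uU; rewrite -[u](subrK (\sum_(a <- enum B) ev a u *: v a)).
  set w := \sum_(_ <- _) _; have wX : w \in <<X>>%VS.
    rewrite /w big_seq; apply: memv_suml => a aB; apply: memvZ; apply: memv_span; exact: map_f.
  suff -> : u - w = 0 by rewrite add0r.
  apply: sep => [|b bB].
    apply: memvB => //; rewrite /w big_seq; apply: memv_suml => a; rewrite mem_enum => aB.
    exact/memvZ/vU.
  rewrite -scaleN1r addrC lin /w evS (bigD1_seq b) ?mem_enum ?enum_uniq //=.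
  rewrite dual // eqxx mulr1 big_seq_cond big1 ?addr0 ?mulN1r ?addNr // => a.
  by rewrite mem_enum => /andP[aB ab]; rewrite dual // eq_sym (negPf ab) mulr0.
apply: leq_trans (dimvS (_ : (<<X>> <= U)%VS)); last first.
  by apply/span_subvP=> _ /mapP[b + ->]; rewrite mem_enum; exact: vU.
suff -> : \dim <<X>> = size X by [].
apply/eqP; rewrite -/(free X); apply/(@freeP _ _ _ (in_tuple X)) => k /= e i.
case: (pickP (mem B)) => [b0 _|B0]; last first.
  by exfalso; case: i => i; rewrite size_map -cardE (eq_card0 B0).
have szX : size X = #|B| by rewrite size_map -cardE.
have iB : (i < size (enum B))%N by rewrite -cardE -szX ltn_ord.
have bB : nth b0 (enum B) i \in B by rewrite -mem_enum mem_nth.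
have := congr1 (ev (nth b0 (enum B) i)) e; rewrite ev0.
have evS2 b (F : 'I_(size X) -> vT) : ev b (\sum_j F j) = \sum_j ev b (F j).
  by apply: (big_morph (ev b)) => [x y|]; [exact: evD | exact: ev0].
rewrite evS2 (bigD1 i) //= evZ big1 ?addr0 => [|j ji].
  by rewrite /X (nth_map b0) // dual // eqxx mulr1.
have jB : (j < size (enum B))%N by rewrite -cardE -szX ltn_ord.
rewrite evZ /X (nth_map b0) // dual // ?nth_uniq ?enum_uniq //; last by rewrite -mem_enum mem_nth.
by rewrite (_ : (i == j :> nat) = false) ?mulr0 //; apply/negbTE; rewrite eq_sym.
Qed.

End LinearInduction.

Section Homogeneous.
Variables (K : fieldType) (n : nat).
Implicit Types (x y w : exterior K n) (S A B : {set 'I_n}).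

Definition homog d x := forall S, x S != 0 -> #|S| = d.

Lemma homog_base S : homog #|S| (ext_base K S).
Proof. by move=> T; rewrite ffunE; have [->|] := eqVneq T S; rewrite ?eqxx. Qed.

Lemma homogM d e x y : homog d x -> homog e y -> homog (d + e) (x * y).
Proof.
move=> hx hy T nz; apply/eqP; apply: contraNT nz => neq; apply/eqP.
rewrite [x * y]/GRing.mul /= /ext_mul sum_ffunE big1 // => A _.
rewrite sum_ffunE big1 // => B _; rewrite !ffunE.
have [->|/hx cA] := eqVneq (x A) 0; first by rewrite mul0r scale0r.
have [->|/hy cB] := eqVneq (y B) 0; first by rewrite mulr0 scale0r.
rewrite /ext_base_mul; case: ifP => [dAB|_]; last by rewrite ffunE scaler0.
rewrite !ffunE; case: eqP => [eT|]; last by rewrite !scaler0.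
by case/negP: neq; rewrite eT cardsU disjoint_setI0 // cards0 subn0 cA cB.
Qed.

Lemma ext_deriveE S T :
  ext_derive_base K S T
  = \sum_(j in S | T == S :\ j) (-1) ^+ #|[set i in S | (i < j)%N]|.
Proof.
rewrite sum_ffunE [RHS]big_mkcondr; apply: eq_bigr => j _ /=; rewrite !ffunE.
by case: eqP => _; rewrite ?scaler0 // [_ *: _]mulr1.
Qed.

Lemma homog_derive S : homog #|S|.-1 (ext_derive_base K S).
Proof.
move=> T; rewrite ext_deriveE => nz; apply/eqP; apply: contraNT nz => neq; apply/eqP.
rewrite big_pred0 // => j; apply: contraNF neq => /andP[jS /eqP eT].
by rewrite eT [#|S|](cardsD1 j) jS.
Qed.

Lemma ext_derive_facet S j : j \in S ->
  ext_derive_base K S (S :\ j) = (-1) ^+ #|[set i in S | (i < j)%N]|.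
Proof.
move=> jS; rewrite ext_deriveE (big_pred1 j) // => i /=.
apply/andP/eqP => [[iS /eqP e]|->]; last by [].
by apply/eqP; apply/negPn/negP=> ne; have := setD11 j S; rewrite e in_setD1 eq_sym ne jS.
Qed.

Lemma homog_grade d x : x \in ext_grade K n d <-> homog d x.
Proof.
split=> [|hx].
  apply: (span_closed_ind (P := homog d)) => [|a u v hu hv|].
  - by move=> S; rewrite ffunE eqxx.
  - move=> S; rewrite !ffunE => nz; apply/eqP; apply: contraNT nz => nS.
    have [/hu/eqP|/negPn/eqP->] := boolP (u S != 0); first by rewrite (negPf nS).
    have [/hv/eqP|/negPn/eqP->] := boolP (v S != 0); first by rewrite (negPf nS).
    by rewrite scaler0 addr0.
  - by move=> _ /mapP[A cA ->]; move: cA; rewrite mem_enum inE => /eqP <-; exact: homog_base.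
rewrite (ext_baseE x); apply: memv_suml => S _.
have [->|nz] := eqVneq (x S) 0; first by rewrite scale0r mem0v.
by apply/memvZ/memv_span/map_f; rewrite mem_enum inE (hx S nz).
Qed.

End Homogeneous.

(** * The Falk kernel as a space of syzygies *)

(** The value C x y z is a coordinate at e_x (x) e_y e_z.  The second and third
conditions put each slice C x into I^2, the last one says that the product in
E^3 vanishes.  Points and lines are kept abstract: they are first the
hyperplanes and their dependent triples, then the edges and loops of the
graph. *)
Definition syzygy (K : fieldType) (P : Type) (A : pred P) (line : P -> P -> P -> bool)
    (C : P -> P -> P -> K) : Prop :=
  [/\ forall x y z, C x z y = - C x y z,
      forall x y z, C x y z != 0 -> A x /\ exists u, line y z u,
      forall x y z u, line y z u -> C x z u = C x y z
    & forall x y z, C x y z + C y z x + C z x y = 0].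

Section OrlikSolomon.
Variables (K : fieldType) (V : vectType K) (n : nat) (alpha : 'I_n -> 'Hom(V, K^o)).
Implicit Types (w : exterior K n) (S A B : {set 'I_n}) (t : ext_tensor K n).

(* Distinct hyperplanes, and flats of rank 2 with at most three hyperplanes. *)
Hypothesis simple : forall S, S \in dependent_sets alpha -> (2 < #|S|)%N.

Definition line_of S := (#|S| == 3) && (S \in dependent_sets alpha).

Hypothesis lines_meet : forall S S', line_of S -> line_of S' -> (1 < #|S :&: S'|)%N -> S = S'.

Definition facet_sign S (j : 'I_n) : K := (-1) ^+ #|[set i in S | (i < j)%N]|.

Lemma facet_signK S j : facet_sign S j * facet_sign S j = 1.
Proof. by rewrite -expr2 sqrr_sign. Qed.

(** The coefficient of the derivative of e_S in w can be read off at each of the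
three pairs inside the line S, where it occurs with the sign facet_sign.  As two
lines share at most one point, the pairs of different lines do not interact. *)
Definition quadratic w :=
  [/\ homog 2 w,
      forall B, w B != 0 -> exists2 S, line_of S & B \subset S
    & forall S i j, line_of S -> i \in S -> j \in S ->
        facet_sign S i * w (S :\ i) = facet_sign S j * w (S :\ j)].

Lemma homog_mul_derive A S B :
  homog (#|A| + #|S|.-1 + #|B|) (ext_base K A * ext_derive_base K S * ext_base K B).
Proof. by do 2?apply: homogM; do ?[exact: homog_base | exact: homog_derive]. Qed.

(** Bilinearity: the e_A span the exterior algebra, so the ideal is spanned by the
products of a generator with some e_A on the left and e_B on the right. *)
Lemma OS_ideal_ind (P : exterior K n -> Prop) :
  P 0 -> (forall a u v, P u -> P v -> P (a *: u + v)) ->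
  (forall A S B, S \in dependent_sets alpha ->
     P (ext_base K A * ext_derive_base K S * ext_base K B)) ->
  forall w, w \in OS_ideal alpha -> P w.
Proof.
move=> P0 Plin Pgen.
have PZ a u : P u -> P (a *: u) by move=> Pu; rewrite -[_ *: _]addr0; exact: Plin.
have Psum (I : finType) (F : I -> exterior K n) : (forall i, P (F i)) -> P (\sum_i F i).
  by move=> PF; apply: big_ind => // u v Pu Pv; rewrite -[u]scale1r; apply: Plin.
apply: prod_closed_ind => // u b uI _; rewrite (ext_baseE b) mulr_sumr; apply: (Psum) => B.
rewrite -scalerAr; apply: (PZ); move: u uI.
apply: (prod_closed_ind (P := fun u => P (u * ext_base K B))) => [|a u v Pu Pv|].
- by rewrite mul0r.
- by rewrite mulrDl -scalerAl; exact: Plin.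
move=> a s _ sX; rewrite (ext_baseE a) [_ * s]mulr_suml [_ * ext_base K B]mulr_suml; apply: Psum => A.
rewrite -!scalerAl; apply: (PZ); move: s sX.
apply: (span_closed_ind (P := fun s => P (ext_base K A * s * ext_base K B))) => [|c u v Pu Pv|].
- by rewrite mulr0 mul0r.
- by rewrite mulrDr mulrDl -scalerAr -scalerAl; exact: Plin.
by move=> _ /mapP[S dS ->]; apply: Pgen; rewrite mem_enum in dS.
Qed.

(** Dependent sets have at least three elements, so for reasons of degree a product
e_A (d e_S) e_B contributes to degree 2 only if A and B are empty and S is a
line.  Hence I^2 is spanned by the derivatives of the lines. *)
Lemma quadratic_OS w : w \in OS_ideal_grade 2 alpha <-> quadratic w.
Proof.
rewrite /OS_ideal_grade memv_cap; split=> [/andP[wI /homog_grade hw]|[hw sw cw]].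
  suff [sw cw] : (forall B, #|B| = 2 -> w B != 0 -> exists2 S, line_of S & B \subset S)
    /\ (forall S i j, line_of S -> i \in S -> j \in S ->
          facet_sign S i * w (S :\ i) = facet_sign S j * w (S :\ j)).
    by split=> // B nz; apply: sw => //; exact: hw.
  clear hw; move: w wI; apply: OS_ideal_ind => [|a u v [su cu] [sv cv]|A S B dS].
  - by split=> [B|S i j _ _ _]; rewrite !ffunE ?eqxx // !mulr0.
  - split=> [B cB|S i j lS iS jS]; last first.
      rewrite !ffunE !mulrDr; congr (_ + _); last exact: cv.
      by rewrite /GRing.scale /= !(mulrCA _ a) (cu S i j).
    have [/su|/negPn/eqP uB] := boolP (u B != 0); first by move/(_ cB).
    have [/sv|/negPn/eqP vB] := boolP (v B != 0); first by move/(_ cB).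
    by rewrite !ffunE uB vB scaler0 addr0 eqxx.
  have hom := @homog_mul_derive A S B; have cS := simple dS.
  set w := _ * _ * _ in hom *.
  have [cw|ncw] := eqVneq (#|A| + #|S|.-1 + #|B|)%N 2; last first.
    have w0 (T : {set 'I_n}) : #|T| = 2 -> w T = 0.
      by move=> cT; apply/eqP; apply: contraNT ncw => /hom <-; rewrite cT.
    split=> [T /w0->|T i j /andP[/eqP cT _] iT jT]; first by rewrite eqxx.
    by rewrite !w0 ?mulr0 //; [move: cT; rewrite (cardsD1 j) jT => -[] |
                               move: cT; rewrite (cardsD1 i) iT => -[]].
  have [A0 B0 S3] : [/\ A = set0, B = set0 & #|S| = 3].
    have sz : [/\ #|A| = 0, #|B| = 0 & #|S| = 3]%N.
      by split; lia.
    by case: sz => /eqP + /eqP +; rewrite !cards_eq0 => /eqP-> /eqP->.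
  have -> : w = ext_derive_base K S by rewrite /w A0 B0 [ext_base K set0 * _]mul1r [_ * ext_base K set0]mulr1.
  split=> [T cT|T i j lT iT jT].
    rewrite ext_deriveE => nz; exists S; first by rewrite /line_of S3 eqxx.
    apply/negPn/negP => nTS; case/negP: nz; rewrite big_pred0 // => j; apply/negP=> /andP[_ /eqP e].
    by case/negP: nTS; rewrite e subsetDl.
  have [eTS|neq] := eqVneq T S.
    by rewrite eTS in iT jT *; rewrite !ext_derive_facet // -!/(facet_sign _ _) !facet_signK.
  suff z k : k \in T -> ext_derive_base K S (T :\ k) = 0 by rewrite !z ?mulr0.
  move=> kT; rewrite ext_deriveE big_pred0 // => m; apply/negP=> /andP[mS /eqP e].
  case/eqP: neq; apply: lines_meet => //; first by rewrite /line_of S3 eqxx.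
  have /subset_leq_card : T :\ k \subset T :&: S by rewrite subsetI subsetDl e subsetDl.
  by case/andP: lT => /eqP; rewrite (cardsD1 k) kT => cT _; lia.
apply/andP; split; last exact/homog_grade.
(* The coefficient of the derivative of e_S in w, read off at any facet of S. *)
pose c S := if [pick j in S] is Some j then facet_sign S j * w (S :\ j) else 0.
have cE S j : line_of S -> j \in S -> c S = facet_sign S j * w (S :\ j).
  by rewrite /c => lS jS; case: pickP => [i iS|/(_ j)]; [exact: cw | rewrite jS].
suff -> : w = \sum_(S | line_of S) c S *: ext_derive_base K S.
  apply: memv_suml => S /andP[_ dS]; apply: memvZ.
  rewrite -[ext_derive_base K S]mulr1 -[ext_derive_base K S]mul1r.
  by rewrite memv_mul ?memvf // memv_mul ?memvf // memv_span // map_f // mem_enum.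
apply/ffunP=> B; rewrite sum_ffunE.
have [/eqP wB|nz] := boolP (w B == 0); last first.
  have [S lS BS] := sw B nz; have cB := hw B nz.
  have [j jS eB] : exists2 j, j \in S & B = S :\ j.
    have /cards1P[j e] : #|S :\: B| == 1%N.
      by rewrite cardsD (setIidPr BS) cB; case/andP: lS => /eqP->.
    have /setDP[jS jB] : j \in S :\: B by rewrite e set11.
    exists j => //; apply/eqP; rewrite eqEcard subsetD1 BS jB cB.
    by case/andP: lS => /eqP; rewrite (cardsD1 j) jS => cS _; lia.
  rewrite (bigD1 S) //= big1 ?addr0 => [|T /andP[lT neT]]; rewrite !ffunE; last first.
    rewrite ext_deriveE big_pred0 ?scaler0 // => i; apply/negP=> /andP[_ /eqP e].
    case/eqP: neT; apply: lines_meet => //.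
    have /subset_leq_card : B \subset T :&: S by rewrite subsetI BS e subsetDl.
    by rewrite cB.
  by rewrite (cE S j) // eB ext_derive_facet // /GRing.scale /= mulrAC facet_signK mul1r.
rewrite big1 // => S lS; rewrite !ffunE ext_deriveE.
have [|no] := pickP (fun j => (j \in S) && (B == S :\ j)); last first.
  by rewrite big_pred0 ?scaler0.
by move=> j /andP[jS /eqP eB]; rewrite (cE S j) // -eB wB mulr0 scale0r.
Qed.

Definition slice t A : exterior K n := [ffun B => t (A, B)].

Lemma slice_linear A a t t' : slice (a *: t + t') A = a *: slice t A + slice t' A.
Proof. by apply/ffunP=> B; rewrite !ffunE. Qed.

Definition syzygy_space : {vspace ext_tensor K n} :=
  (tensor_space (ext_grade K n 1) (OS_ideal_grade 2 alpha)
     :&: lker (linfun (@wedge K n)))%VS.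

Lemma tensor_slices t :
  t = \sum_(A : {set 'I_n}) tensor (ext_base K A) (slice t A).
Proof.
apply/ffunP=> -[A B]; rewrite sum_ffunE (bigD1 A) //= !ffunE eqxx mul1r.
by rewrite big1 ?addr0 // => A' neA; rewrite !ffunE /= eq_sym (negPf neA) mul0r.
Qed.

(** A tensor is the sum of the e_A (x) (its slice at A), so that membership can be
tested slice by slice. *)
Lemma mem_tensor_space t :
  t \in tensor_space (ext_grade K n 1) (OS_ideal_grade 2 alpha) <->
  (forall p, t p != 0 -> #|p.1| = 1) /\ (forall A, quadratic (slice t A)).
Proof.
split=> [|[h1 h2]].
  apply: (span_closed_ind (P := fun t => (forall p, t p != 0 -> #|p.1| = 1)
    /\ (forall A, quadratic (slice t A)))) => [|a u v [u1 u2] [v1 v2]|].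
  - split=> [p|A]; first by rewrite ffunE eqxx.
    have -> : slice 0 A = 0 by apply/ffunP=> B; rewrite !ffunE.
    by apply/quadratic_OS; rewrite mem0v.
  - split=> [p|A].
      rewrite !ffunE; have [/u1|/negPn/eqP->] := boolP (u p != 0); first by [].
      have [/v1|/negPn/eqP->] := boolP (v p != 0); first by [].
      by rewrite scaler0 addr0 eqxx.
    apply/quadratic_OS; rewrite slice_linear.
    by rewrite memvD ?memvZ //; exact/quadratic_OS.
  move=> _ /allpairsP[[u w] [/= uU wW ->]].
  have /homog_grade hu := vbasis_mem uU; have wI := vbasis_mem wW.
  split=> [p|A].
    by rewrite ffunE; have [->|/hu->//] := eqVneq (u p.1) 0; rewrite mul0r eqxx.
  apply/quadratic_OS; suff -> : slice (tensor u w) A = u A *: w by rewrite memvZ.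
  by apply/ffunP=> B; rewrite !ffunE.
rewrite (tensor_slices t); apply: memv_suml => A _.
have [cA|ncA] := eqVneq #|A| 1%N.
  by apply: tensor_spaceP; [apply/homog_grade; rewrite -cA; exact: homog_base | exact/quadratic_OS].
suff -> : tensor (ext_base K A) (slice t A) = 0 by rewrite mem0v.
apply/ffunP=> -[A' B]; rewrite !ffunE /=.
case: (A' == A); last by rewrite mul0r.
by have [->|/h1/eqP] := eqVneq (t (A, B)) 0; rewrite ?mulr0 // (negPf ncA).
Qed.

Lemma wedge_coef t S : (forall p, t p != 0 -> #|p.1| = 1) ->
  wedge t S = \sum_(j in S) facet_sign S j * t ([set j], S :\ j).
Proof.
move=> h1; rewrite /wedge sum_ffunE.
pose facet j : {set 'I_n} * {set 'I_n} := ([set j], S :\ j).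
rewrite (bigID (mem (facet @: S))) /= [X in _ + X]big1 ?addr0; last first.
  move=> [A B] nS; rewrite !ffunE /=.
  have [->|nz] := eqVneq (t (A, B)) 0; first by rewrite scale0r.
  have /cards1P[j eA] : #|A| == 1 by rewrite (h1 _ nz).
  rewrite [_ * _]ext_mul_base /ext_base_mul; case: ifP => [dAB|_]; last by rewrite ffunE scaler0.
  rewrite !ffunE; case: eqP => [eS|_]; last by rewrite !scaler0.
  case/imsetP: nS; exists j; first by rewrite eS eA !inE eqxx.
  by rewrite /facet eS eA setU1K //; move: dAB; rewrite eA disjoints1.
rewrite big_imset /= => [|i j _ _ [/set1_inj]//]; apply: eq_bigr => j jS.
rewrite !ffunE /= [_ * _]ext_mul_base /ext_base_mul disjoints1 in_setD1 eqxx /=.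
rewrite !ffunE setD1K // eqxx [_ *: 1]mulr1 mulrC; congr (_ * _).
rewrite /facet_sign /inversions; congr (_ ^+ _); apply/esym.
rewrite -(card_imset _ (f := fun i => (j, i))) => [|i k [] //].
apply: eq_card => -[a b]; apply/imsetP/idP => [[ i ]|].
  by rewrite inE => /andP[iS lt] [-> ->]; rewrite !inE /= eqxx iS lt neq_ltn lt.
rewrite !inE /= => /andP[/andP[/eqP-> /andP[nb bS]] lt]; exists b => //.
by rewrite inE bS.
Qed.

Lemma wedge_eq0 t : (t \in lker (linfun (@wedge K n))) = (wedge t == 0).
Proof. by rewrite memv_ker lfunE. Qed.

(** The sign of the permutation sorting x, y and z.  Since it is invariant under
cyclic rotation (orient_rot), all signs disappear from the relations between
the coordinates pair_coef and coef, which are indexed by ordered pairs. *)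
Definition orient (x y z : 'I_n) : K :=
  (-1) ^+ ((y < x) + (z < x) + (z < y))%N.

Lemma orientK x y z : orient x y z * orient x y z = 1.
Proof. by rewrite -expr2 sqrr_sign. Qed.

Lemma orient_rot x y z : x != y -> x != z -> y != z -> orient x y z = orient y z x.
Proof.
move=> xy xz yz; rewrite /orient -signr_odd -[RHS]signr_odd; congr (_ ^+ _).
have flip (a b : 'I_n) : a != b -> (b < a)%N = ~~ (a < b)%N.
  by move=> ab; rewrite -leqNgt [RHS]leq_eqVlt (inj_eq (@ord_inj n)) eq_sym (negPf ab).
rewrite (flip x y) // (flip x z) //.
by case: (x < y)%N; case: (x < z)%N; case: (z < y)%N.
Qed.

Definition pair_coef w (y z : 'I_n) : K :=
  if y == z then 0 else (-1) ^+ (z < y)%N * w [set y; z].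

Definition line3 (x y z : 'I_n) := line_of [set x; y; z].

Lemma card_set3 (x y z : 'I_n) :
  (#|[set x; y; z]| == 3) = [&& x != y, x != z & y != z].
Proof.
rewrite -setUA cardsU1 !inE cards2.
by case: (x == y); case: (x == z); case: (y == z).
Qed.

Lemma line3P x y z : line3 x y z ->
  [/\ x != y, x != z, y != z & line_of [set x; y; z]].
Proof. by move=> l; case/andP: (l); rewrite card_set3 => /and3P[]; split. Qed.

Lemma card3_set S : #|S| = 3 ->
  exists x y z, [/\ x != y, x != z, y != z & S = [set x; y; z]].
Proof.
case: (cards_eqP S) => -[|x [|y [|z []]]] //=.
rewrite !inE negb_or !andbT => /andP[/andP[xy xz] yz] _; exists x, y, z; split=> //.
by apply/setP=> u; rewrite !inE orbA.
Qed.

Lemma card3_third S (i j : 'I_n) : #|S| = 3 -> i \in S -> j \in S -> i != j ->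
  exists k, [/\ i != k, j != k & S = [set i; j; k]].
Proof.
move=> cS iS jS ij; have ijS : [set i; j] \subset S by rewrite subUset !sub1set iS.
have /cards1P[k e] : #|S :\: [set i; j]| == 1%N by rewrite cardsD (setIidPr ijS) cS cards2 ij.
have /setDP[kS] : k \in S :\: [set i; j] by rewrite e set11.
rewrite !inE negb_or => /andP[ki kj]; exists k; rewrite ![_ == k]eq_sym; split=> //.
apply/esym/eqP; rewrite eqEcard subUset ijS sub1set kS /= cS setUC cardsU1.
by rewrite !inE negb_or ki kj cards2 ij.
Qed.

Lemma set3_rot (x y z : 'I_n) : [set x; y; z] = [set y; z; x].
Proof. by apply/setP=> u; rewrite !inE -orbA orbC. Qed.

(** Compares the two sign conventions: up to the orientation of x, y, z, which
the three cyclic pairs have in common, the coordinate at an ordered pair is the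
coordinate at a facet with its sign in the derivative. *)
Lemma pair_coefE w x y z : x != y -> x != z -> y != z ->
  pair_coef w y z = orient x y z * (facet_sign [set x; y; z] x * w ([set x; y; z] :\ x)).
Proof.
move=> xy xz yz; rewrite /pair_coef (negPf yz) /orient /facet_sign.
have -> : [set x; y; z] :\ x = [set y; z].
  by rewrite -setUA setU1K // !inE negb_or xy xz.
rewrite mulrA -exprD; congr (_ * _); rewrite -signr_odd -[RHS]signr_odd; congr (_ ^+ _).
suff -> : #|[set i in [set x; y; z] | (i < x)%N]| = ((y < x) + (z < x))%N.
  by rewrite addnAC addnn oddD odd_double.
rewrite [#|_|](cardsD1 y) [#|_ :\ y|](cardsD1 z) !inE !eqxx (eq_sym z y) yz ?orbT /=.
rewrite addnA -[RHS]addn0; congr (_ + _)%N; apply: eq_card0 => i; rewrite !inE.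
by apply/negP=> /and4P[/negPf-> /negPf->]; rewrite !orbF => /eqP->; rewrite ltnn.
Qed.

Definition coef t (x y z : 'I_n) : K := pair_coef (slice t [set x]) y z.

Lemma pair_coefN w y z : pair_coef w z y = - pair_coef w y z.
Proof.
rewrite /pair_coef eq_sym setUC; have [_|ne] := eqVneq y z; first by rewrite oppr0.
rewrite -mulNr; congr (_ * _); move: ne; rewrite -(inj_eq (@ord_inj n)).
by case: ltngtP => // _ _; rewrite ?expr0 ?expr1 ?opprK.
Qed.

Lemma quadratic_pair_coef w : quadratic w ->
  (forall y z, pair_coef w y z != 0 -> exists u, line3 y z u) /\
  (forall y z u, line3 y z u -> pair_coef w z u = pair_coef w y z).
Proof.
case=> hw sw cw; split=> [y z|y z u l].
  rewrite /pair_coef; have [|yz] := eqVneq y z; first by rewrite eqxx.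
  rewrite mulf_eq0 negb_or => /andP[_ /sw[S lS yzS]].
  have [yS zS] : y \in S /\ z \in S by rewrite !(subsetP yzS) // !inE eqxx ?orbT.
  have cS : #|S| = 3 by case/andP: lS => /eqP.
  have [u [_ _ e]] := card3_third cS yS zS yz.
  by exists u; rewrite /line3 -e.
have /line3P[yz yu zu lS] := l.
have [uy uz] : u != y /\ u != z by rewrite ![u == _]eq_sym.
rewrite (@pair_coefE w y z u) // (@pair_coefE w u y z) // (set3_rot u) (@orient_rot u y z) //.
by rewrite (cw _ y u) ?inE ?eqxx ?orbT.
Qed.

Lemma coef_eq0 t : t \in syzygy_space -> (forall x y z, coef t x y z = 0) -> t = 0.
Proof.
rewrite memv_cap => /andP[/mem_tensor_space[h1 hq] _] z; apply/ffunP=> -[A B]; rewrite ffunE.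
apply/eqP; rewrite -[_ == _]negbK; apply/negP=> nz.
have /cards1P[x eA] : #|A| == 1%N by rewrite (h1 _ nz).
have [h2 _ _] := hq A; have /cards2P[a [b [ab eB]]] : #|B| == 2 by rewrite h2 ?ffunE.
have := z x a b; rewrite /coef /pair_coef (negPf ab) ffunE -eA -eB => /eqP.
by rewrite mulf_eq0 signr_eq0 (negPf nz).
Qed.

Lemma coef_linear a t t' x y z :
  coef (a *: t + t') x y z = a * coef t x y z + coef t' x y z.
Proof.
rewrite /coef /pair_coef; case: eqP => _; first by rewrite mulr0 addr0.
by rewrite !ffunE mulrDr mulrCA.
Qed.

Lemma sum3 (F : 'I_n -> K) x y z : x != y -> x != z -> y != z ->
  \sum_(j in [set x; y; z]) F j = F x + F y + F z.
Proof.
move=> xy xz yz; rewrite (big_setD1 x) ?inE ?eqxx //= -addrA; congr (_ + _).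
have -> : [set x; y; z] :\ x = [set y; z] by rewrite -setUA setU1K // !inE negb_or xy xz.
by rewrite big_setU1 ?inE // big_set1.
Qed.

(** The three products contributing to e_x e_y e_z are those with left factor e_x,
e_y and e_z, and cyclic rotation does not change the orientation. *)
Lemma wedge_coef3 t x y z : (forall p, t p != 0 -> #|p.1| = 1) ->
  x != y -> x != z -> y != z ->
  wedge t [set x; y; z] = orient x y z * (coef t x y z + coef t y z x + coef t z x y).
Proof.
move=> h1 xy xz yz; rewrite wedge_coef // sum3 //.
have sl u B : t ([set u], B) = slice t [set u] B by rewrite ffunE.
have [yx zx zy] : [/\ y != x, z != x & z != y] by rewrite ![z == _]eq_sym eq_sym.
rewrite /coef (@pair_coefE _ x y z) // (@pair_coefE _ y z x) // (@pair_coefE _ z x y) //.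
rewrite -!sl -(set3_rot x) (set3_rot z) -(@orient_rot x y z) // (@orient_rot z x y) //.
by rewrite -!mulrDr mulrA orientK mul1r.
Qed.

Lemma coef_syzygy t : t \in syzygy_space -> syzygy xpredT line3 (coef t).
Proof.
rewrite memv_cap wedge_eq0 => /andP[/mem_tensor_space[h1 hq] /eqP w0].
have antisym x y z : coef t x z y = - coef t x y z by exact: pair_coefN.
split=> // [x y z|x y z u|x y z].
- by have [c0 _] := quadratic_pair_coef (hq [set x]) => /c0.
- by have [_ c1] := quadratic_pair_coef (hq [set x]); exact: c1.
have diag a b : coef t a b b = 0 by rewrite /coef /pair_coef eqxx.
have [<-|xy] := eqVneq x y; first by rewrite diag addr0 antisym addNr.
have [<-|xz] := eqVneq x z; first by rewrite diag addr0 antisym addNr.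
have [<-|yz] := eqVneq y z; first by rewrite diag add0r antisym addNr.
have := wedge_coef3 h1 xy xz yz; rewrite w0 ffunE => /esym/eqP.
by rewrite mulf_eq0 signr_eq0 => /eqP.
Qed.

(** Together with coef_syzygy and coef_eq0, this identifies the Falk kernel with the
space of syzygies.  The tensor takes the value C x y z at e_x (x) e_y e_z for
y < z. *)
Lemma syzygy_coef C : syzygy xpredT line3 C ->
  exists2 t, t \in syzygy_space & forall x y z, coef t x y z = C x y z.
Proof.
case=> antisym c0 c1 cyc.
pose t : ext_tensor K n := [ffun p =>
  if [pick q : 'I_n * 'I_n * 'I_n | (q.1.2 < q.2)%N && (p == ([set q.1.1], [set q.1.2; q.2]))]
  is Some q then C q.1.1 q.1.2 q.2 else 0].
have tE (x y z : 'I_n) : (y < z)%N -> t ([set x], [set y; z]) = C x y z.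
  move=> yz; rewrite ffunE; case: pickP => [[[a b] c] /=|/(_ (x, y, z))]; last first.
    by rewrite /= yz eqxx.
  case/andP=> bc /eqP[/set1_inj -> e].
  have : b \in [set y; z] by rewrite e !inE eqxx.
  have : c \in [set y; z] by rewrite e !inE eqxx orbT.
  have : y \in [set b; c] by rewrite -e !inE eqxx.
  rewrite !inE => /orP[]/eqP ey /orP[]/eqP ec /orP[]/eqP eb; subst => //;
    by move: bc yz; rewrite ?ltnn //; case: ltngtP.
have C_diag x y : C x y y = 0.
  by apply/eqP; apply/negPn/negP=> /c0[_ [u /line3P[]]]; rewrite eqxx.
have coefE x y z : coef t x y z = C x y z.
  rewrite /coef /pair_coef; have [->|] := eqVneq y z; first by rewrite C_diag.
  rewrite -(inj_eq (@ord_inj n)) ffunE; case: ltngtP => // yz _.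
    by rewrite /= expr1 mulN1r setUC tE // antisym opprK.
  by rewrite /= expr0 mul1r tE.
have t1 p : t p != 0 -> exists x y z : 'I_n, [/\ p = ([set x], [set y; z]), (y < z)%N & C x y z != 0].
  rewrite ffunE; case: pickP => [[[a b] c] /= /andP[bc /eqP ->] nz|]; last by rewrite eqxx.
  by exists a, b, c.
clearbody t.
have h1 p : t p != 0 -> #|p.1| = 1%N by move=> /t1[x [y [z [-> _ _]]]]; rewrite cards1.
exists t => //; rewrite memv_cap wedge_eq0; apply/andP; split; last first.
  apply/eqP/ffunP=> S; rewrite ffunE; have [/eqP cS|ncS] := boolP (#|S| == 3).
    have [x [y [z [xy xz yz ->]]]] := card3_set cS.
    by rewrite wedge_coef3 // !coefE cyc mulr0.
  rewrite wedge_coef // big1 // => j jS; apply/eqP; rewrite mulf_eq0; apply/orP; right.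
  apply: contraR ncS => /t1[x [y [z [[ej eS] yz _]]]].
  by rewrite (cardsD1 j) jS eS cards2 -(inj_eq (@ord_inj n)) neq_ltn yz.
apply/mem_tensor_space; split=> // A; split=> [B|B|S i j lS iS jS]; rewrite ?ffunE.
- by move=> /t1[x [y [z [[_ ->] yz _]]]]; rewrite cards2 -(inj_eq (@ord_inj n)) neq_ltn yz.
- move=> /t1[x [y [z [[_ ->] yz /c0[_ [u l]]]]]]; exists [set y; z; u]; last exact: subsetUl.
  by case/line3P: l.
have [x eA|noA] := pickP (fun x => A == [set x]); last first.
  have t0 B : t (A, B) = 0.
    apply/eqP; apply: contraFT (noA (odflt i [pick x in A])) => /t1[x [y [z [[-> _] _ _]]]].
    by case: pickP => [u /set1P->|/(_ x)] //; rewrite !inE eqxx.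
  by rewrite !t0 !mulr0.
rewrite (eqP eA) => {A eA}; have [->//|ij] := eqVneq i j.
have cS : #|S| = 3 by case/andP: lS => /eqP.
have [k [ki kj eS]] := card3_third cS iS jS ij.
have slE u : t ([set x], u) = slice t [set x] u by rewrite ffunE.
have l : line3 j k i by rewrite /line3 set3_rot set3_rot -eS.
have pcE (u v : 'I_n) : pair_coef (slice t [set x]) u v = C x u v by exact: coefE.
have ji : j != i by rewrite eq_sym.
have kj' : k != i by rewrite eq_sym.
have := pair_coefE (slice t [set x]) ij ki kj.
have := pair_coefE (slice t [set x]) kj ji kj'.
rewrite !pcE (c1 _ _ _ _ l) -(set3_rot i) -eS -(@orient_rot i j k) // !ffunE => -> /eqP.
rewrite -[X in X == _]mulr1 -subr_eq0 mulr1 -mulrBr mulf_eq0 signr_eq0 subr_eq0.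
by move=> /eqP.
Qed.

End OrlikSolomon.

(** * Model configurations and their syzygies *)

Section Propagation.
Variables (n : nat) (third : nat -> nat -> option nat).

(** Boolean functions are stored as nested lists, so that each round of propagation
is computed once and not again at every later lookup. *)
Definition tabulate (f : nat -> nat -> nat -> bool) : seq (seq (seq bool)) :=
  mkseq (fun x => mkseq (fun y => mkseq (f x y) n) n) n.

Definition lookup (Z : seq (seq (seq bool))) x y z : bool :=
  nth false (nth [::] (nth [::] Z x) y) z.

Lemma lookup_tabulate f x y z : lookup (tabulate f) x y z ->
  [/\ (x < n)%N, (y < n)%N, (z < n)%N & f x y z].
Proof.
rewrite /lookup /tabulate; case: (ltnP x n) => [xn|nx]; last first.
  by rewrite [nth _ _ x]nth_default ?size_mkseq // !nth_nil.
rewrite nth_mkseq //; case: (ltnP y n) => [yn|ny]; last first.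
  by rewrite [nth _ _ y]nth_default ?size_mkseq // !nth_nil.
rewrite nth_mkseq //; case: (ltnP z n) => [zn|nz]; last first.
  by rewrite [nth _ _ z]nth_default ?size_mkseq.
by rewrite nth_mkseq.
Qed.

(** One round of deductions from the triples at which a syzygy is known to vanish:
antisymmetry, equality along a line (a pair on no line gives 0), and the
three-term relation with two vanishing terms. *)
Definition propagate_step Z :=
  tabulate (fun x y z =>
    [|| lookup Z x y z, lookup Z x z y,
        if third y z is Some u then lookup Z x z u else true
      | lookup Z y z x && lookup Z z x y]).

Definition propagate fuel Z := iter fuel propagate_step Z.

Lemma propagateP (K : fieldType) (v : nat -> nat -> nat -> K) fuel Z :
  (forall x y z, (x < n)%N -> (y < n)%N -> (z < n)%N ->
     [/\ v x z y = - v x y z,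
         if third y z is Some u then v x z u = v x y z else v x y z = 0
       & v x y z + v y z x + v z x y = 0]) ->
  (forall x y z, lookup Z x y z -> v x y z = 0) ->
  forall x y z, lookup (propagate fuel Z) x y z -> v x y z = 0.
Proof.
move=> hv hZ; elim: fuel => [//|fuel IH] x y z /lookup_tabulate[xn yn zn].
have [anti th cyc] := hv x y z xn yn zn.
case/or4P=> [/IH//|/IH|h|/andP[/IH h1 /IH h2]].
- by rewrite anti => /eqP; rewrite oppr_eq0 => /eqP.
- by case: (third y z) th h => [u <- /IH|].
by move: cyc; rewrite h1 h2 !addr0.
Qed.

End Propagation.

(** An entry (x, (a, b, c), v) records the value v at x and the cyclic pairs (a, b),
(b, c), (c, a) of a line, and so the value - v at the reversed pairs. *)
Definition table := seq (nat * (nat * nat * nat) * int).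

(** An abstract configuration of points and lines, with the triples at which
syzygies are evaluated and the tables of the dual basis of syzygies. *)
Record model := Model {
  npts : nat;
  mlines : seq (nat * nat * nat);
  mfuns : seq (nat * nat * nat);
  mtabs : seq table
}.

Definition mline (m : model) (i j k : nat) : bool :=
  has (fun l : nat * nat * nat => let: (a, b, c) := l in
    (i, j, k) \in [:: (a, b, c); (b, c, a); (c, a, b); (a, c, b); (c, b, a); (b, a, c)])
    (mlines m).

Definition entry (e : nat * (nat * nat * nat) * int) (i j k : nat) : int :=
  let: (x, (a, b, c), v) := e in
  if x != i then 0
  else if (j, k) \in [:: (a, b); (b, c); (c, a)] then v
  else if (k, j) \in [:: (a, b); (b, c); (c, a)] then - v else 0.

Definition tab (T : table) (i j k : nat) : int :=
  foldr (fun e r => entry e i j k + r) 0 T.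

Definition is_line_model m := npts m == 3.

Definition mthird m j k := ohead [seq u <- iota 0 (npts m) | mline m j k u].

(** The zeros from which propagation starts are the evaluation triples and, except
in a line, the triples (i; j, k) with i on the line through j and k: those
belong to the configuration formed by that line. *)
Definition init m :=
  tabulate (npts m) (fun i j k =>
    ((i, j, k) \in mfuns m) ||
    (~~ is_line_model m && [|| i == j, i == k | mline m j k i])).

(** The range has one index more than there are points, because the index of a
foreign point in the list of points of a configuration is the length of that
list. *)
Definition table_ok m (T : table) :=
  let R := iota 0 (npts m).+1 in
  all (fun i => all (fun j => all (fun k =>
    [&& tab T i k j == - tab T i j k,
        (tab T i j k != 0) ==> [&& (i < npts m)%N, (j < npts m)%N, (k < npts m)%N
                                 & isSome (mthird m j k)],
        all (fun u => mline m j k u ==> (tab T i k u == tab T i j k)) R,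
        tab T i j k + tab T j k i + tab T k i j == 0
      & (~~ is_line_model m && [|| i == j, i == k | mline m j k i]) ==> (tab T i j k == 0)])
    R) R) R.

(** The tables are syzygies dual to the evaluations, and a syzygy killed by all
evaluations vanishes; the latter is detected by fifteen rounds of
propagation, which reach every triple in the models below. *)
Definition model_ok m :=
  let R := iota 0 (npts m) in
  [&& size (mfuns m) == size (mtabs m),
      all (table_ok m) (mtabs m),
      all (fun a => all (fun b =>
        let: (i, j, k) := nth (0, 0, 0)%N (mfuns m) a in
        tab (nth [::] (mtabs m) b) i j k == (a == b)%:Z)
        (iota 0 (size (mfuns m)))) (iota 0 (size (mfuns m))),
      all (fun f : nat * nat * nat => let: (i, j, k) := f in
        [&& (i < npts m)%N, (j < npts m)%N, (k < npts m)%N, i != j, i != k, j != k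
          & (mline m i j k == is_line_model m)]) (mfuns m),
      all (fun l : nat * nat * nat => let: (i, j, k) := l in
        [&& (i < npts m)%N, (j < npts m)%N & (k < npts m)%N]) (mlines m),
      is_line_model m ==> all (fun i => all (fun j => all (fun k =>
        [&& i != j, i != k & j != k] ==> mline m i j k) R) R) R
    & let Z := propagate (npts m) (mthird m) 15 (init m) in
      all (fun i => all (fun j => all (fun k =>
        isSome (mthird m j k) ==> lookup Z i j k) R) R) R].

(** On a single line the relations say that the values at the three points add up to
0. *)
Definition line_model := Model 3 [:: (0, 1, 2)]%N [:: (0, 1, 2); (1, 2, 0)]%N
  [:: [:: (0%N, (0, 1, 2)%N, 1); (2%N, (0, 1, 2)%N, -1)];
      [:: (1%N, (0, 1, 2)%N, 1); (2%N, (0, 1, 2)%N, -1)]].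

(** The complete quadrilateral: four lines in general position and their six
intersection points. *)
Definition quad_model := Model 6
  [:: (0, 1, 3); (0, 2, 4); (1, 2, 5); (3, 4, 5)]%N
  [:: (2, 0, 1); (4, 0, 1)]%N
  [:: [:: (2%N, (0, 1, 3)%N, 1); (5%N, (0, 1, 3)%N, -1);
          (3%N, (0, 2, 4)%N, -1); (5%N, (0, 2, 4)%N, 1);
          (0%N, (1, 2, 5)%N, -1); (3%N, (1, 2, 5)%N, 1);
          (0%N, (3, 4, 5)%N, 1); (2%N, (3, 4, 5)%N, -1)];
      [:: (4%N, (0, 1, 3)%N, 1); (5%N, (0, 1, 3)%N, -1);
          (1%N, (0, 2, 4)%N, -1); (5%N, (0, 2, 4)%N, 1);
          (0%N, (1, 2, 5)%N, -1); (4%N, (1, 2, 5)%N, 1);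
          (0%N, (3, 4, 5)%N, 1); (1%N, (3, 4, 5)%N, -1)]].

(** The non-Fano plane.  It contains quadrilaterals, and its local kernel of
dimension 5 contains theirs. *)
Definition nonfano_model := Model 7
  [:: (0, 1, 6); (0, 2, 4); (0, 3, 5); (1, 2, 5); (1, 3, 4); (2, 3, 6)]%N
  [:: (2, 0, 1); (3, 0, 1); (4, 0, 1); (1, 0, 2); (3, 0, 2)]%N
  [:: [:: (2%N, (0, 1, 6)%N, 1); (5%N, (0, 1, 6)%N, -1);
          (2%N, (0, 3, 5)%N, 1); (6%N, (0, 3, 5)%N, -1);
          (0%N, (1, 2, 5)%N, -1); (6%N, (1, 2, 5)%N, 1);
          (0%N, (2, 3, 6)%N, 1); (5%N, (2, 3, 6)%N, -1)];
      [:: (3%N, (0, 1, 6)%N, 1); (5%N, (0, 1, 6)%N, -1);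
          (1%N, (0, 3, 5)%N, 1); (6%N, (0, 3, 5)%N, -1);
          (3%N, (1, 2, 5)%N, -1); (6%N, (1, 2, 5)%N, 1);
          (1%N, (2, 3, 6)%N, 1); (5%N, (2, 3, 6)%N, -1)];
      [:: (4%N, (0, 1, 6)%N, 1); (5%N, (0, 1, 6)%N, -1);
          (5%N, (0, 2, 4)%N, -1); (6%N, (0, 2, 4)%N, 1);
          (1%N, (0, 3, 5)%N, 1); (2%N, (0, 3, 5)%N, 1);
          (4%N, (0, 3, 5)%N, -1); (6%N, (0, 3, 5)%N, -1);
          (4%N, (1, 2, 5)%N, -1); (6%N, (1, 2, 5)%N, 1);
          (0%N, (1, 3, 4)%N, 1); (2%N, (1, 3, 4)%N, 1);
          (5%N, (1, 3, 4)%N, -1); (6%N, (1, 3, 4)%N, -1);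
          (0%N, (2, 3, 6)%N, 1); (1%N, (2, 3, 6)%N, 1);
          (4%N, (2, 3, 6)%N, -1); (5%N, (2, 3, 6)%N, -1)];
      [:: (1%N, (0, 2, 4)%N, 1); (5%N, (0, 2, 4)%N, -1);
          (1%N, (0, 3, 5)%N, 1); (4%N, (0, 3, 5)%N, -1);
          (0%N, (1, 2, 5)%N, 1); (4%N, (1, 2, 5)%N, -1);
          (0%N, (1, 3, 4)%N, 1); (5%N, (1, 3, 4)%N, -1)];
      [:: (3%N, (0, 2, 4)%N, 1); (5%N, (0, 2, 4)%N, -1);
          (2%N, (0, 3, 5)%N, 1); (4%N, (0, 3, 5)%N, -1);
          (3%N, (1, 2, 5)%N, 1); (4%N, (1, 2, 5)%N, -1);
          (2%N, (1, 3, 4)%N, 1); (5%N, (1, 3, 4)%N, -1)] ].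

Lemma all_iotaP (p : pred nat) n :
  reflect (forall i, (i < n)%N -> p i) (all p (iota 0 n)).
Proof.
by apply: (iffP allP) => h i; have := h i; rewrite mem_iota add0n.
Qed.

Lemma mthirdP m j k :
  if mthird m j k is Some u then (u < npts m)%N /\ mline m j k u
  else forall u, (u < npts m)%N -> ~~ mline m j k u.
Proof.
rewrite /mthird; case e : [seq _ <- _ | _] => [|u r] /=.
  move=> u un; apply/negP=> l; have : u \in [seq u <- iota 0 (npts m) | mline m j k u].
    by rewrite mem_filter l mem_iota.
  by rewrite e.
have : u \in [seq u <- iota 0 (npts m) | mline m j k u] by rewrite e mem_head.
by rewrite mem_filter mem_iota add0n => /andP[].
Qed.

Lemma table_okP m T i j k : table_ok m T ->
  (i <= npts m)%N -> (j <= npts m)%N -> (k <= npts m)%N ->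
  [/\ tab T i k j = - tab T i j k,
      tab T i j k != 0 -> [/\ (i < npts m)%N, (j < npts m)%N, (k < npts m)%N &
                             exists2 u, (u < npts m)%N & mline m j k u],
      forall u, (u <= npts m)%N -> mline m j k u -> tab T i k u = tab T i j k,
      tab T i j k + tab T j k i + tab T k i j = 0
    & ~~ is_line_model m -> [|| i == j, i == k | mline m j k i] -> tab T i j k = 0].
Proof.
move=> /all_iotaP ok /ok/all_iotaP{}ok /ok/all_iotaP{}ok /ok.
case/and5P=> /eqP anti /implyP nz /all_iotaP th /eqP cyc /implyP z; split=> //.
- case/nz/and4P=> -> -> ->; have := mthirdP m j k.
  by case: (mthird m j k) => // u [un l] _; split=> //; exists u.
- by move=> u un /(implyP (th u un))/eqP.
- by move=> nl h; apply/eqP/z; rewrite nl.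
Qed.

Section Configurations.
Variables (K : fieldType) (P : eqType) (p0 : P) (A : pred P) (line : P -> P -> P -> bool).
Hypotheses (line_mem : forall x y z, line x y z -> A x)
  (line_neq : forall x y z, line x y z -> x != y)
  (line_rot : forall x y z, line x y z = line y z x)
  (line_swap : forall x y z, line x y z = line x z y)
  (line_third : forall x y z u, line x y z -> line x y u -> z = u).
(* A family of configurations s j, with models md j, such that each line is one of
them, each triple in the support of a syzygy lies in one of them, and a triple is
in at most one of them that is of the appropriate sort: a line for collinear
triples, a quadrilateral or non-Fano plane otherwise. *)
Variables (J : finType) (Js : {set J}) (md : J -> model) (s : J -> seq P).
Hypotheses (md_ok : forall j, j \in Js -> model_ok (md j))
  (s_uniq : forall j, j \in Js -> uniq (s j))
  (s_size : forall j, j \in Js -> size (s j) = npts (md j))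
  (s_mem : forall j, j \in Js -> {subset s j <= A})
  (s_line : forall j, j \in Js -> {in s j & &, forall x y z,
     line x y z = mline (md j) (index x (s j)) (index y (s j)) (index z (s j))}).
Hypothesis line_conf : forall x y z, line x y z ->
  exists2 j, j \in Js & is_line_model (md j) /\ [/\ x \in s j, y \in s j & z \in s j].
Hypothesis conf_cover : forall (C : P -> P -> P -> K) x y z u, syzygy A line C ->
  C x y z != 0 -> line y z u -> x \notin [:: y; z; u] ->
  exists2 j, j \in Js & ~~ is_line_model (md j) /\
    [/\ x \in s j, y \in s j, z \in s j & u \in s j].
Hypothesis conf_unique : forall i j x y z, i \in Js -> j \in Js ->
  [/\ x \in s i, y \in s i & z \in s i] -> [/\ x \in s j, y \in s j & z \in s j] ->
  [/\ x != y, x != z & y != z] ->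
  line x y z = is_line_model (md i) -> line x y z = is_line_model (md j) -> i = j.

Definition conf_tab j a := nth [::] (mtabs (md j)) a.

(** The table of the model carried over to the points of s j.  A point outside of
s j has an index beyond the range of the table and gets the value 0. *)
Definition conf_vect j a (x y z : P) : K :=
  (tab (conf_tab j a) (index x (s j)) (index y (s j)) (index z (s j)))%:~R.

Definition conf_eval j a (C : P -> P -> P -> K) : K :=
  let: (x, y, z) := nth (0, 0, 0)%N (mfuns (md j)) a in
  C (nth p0 (s j) x) (nth p0 (s j) y) (nth p0 (s j) z).

Lemma conf_vect_table j a x y z : j \in Js -> (a < size (mfuns (md j)))%N ->
  [/\ conf_vect j a x z y = - conf_vect j a x y z,
      conf_vect j a x y z != 0 -> [/\ x \in s j, y \in s j, z \in s j &
        exists2 u, u \in s j & line y z u],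
      forall u, u \in s j -> mline (md j) (index y (s j)) (index z (s j)) (index u (s j)) ->
        conf_vect j a x z u = conf_vect j a x y z,
      conf_vect j a x y z + conf_vect j a y z x + conf_vect j a z x y = 0
    & ~~ is_line_model (md j) -> x \in s j -> y \in s j -> z \in s j ->
      line y z x -> conf_vect j a x y z = 0].
Proof.
move=> jJ aj; have ok := md_ok jJ; have sz := s_size jJ.
have tok : table_ok (md j) (conf_tab j a).
  case/and5P: ok => /eqP sz2 /allP tok _ _ _; apply: tok; apply: mem_nth.
  by rewrite -sz2.
have le u : (index u (s j) <= npts (md j))%N by rewrite -sz index_size.
have [anti nz th cyc z0] := table_okP tok (le x) (le y) (le z).
rewrite /conf_vect; split.
- by rewrite anti rmorphN.
- move=> h; case: nz => [|xs ys zs [u us l]]; first by apply: contraNneq h => ->.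
  move: xs ys zs us; rewrite -sz !index_mem => xs ys zs us.
  split=> //; exists (nth p0 (s j) u); first by rewrite mem_nth.
  by rewrite (s_line jJ) // ?mem_nth // index_uniq // s_uniq.
- by move=> u us l; rewrite th.
- by rewrite -!rmorphD /= cyc.
- by move=> nl xs ys zs l; rewrite z0 //; move: l; rewrite (s_line jJ) // => ->; rewrite !orbT.
Qed.

(** Where a table does not vanish, the third point of the line belongs to the
configuration too; by uniqueness of the third point, lines that are only partly
contained in s j do not see the table. *)
Lemma conf_vect_syzygy j a : j \in Js -> (a < size (mfuns (md j)))%N ->
  syzygy A line (conf_vect j a).
Proof.
move=> jJ aj; split=> [x y z|x y z|x y z u l|x y z]; have := conf_vect_table _ _ _ jJ aj.
- by case/(_ x y z).
- by case/(_ x y z)=> _ h _ _ _ /h[xs _ _ [u _ l]]; split; [exact: s_mem xs | exists u].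
- move=> h; suff all_in : conf_vect j a x y z != 0 \/ conf_vect j a x z u != 0 ->
      [/\ y \in s j, z \in s j & u \in s j].
    have [/eqP e1|n1] := boolP (conf_vect j a x y z == 0).
      have [/eqP e2|n2] := boolP (conf_vect j a x z u == 0); first by rewrite e1 e2.
      have [ys zs us] := all_in (or_intror n2); have [_ _ th _ _] := h x y z.
      by apply: th => //; rewrite -s_line.
    have [ys zs us] := all_in (or_introl n1); have [_ _ th _ _] := h x y z.
    by apply: th => //; rewrite -s_line.
  case=> nz.
    have [_ /(_ nz)[xs ys zs [w ws l']] _ _ _] := h x y z.
    by split=> //; rewrite (line_third l l').
  have [_ /(_ nz)[xs zs us [w ws l']] _ _ _] := h x z u.
  by split=> //; rewrite (@line_third z u y w) // -line_rot.
- by case/(_ x y z).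
Qed.

Lemma model_funs j a x y z : j \in Js -> (a < size (mfuns (md j)))%N ->
  nth (0, 0, 0)%N (mfuns (md j)) a = (x, y, z) ->
  [/\ [/\ (x < size (s j))%N, (y < size (s j))%N & (z < size (s j))%N],
      [/\ x != y, x != z & y != z]
    & mline (md j) x y z = is_line_model (md j)].
Proof.
move=> jJ aj e; rewrite s_size //; case/and5P: (md_ok jJ) => _ _ _ /allP ok _.
have := ok _ (mem_nth (0, 0, 0)%N aj); rewrite e.
by case/and5P=> -> -> -> -> /and3P[-> -> /eqP ->].
Qed.

(** A nonzero value puts the evaluation triple of i inside s j, and a triple
determines its configuration, so i = j; within one configuration the duality is
that of the model. *)
Lemma conf_eval_vect i a j b : i \in Js -> (a < size (mfuns (md i)))%N ->
  j \in Js -> (b < size (mfuns (md j)))%N ->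
  conf_eval i a (conf_vect j b) = ((i == j) && (a == b))%:R.
Proof.
move=> iJ ai jJ bj; rewrite /conf_eval; case e : (nth _ _ a) => [[x y] z].
have [[xs ys zs] [xy xz yz] l] := model_funs iJ ai e.
have [eij|ne] := eqVneq i j.
  subst i; rewrite /conf_vect !index_uniq ?s_uniq //= /conf_tab.
  case/and5P: (md_ok jJ) => _ _ /all_iotaP /(_ a ai) /all_iotaP /(_ b bj) + _ _.
  by rewrite e => /eqP->; case: (a == b).
apply/eqP; apply: contraNT ne => nz; apply/eqP.
have [_ /(_ nz)[xs' ys' zs' [u us' l']] _ _ z0] := conf_vect_table (nth p0 (s i) x)
  (nth p0 (s i) y) (nth p0 (s i) z) jJ bj.
have d (v w : nat) : (v < size (s i))%N -> (w < size (s i))%N -> v != w ->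
  nth p0 (s i) v != nth p0 (s i) w by move=> vs ws; rewrite nth_uniq // s_uniq.
have li : line (nth p0 (s i) x) (nth p0 (s i) y) (nth p0 (s i) z) = is_line_model (md i).
  by rewrite (s_line iJ) ?mem_nth // !index_uniq ?s_uniq.
apply: (conf_unique iJ jJ (x := nth p0 (s i) x) (y := nth p0 (s i) y) (z := nth p0 (s i) z));
  rewrite ?mem_nth //; first by split; apply: d.
have [lj|nlj] := boolP (is_line_model (md j)).
  case/and5P: (md_ok jJ) => _ _ _ _ /and3P[_ /implyP/(_ lj) /all_iotaP ok _].
  rewrite (s_line jJ) //; rewrite -!index_mem !s_size // in xs' ys' zs'.
  have /all_iotaP/(_ _ ys')/all_iotaP/(_ _ zs')/implyP-> // := ok _ xs'.
  have inj v w : v \in s j -> (index v (s j) == index w (s j)) = (v == w).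
    move=> vs; apply/eqP/eqP => [ei|->//]; have := nth_index p0 vs; rewrite ei nth_index //.
    by rewrite -index_mem -ei index_mem.
  by rewrite !inj -?index_mem ?s_size // !d.
apply/negbTE; apply: contra nz => l3; apply/eqP/z0 => //.
by rewrite -line_rot.
Qed.

(** Inside a configuration that is closed under the lines in the support of C,
propagation shows C = 0.  This applies to lines first, and then, C being 0 at
the triples whose point is on the line of the pair, to the configurations
covering the rest of the support: these are closed because a non-collinear
triple determines its configuration. *)
Lemma conf_separate C : syzygy A line C ->
  (forall j a, j \in Js -> (a < size (mfuns (md j)))%N -> conf_eval j a C = 0) ->
  forall x y z, C x y z = 0.
Proof.
move=> sC ev0; have [anti nzC thC cycC] := sC.
(* Propagation inside one configuration. *)
have local j : j \in Js ->
    {in s j & &, forall x y z, C x y z != 0 -> exists2 u, u \in s j & line y z u} ->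
    (~~ is_line_model (md j) -> {in s j & &, forall x y z,
       line y z x -> C x y z = 0 /\ C y y z = 0 /\ C z y z = 0}) ->
  {in s j & &, forall x y z, C x y z = 0}.
  move=> jJ closed col0 x y z xs ys zs.
  case/and5P: (md_ok jJ) => _ _ _ /allP fok /and3P[_ _ /all_iotaP sep].
  have [//|nz] := eqVneq (C x y z) 0.
  have [u us l] := closed _ _ _ xs ys zs nz.
  pose v a b c := C (nth p0 (s j) a) (nth p0 (s j) b) (nth p0 (s j) c).
  have vE a : a \in s j -> nth p0 (s j) (index a (s j)) = a by move=> ?; rewrite nth_index.
  have lE a b c : (a < npts (md j))%N -> (b < npts (md j))%N -> (c < npts (md j))%N ->
      line (nth p0 (s j) a) (nth p0 (s j) b) (nth p0 (s j) c) = mline (md j) a b c.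
    rewrite -s_size // => aj bj cj; rewrite (s_line jJ) ?mem_nth // !index_uniq ?s_uniq //.
  suff : v (index x (s j)) (index y (s j)) (index z (s j)) = 0 by rewrite /v !vE.
  have lt w : w \in s j -> (index w (s j) < npts (md j))%N by rewrite -s_size // index_mem.
  apply: (propagateP (n := npts (md j)) (third := mthird (md j)) (fuel := 15) (Z := init (md j))).
  - move=> a b c aj bj cj; rewrite /v; split; [exact: anti | | exact: cycC].
    have := mthirdP (md j) b c; case: (mthird _ _ _) => [w [wj lw]|no].
      by apply: thC; rewrite lE.
    apply/eqP/negPn/negP=> nz'; rewrite -s_size // in aj bj cj.
    have [w ws lw] := closed _ _ _ (mem_nth _ aj) (mem_nth _ bj) (mem_nth _ cj) nz'.
    case/negP: (no _ (lt _ ws)); rewrite -lE -?s_size // ?index_mem //.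
    by rewrite vE.
  - move=> a b c /lookup_tabulate[aj bj cj /orP[fm|/andP[nl col]]].
      have := nth_index (0, 0, 0)%N fm; have := index_mem (a, b, c) (mfuns (md j)); rewrite fm.
      by move=> ai ei; have := ev0 _ _ jJ ai; rewrite /conf_eval ei.
    rewrite /v; have [//|nz'] := eqVneq (C (nth p0 (s j) a) (nth p0 (s j) b) (nth p0 (s j) c)) 0.
    rewrite -s_size // in aj bj cj.
    have [w ws lw] := closed _ _ _ (mem_nth _ aj) (mem_nth _ bj) (mem_nth _ cj) nz'.
    have [c1 [c2 c3]] := col0 nl _ _ _ ws (mem_nth p0 bj) (mem_nth p0 cj) lw.
    case/or3P: col => [/eqP->|/eqP->|l3] //.
    by have [] := col0 nl _ _ _ (mem_nth p0 aj) (mem_nth p0 bj) (mem_nth p0 cj) _; rewrite // lE // -s_size.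
  have /all_iotaP/(_ _ (lt _ ys))/all_iotaP/(_ _ (lt _ zs))/implyP := sep _ (lt _ xs).
  apply; have := mthirdP (md j) (index y (s j)) (index z (s j)); case: (mthird _ _ _) => // no.
  by case/negP: (no _ (lt _ us)); rewrite -lE ?lt // !vE.
(* Points on the line of the pair: the line itself is a configuration. *)
have col0 x y z : line x y z -> forall w, w \in [:: x; y; z] -> C w y z = 0.
  move=> l w wl; have [j jJ [lj [xs ys zs]]] := line_conf l.
  apply: (local j jJ) => //; last 2 first.
  - by rewrite lj.
  - by move: wl; rewrite !inE => /or3P[]/eqP->.
  move=> a b c as_ bs cs nz; have [_ [u lu]] := nzC _ _ _ nz.
  have bc : b != c by exact: line_neq lu.
  case/and5P: (md_ok jJ) => _ _ _ _ /and3P[_ /implyP/(_ lj) /all_iotaP ok _].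
  have [k ks [kb kc]] : exists2 k, k \in s j & k != b /\ k != c.
    have xy := line_neq l; have yz : y != z by move: l; rewrite line_rot; exact: line_neq.
    have xz : x != z by move: l; rewrite line_swap; exact: line_neq.
    have [e1|n1] := boolP ((x != b) && (x != c)); first by exists x => //; apply/andP.
    have [e2|n2] := boolP ((y != b) && (y != c)); first by exists y => //; apply/andP.
    exists z => //; move: n1 n2; rewrite !negb_and !negbK.
    by move=> /orP[]/eqP ? /orP[]/eqP ?; subst; rewrite ?eqxx in xy xz yz *; split; rewrite // eq_sym.
  exists k => //; rewrite (s_line jJ) //.
  have lt w' : w' \in s j -> (index w' (s j) < npts (md j))%N by rewrite -s_size // index_mem.
  have /all_iotaP/(_ _ (lt _ cs))/all_iotaP/(_ _ (lt _ ks))/implyP-> // := ok _ (lt _ bs).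
  have inj v w' : v \in s j -> w' \in s j -> (index v (s j) == index w' (s j)) = (v == w').
    move=> vs ws; apply/eqP/eqP => [ei|->//].
    by rewrite -(nth_index p0 vs) ei nth_index.
  by rewrite !inj // bc !(eq_sym _ k) kb.
move=> x y z; have [//|nz] := eqVneq (C x y z) 0.
have [_ [u lu]] := nzC _ _ _ nz.
have col w : line y z w -> x \in [:: w; y; z] -> C x y z = 0.
  by move=> lw; apply: col0; rewrite line_rot.
have [xl|xnl] := boolP (x \in [:: u; y; z]); first exact: col lu xl.
have xnl' : x \notin [:: y; z; u] by move: xnl; rewrite !inE orbC orbA.
have [j jJ [nlj [xs ys zs us]]] := conf_cover sC nz lu xnl'.
apply: (local j jJ) => // [a b c as_ bs cs nz'|_ a b c as_ bs cs l].
  have [_ [w lw]] := nzC _ _ _ nz'; exists w => //.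
  have [al|anl] := boolP (a \in [:: w; b; c]).
    by case/eqP: nz'; apply: (col0 w b c) => //; rewrite line_rot.
  have anl' : a \notin [:: b; c; w] by move: anl; rewrite !inE orbC orbA.
  have [k kJ [nlk [ak bk ck wk]]] := conf_cover sC nz' lw anl'.
  (* The point w lies in a configuration k with a, b, c, which is j. *)
  suff -> : j = k by [].
  have nl : line a b c = false.
    apply/negP=> l; case/negP: anl; rewrite -(line_third lw (_ : line b c a)) ?mem_head //.
    by rewrite -line_rot.
  apply: (conf_unique jJ kJ (x := a) (y := b) (z := c)); rewrite ?nl ?(negPf nlj) ?(negPf nlk) //.
  by move: anl; rewrite !inE !negb_or => /and3P[_ -> ->]; rewrite (line_neq lw).
have lab : line a b c by rewrite line_rot.
by do !split; apply: (col0 a b c) => //; rewrite !inE eqxx ?orbT.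
Qed.

End Configurations.

Local Close Scope ring_scope.

(** * Signed edges as codes, and the finite checks on them *)

(** The code (i, j, s) with i <= j stands for the edge between i and j, negative if
s holds.  A loop at i is coded as a negative edge from i to itself: its form
x_i + x_i has the same kernel as x_i, and switching leaves it unchanged. *)
Definition code : Type := (nat * nat * bool)%type.

Definition norm (x : code) : code :=
  if (x.1.1 <= x.1.2)%N then x else (x.1.2, x.1.1, x.2).
Definition emb (f : nat -> nat) (x : code) : code := norm (f x.1.1, f x.1.2, x.2).
Definition twist (sigma : seq bool) (x : code) : code :=
  (x.1, x.2 (+) nth false sigma x.1.1 (+) nth false sigma x.1.2).

Definition ends (x : code) : seq nat := [:: x.1.1; x.1.2].
Definition vcover (X : seq code) : seq nat := undup (flatten (map ends X)).
Definition valid (x : code) : bool :=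
  (x.1.1 <= x.1.2)%N && ((x.1.1 == x.1.2) ==> x.2).
Definition is_edge (x : code) : bool := x.1.1 != x.1.2.

(** The dependent triples of forms: three of the four forms x_i, x_j, x_i - x_j,
x_i + x_j on two vertices, or a balanced triangle, that is one with an even
number of negative edges (see free_forms). *)
Definition lineb (x y z : code) : bool :=
  let vs := flatten (map ends [:: x; y; z]) in
  [&& x != y, x != z, y != z &
    (size (undup vs) == 2) ||
    [&& size (undup vs) == 3, all (fun v => count_mem v vs == 2) vs,
        all is_edge [:: x; y; z] & ~~ (x.2 (+) y.2 (+) z.2)]].

Definition codes (k : nat) : seq code :=
  flatten [seq (j, j, true) :: flatten [seq [:: (i, j, false); (i, j, true)] | i <- iota 0 j]
          | j <- iota 0 k].

Lemma mem_codes k x : (x \in codes k) = valid x && (x.1.2 < k)%N.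
Proof.
case: x => [[i j] s]; rewrite /valid /=; apply/flatten_mapP/idP => [[b]|/andP[/andP[le lp] jk]].
  rewrite mem_iota add0n /= => bk; rewrite inE => /orP[/eqP[-> -> ->]|]; first by rewrite leqnn implybT bk.
  case/flatten_mapP=> a; rewrite mem_iota add0n /= => ab; rewrite !inE.
  by case/orP=> /eqP[-> -> ->]; rewrite ltnW // bk ltn_eqF.
exists j; first by rewrite mem_iota.
rewrite inE; apply/orP; case: (eqVneq i j) lp => [-> /= ->|ne _]; first by left.
right; apply/flatten_mapP; exists i; first by rewrite mem_iota add0n ltn_neqAle ne.
by rewrite !inE; case: s; rewrite eqxx ?orbT.
Qed.

Fixpoint bools (k : nat) : seq (seq bool) :=
  if k is k'.+1 then [seq b :: s | b <- [:: false; true], s <- bools k'] else [:: [::]].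

Lemma mem_bools k s : (s \in bools k) = (size s == k).
Proof.
elim: k s => [|k IH] [|b s] //=.
  by rewrite cats0 mem_cat; apply/negbTE; rewrite negb_or; apply/andP; split; apply/negP=> /mapP[].
rewrite eqSS -IH cats0 mem_cat; apply/orP/idP => [[]/mapP[t ts [_ ->]]//|st].
by case: b; [right|left]; apply: map_f.
Qed.

Definition kind_order (k : nat) : nat := nth 0 [:: 3; 4; 3; 2; 2; 3; 3; 3] k.

(** The kinds 0, ..., 7 are K_3, K_4, D_3, D_2^1, K_2^2, K_3^3, G_circ and D_3^1.
The edges and loops are listed in such an order that their lines are those of
kind_model. *)
Definition kind_codes (k : nat) : seq code := nth [::]
  [:: [:: (0, 1, false); (1, 2, false); (0, 2, false)];
      [:: (0, 1, false); (0, 2, false); (0, 3, false); (1, 2, false); (1, 3, false); (2, 3, false)];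
      [:: (0, 1, false); (0, 2, false); (1, 2, true); (1, 2, false); (0, 2, true); (0, 1, true)];
      [:: (0, 1, false); (0, 1, true); (0, 0, true)];
      [:: (0, 1, false); (0, 0, true); (1, 1, true)];
      [:: (0, 1, false); (0, 2, false); (0, 0, true); (1, 2, false); (1, 1, true); (2, 2, true)];
      [:: (0, 1, false); (1, 2, false); (1, 1, true); (0, 2, false); (0, 1, true); (1, 2, true)];
      [:: (0, 1, false); (0, 1, true); (0, 2, false); (0, 2, true); (1, 2, false); (1, 2, true);
          (0, 0, true)]] k.

Definition kind_model (k : nat) : model := nth line_model
  [:: line_model; quad_model; quad_model; line_model; line_model; quad_model; quad_model;
      nonfano_model] k.

Definition B2_codes : seq code := [:: (0, 1, false); (0, 1, true); (0, 0, true); (1, 1, true)].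

Definition switchings k : seq (seq code) :=
  [seq map (twist sigma) (kind_codes k) | sigma <- bools (kind_order k)].

Definition images k : seq (seq code) :=
  [seq map (emb (nth 0 p)) c | p <- permutations (iota 0 (kind_order k)), c <- switchings k].

Definition is_line_kind k := is_line_model (kind_model k).

(** Five vertices are enough for all lists of codes to be examined. *)
Definition has_B2 (L : seq code) : bool :=
  has (fun j => has (fun i =>
    all (mem L) [:: (i, j, false); (i, j, true); (i, i, true); (j, j, true)])
    (iota 0 j)) (iota 0 5).

Definition kinds := iota 0 8.

(** Three codes have at most six ends. *)
Definition triples6_check : bool :=
  all (fun x => all (fun y => all (fun z =>
    [&& lineb x y z == lineb y z x, lineb x y z == lineb x z y
     & lineb x y z ==> (size (vcover [:: x; y; z]) \in [:: 2; 3])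
        && all (mem (ends x ++ ends y)) (ends z)])
    (codes 6)) (codes 6)) (codes 6).

(** Two points z and w on the line through x and y complete a B_2 with x and y.  A
line has at most three vertices, and w adds two more. *)
Definition third_check : bool :=
  all (fun x => all (fun y => all (fun z => if lineb x y z then
    all (fun w => if lineb x y w then (z == w) || has_B2 [:: x; y; z; w] else true) (codes 5)
    else true) (codes 5)) (codes 5)) (codes 5).

(** Switching does not change which cycles are balanced, so all switchings of a kind
have the lines of its model. *)
Definition labels_check : bool :=
  all (fun k => let m := kind_model k in
    all (fun c => [&& size c == npts m, uniq c, all (mem (codes (kind_order k))) c
      & all (fun i => all (fun j => all (fun l =>
          lineb (nth (0, 0, true) c i) (nth (0, 0, true) c j) (nth (0, 0, true) c l)
            == mline m i j l)
        (iota 0 (npts m))) (iota 0 (npts m))) (iota 0 (npts m))])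
    (switchings k)) kinds.

(** Lines on two vertices are copies of K_2^2 or D_2^1, lines on three vertices are
balanced triangles. *)
Definition line_kind_check : bool :=
  all (fun n => all (fun x => all (fun y => all (fun z =>
    if lineb x y z && (size (vcover [:: x; y; z]) == n) then
    has (fun k => (kind_order k == n) && has (fun c =>
      all (mem c) [:: x; y; z] && all (mem [:: x; y; z]) c) (images k)) [:: 0; 3; 4]
    else true)
    (codes n)) (codes n)) (codes n)) [:: 2; 3].

(** Here x is off the line y, z, u and the four have n vertices, n <> 3.  For
n <= 2 they form a B_2.  Otherwise, if some syzygy does not vanish at x and this
line, each of the pairs y z, z u, u y contains a point that is joined to x by a
line (syzygy_neighbour).  The third points on these lines complete a K_4 if
n = 4; if n = 5 they do not exist. *)
Definition spread_check (n : nat) : bool :=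
  let T x a b := [seq w <- codes n | lineb x a w || lineb x b w] in
  all (fun y => all (fun z => all (fun u => if lineb y z u then
    all (fun x => if (x \notin [:: y; z; u]) && (size (vcover [:: x; y; z; u]) == n) then
      if n <= 2 then has_B2 [:: x; y; z; u] else
      all (fun u1 => all (fun u2 => all (fun u3 =>
        (n == 4) && has (fun c => all (mem [:: x; y; z; u; u1; u2; u3]) c
                                  && all (mem c) [:: x; y; z; u]) (switchings 1))
        (T x u y)) (T x z u)) (T x y z) else true)
      (codes n) else true) (codes n)) (codes n)) (codes n).

(** Two lines with the same points, or quadrilaterals and non-Fano planes with a
common non-collinear triple, have the same vertices (span_check), so that
one can be put in standard position and the other differs from a standard one by
a permutation.  If they are different, then either their union contains a B_2 or
one of them is a D_3 or a G_circ, contained in a D_3^1 inside the union. *)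
Definition overlap_check : bool :=
  all (fun k => all (fun k' =>
    if (kind_order k == kind_order k') && (is_line_kind k == is_line_kind k') then
    let cs' := images k' in let ds := images 7 in
    all (fun c => all (fun c' =>
      if [&& k == k', all (mem c) c' & all (mem c') c] then true else
      if has_B2 (c ++ c') then true else
      let I := [seq x <- c | x \in c'] in
      if has (fun x => has (fun y => has (fun z =>
        if [&& x != y, x != z & y != z] then lineb x y z == is_line_kind k else false) I) I) I
      then
        if k \in [:: 2; 6] then has (fun d => all (mem (c ++ c')) d && all (mem d) c) ds else
        if k' \in [:: 2; 6] then has (fun d => all (mem (c ++ c')) d && all (mem d) c') ds else
        false
      else true)
    cs') (switchings k) else true) kinds) kinds.

(** The triples considered in overlap_check meet all vertices of a configuration. *)
Definition span_check : bool :=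
  all (fun k => all (fun c => all (fun x => all (fun y => all (fun z =>
    [&& x != y, x != z, y != z & lineb x y z == is_line_kind k] ==>
    all (mem (flatten (map ends [:: x; y; z]))) (iota 0 (kind_order k)))
    c) c) c) (switchings k)) kinds.

Definition conf_kinds : seq nat := [:: 1; 2; 5; 6; 7].

Definition lines3 : seq (seq (seq bool)) :=
  tabulate 9 (fun i j l => let c a := nth (0, 0, true) (codes 3) a in lineb (c i) (c j) (c l)).

(** A graph on three vertices is given by a mask selecting some of the nine codes on
these vertices. *)
Definition mask_third (mask : seq bool) (j l : nat) : option nat :=
  ohead [seq u <- iota 0 9 | [&& nth false mask j, nth false mask l, nth false mask u
                               & lookup lines3 j l u]].

Definition mask_zero (mask : seq bool) : seq (seq (seq bool)) :=
  tabulate 9 (fun i _ _ => ~~ nth false mask i).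

Definition configs3 : seq (seq code) := flatten (map images [:: 7; 2; 5; 6]).

(** Tabulated, so that third points are not searched again in each round of
propagation. *)
Definition mask_table (mask : seq bool) : seq (seq (option nat)) :=
  mkseq (fun j => mkseq (mask_third mask j) 9) 9.

Definition table_third (T : seq (seq (option nat))) j l : option nat :=
  nth None (nth [::] T j) l.

Definition mask_zeros (mask : seq bool) : seq (seq (seq bool)) :=
  let T := mask_table mask in propagate 9 (table_third T) 8 (mask_zero mask).

Definition mask_codes (mask : seq bool) : seq code :=
  [seq x <- codes 3 | nth false mask (index x (codes 3))].

(** For a graph on three vertices without B_2, every triple (i; j, l) at which
propagation does not prove the vanishing of all syzygies lies, together with the
third point on the line j l, in a configuration contained in the graph. *)
Definition mask_check (mask : seq bool) : bool :=
  let L := mask_codes mask in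
  if has_B2 L then true else
  let Z := mask_zeros mask in
  let Cs := [seq c <- configs3 | all (mem L) c] in
  all (fun j => all (fun l => if mask_third mask j l is Some u then
    all (fun i => [|| ~~ nth false mask i, i \in [:: j; l; u], lookup Z i j l
      | has (fun c => all (fun a => nth (0, 0, true) (codes 3) a \in c) [:: i; j; l; u]) Cs])
     (iota 0 9) else true) (iota 0 9)) (iota 0 9).

Lemma triples6_ok : triples6_check.
Proof. by vm_compute. Qed.
Lemma third_ok : third_check.
Proof. by vm_compute. Qed.
Lemma labels_ok : labels_check.
Proof. by vm_compute. Qed.
Lemma line_kind_ok : line_kind_check.
Proof. by vm_compute. Qed.
Lemma spread_ok : all spread_check [:: 1; 2; 4; 5].
Proof. by vm_compute. Qed.
Lemma overlap_ok : overlap_check.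
Proof. by vm_compute. Qed.
Lemma span_ok : span_check.
Proof. by vm_compute. Qed.
Lemma masks_ok : all mask_check (bools 9).
Proof. by vm_compute. Qed.

(** * Relabelling vertices *)

Lemma normC (a b : nat) (s : bool) : norm (a, b, s) = norm (b, a, s).
Proof. by rewrite /norm /=; case: ltngtP => // ->. Qed.

Lemma norm_id x : valid x -> norm x = x.
Proof. by rewrite /norm => /andP[-> _]. Qed.

Lemma ends_norm x : perm_eq (ends (norm x)) (ends x).
Proof. by rewrite /norm; case: ifP => // _; rewrite (perm_catC [:: _] [:: _]). Qed.

Lemma sign_emb f x : (emb f x).2 = x.2.
Proof. by rewrite /emb /norm; case: ifP. Qed.

Lemma emb_norm f x : emb f (norm x) = emb f x.
Proof. by rewrite /norm; case: ifP => // _; rewrite /emb normC. Qed.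

Lemma emb_comp f g x : emb f (emb g x) = emb (f \o g) x.
Proof. by rewrite {2}/emb emb_norm. Qed.

Lemma eq_emb f g x : f x.1.1 = g x.1.1 -> f x.1.2 = g x.1.2 -> emb f x = emb g x.
Proof. by rewrite /emb => -> ->. Qed.

Lemma ends_emb f x : perm_eq (ends (emb f x)) (map f (ends x)).
Proof. exact: ends_norm. Qed.

Lemma norm_valid (a b : nat) (s : bool) : (a = b -> s) -> valid (norm (a, b, s)).
Proof.
rewrite /valid /norm /= => h; case: (ltngtP a b) => /= [ab|ab|e].
- by rewrite (ltnW ab) ltn_eqF.
- by rewrite (ltnW ab) ltn_eqF.
by rewrite e leqnn eqxx h.
Qed.

Lemma emb_inj f x y : injective f -> valid x -> valid y -> emb f x = emb f y -> x = y.
Proof.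
case: x y => [[a b] s] [[a' b'] s'] inj /andP[/= ab _] /andP[/= ab' _].
rewrite /emb /norm /=; case: leqP => _; case: leqP => _ [e1 e2 ->];
  have := inj _ _ e1; have := inj _ _ e2 => {e1 e2} e1 e2; subst => //.
- by have -> : a' = b' by apply/eqP; rewrite eqn_leq ab ab'.
by have -> : a' = b' by apply/eqP; rewrite eqn_leq ab ab'.
Qed.

Lemma ends_embs f X : perm_eq (flatten (map ends (map (emb f) X))) (map f (flatten (map ends X))).
Proof. by elim: X => //= x X IH; apply: (perm_cat (ends_emb f x) IH). Qed.

Lemma size_undup_embs f X : injective f ->
  size (undup (flatten (map ends (map (emb f) X)))) = size (undup (flatten (map ends X))).
Proof.
move=> inj; rewrite -[RHS](size_map f) -undup_map_inj //.
apply: perm_size; apply: perm_undup; exact: perm_mem (ends_embs f X).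
Qed.

Lemma lineb_emb f x y z : injective f -> valid x -> valid y -> valid z ->
  lineb (emb f x) (emb f y) (emb f z) = lineb x y z.
Proof.
move=> inj vx vy vz; rewrite /lineb.
have E a b : valid a -> valid b -> (emb f a == emb f b) = (a == b).
  by move=> va vb; apply/eqP/eqP => [/emb_inj->|->].
rewrite !E // -[[:: emb f x; emb f y; emb f z]]/(map (emb f) [:: x; y; z]).
set vs := flatten (map ends [:: x; y; z]).
rewrite (size_undup_embs _ inj) -/vs !sign_emb.
have p := ends_embs f [:: x; y; z]; rewrite -/vs in p.
have cnt v : count_mem (f v) (flatten (map ends (map (emb f) [:: x; y; z]))) = count_mem v vs.
  by rewrite (permP p) count_map; apply: eq_count => w /=; rewrite inj_eq.
rewrite (perm_all _ p); do 3!congr (_ && _); congr (_ || (_ && _)); congr [&& _, _ & _].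
  by rewrite all_map; apply: eq_all => v; exact: (congr1 (eq_op^~ 2) (cnt v)).
have P a : is_edge (emb f a) = is_edge a.
  by rewrite /is_edge /emb /norm; case: ifP => /= _; rewrite inj_eq // eq_sym.
by rewrite /= !P.
Qed.

Lemma sumn_mem (s : seq nat) x : x \in s -> x <= sumn s.
Proof.
elim: s => //= y s IH; rewrite inE => /orP[/eqP->|/IH h]; first exact: leq_addr.
exact: leq_trans h (leq_addl _ _).
Qed.

(** Relabellings are injections defined on all natural numbers, so that they
preserve distinctness and lines of arbitrary codes; only their values at the
vertices in use matter. *)
Lemma extend_inj k (g : nat -> nat) :
  (forall i j, i < k -> j < k -> g i = g j -> i = j) ->
  exists2 f, injective f & forall i, i < k -> f i = g i.
Proof.
move=> inj; pose N := sumn (map g (iota 0 k)).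
have gN i : i < k -> g i <= N by move=> ik; apply/sumn_mem/map_f; rewrite mem_iota add0n.
exists (fun i => if i < k then g i else i + N.+1); last by move=> i ->.
move=> i j; case: (ltnP i k) => ik; case: (ltnP j k) => jk.
- exact: inj.
- by move=> e; have := gN i ik; lia.
- by move=> e; have := gN j jk; lia.
by move=> e; lia.
Qed.

(** The elements of X are moved to the vertices 0, 1, ... by indexing the vertices
that occur.  This reduces every property of a few codes that is invariant under
relabelling to a finite check. *)
Lemma transfer (X : seq code) : all valid X ->
  exists f, injective f /\ exists2 Y, X = map (emb f) Y & all (mem (codes (size (vcover X)))) Y.
Proof.
move=> vX; set vs := vcover X.
have [|f inj fE] := @extend_inj (size vs) (nth 0 vs).
  by move=> i j ik jk /eqP; rewrite nth_uniq ?undup_uniq // => /eqP.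
exists f; split=> //; exists (map (fun x => norm (index x.1.1 vs, index x.1.2 vs, x.2)) X).
  rewrite -map_comp -[LHS]map_id; apply/eq_in_map => x xX /=.
  have end_in v : v \in ends x -> v \in vs.
    by move=> vx; rewrite mem_undup; apply/flatten_mapP; exists x.
  have K v : v \in ends x -> f (index v vs) = v.
    by move=> /end_in vv; rewrite fE ?index_mem // nth_index.
  rewrite emb_norm /emb /= !K ?inE ?eqxx ?orbT //.
  by case: x xX {end_in K} => [[a b] s] xX; rewrite norm_id // (allP vX).
apply/allP=> _ /mapP[x xX ->] /=.
have end_in v : v \in ends x -> v \in vs.
  by move=> vx; rewrite mem_undup; apply/flatten_mapP; exists x.
have i1 : x.1.1 \in vs by rewrite end_in ?inE ?eqxx.
have i2 : x.1.2 \in vs by rewrite end_in ?inE ?eqxx ?orbT.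
rewrite mem_codes norm_valid /=.
  by rewrite /norm; case: ifP => /= _; rewrite index_mem.
move=> e; have : x.1.1 = x.1.2 by rewrite -(nth_index 0 i1) e nth_index.
by have /andP[_ /implyP h] := allP vX _ xX; move=> /eqP/h.
Qed.

Lemma codesW k n x : k <= n -> x \in codes k -> x \in codes n.
Proof. by move=> kn; rewrite !mem_codes => /andP[-> h]; exact: leq_trans h kn. Qed.

Lemma codes_valid k x : x \in codes k -> valid x.
Proof. by rewrite mem_codes => /andP[]. Qed.

Lemma size_undup_flatten (X : seq code) : size (vcover X) <= (size X).*2.
Proof.
apply: leq_trans (size_undup _) _; rewrite size_flatten /shape -map_comp.
by elim: X => //= x X IH; rewrite doubleS -[(size X).*2.+2]/(2 + (size X).*2) leq_add2l.
Qed.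

Lemma triple_facts x y z : valid x -> valid y -> valid z ->
  [/\ lineb x y z = lineb y z x, lineb x y z = lineb x z y
    & lineb x y z -> size (vcover [:: x; y; z]) \in [:: 2; 3]
        /\ {subset ends z <= ends x ++ ends y}].
Proof.
move=> vx vy vz; have [|f [inj [Y eX /allP YX]]] := @transfer [:: x; y; z]; first by rewrite /= vx vy vz.
have le6 : size (vcover [:: x; y; z]) <= 6 by exact: (size_undup_flatten [:: x; y; z]).
case: Y eX YX => [|x' [|y' [|z' [|]]]] //= [ex ey ez] YX.
have in6 w : w \in [:: x'; y'; z'] -> w \in codes 6 by move=> /YX; exact: codesW.
have [X6 Y6 Z6] : [/\ x' \in codes 6, y' \in codes 6 & z' \in codes 6].
  by split; apply: in6; rewrite ?mem_head // !in_cons eqxx ?orbT.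
have /allP/(_ _ X6)/allP/(_ _ Y6)/allP/(_ _ Z6)/and3P[/eqP r /eqP sw /implyP co] := triples6_ok.
have [v1 v2 v3] := And3 (codes_valid X6) (codes_valid Y6) (codes_valid Z6).
rewrite ex ey ez !lineb_emb //; split=> // /co/andP[c3 /allP sub].
split; first by rewrite /vcover (@size_undup_embs f [:: x'; y'; z']).
suff : {subset ends (emb f z') <= ends (emb f x') ++ ends (emb f y')} by [].
move=> v; rewrite (perm_mem (ends_emb f z')) => /mapP[w /sub ws ->].
rewrite mem_cat !(perm_mem (ends_emb f _)) -mem_cat -map_cat.
exact: map_f.
Qed.

(** * Lines and overlaps of configurations *)

Lemma lineb_neq x y z : lineb x y z -> [/\ x != y, x != z & y != z].
Proof. by case/and4P. Qed.

Lemma size_cover_embs f X : injective f -> size (vcover (map (emb f) X)) = size (vcover X).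
Proof. exact: size_undup_embs. Qed.

(** The permutation p sends i to the position of f' i among f 0, ..., f (k - 1). *)
Lemma recoord k (f f' : nat -> nat) : injective f -> injective f' ->
  (forall i, i < k -> exists2 j, j < k & f' i = f j) ->
  exists2 p, p \in permutations (iota 0 k) & forall i, i < k -> f (nth 0 p i) = f' i.
Proof.
move=> inj inj' sub; pose r i := index (f' i) (map f (iota 0 k)).
have rE i : i < k -> r i < k /\ f (r i) = f' i.
  move=> ik; have [j jk e] := sub i ik.
  have mem : f' i \in map f (iota 0 k) by rewrite e map_f // mem_iota add0n.
  have rk : r i < k by move: mem; rewrite -index_mem size_map size_iota.
  split=> //; have := nth_index 0 mem; rewrite -/(r i) (nth_map 0) ?size_iota //.
  by rewrite nth_iota // add0n.
exists (map r (iota 0 k)); last first.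
  by move=> i ik; rewrite (nth_map 0) ?size_iota // nth_iota // add0n; case: (rE i ik).
have ur : uniq (map r (iota 0 k)).
  rewrite map_inj_in_uniq ?iota_uniq // => i j; rewrite !mem_iota !add0n /= => ik jk e.
  by apply: inj'; have [_ <-] := rE i ik; have [_ <-] := rE j jk; rewrite e.
rewrite mem_permutations; apply: uniq_perm; rewrite ?iota_uniq //.
have sub_r : {subset map r (iota 0 k) <= iota 0 k}.
  by move=> _ /mapP[i + ->]; rewrite !mem_iota !add0n /= => /rE[].
by have [] := uniq_min_size ur sub_r; rewrite ?size_map.
Qed.

Lemma embs_recoord k f g f' c : all (mem (codes k)) c -> (forall i, i < k -> f (g i) = f' i) ->
  map (emb f') c = map (emb f) (map (emb g) c).
Proof.
move=> /allP cc e; rewrite -map_comp; apply/eq_in_map => x /cc /=.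
rewrite emb_comp mem_codes => /andP[/andP[le _] lt].
by apply: eq_emb; rewrite /= e //; exact: leq_ltn_trans le lt.
Qed.

Lemma perm_injective k (f : nat -> nat) p : injective f -> p \in permutations (iota 0 k) ->
  exists2 f', injective f' & forall i, i < k -> f (nth 0 p i) = f' i.
Proof.
move=> inj; rewrite mem_permutations => pp.
have szp : size p = k by rewrite (perm_size pp) size_iota.
have up : uniq p by rewrite (perm_uniq pp) iota_uniq.
have [|f' inj' e] := @extend_inj k (f \o nth 0 p).
  by move=> i j ik jk /inj/eqP; rewrite nth_uniq ?szp // => /eqP.
by exists f' => // i /e ->.
Qed.

(** The permutation of the vertices is absorbed into the relabelling. *)
Lemma imagesP k c : k \in kinds -> c \in images k -> forall f, injective f ->
  exists f' c', [/\ injective f', c' \in switchings k & map (emb f) c = map (emb f') c'].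
Proof.
move=> kk /allpairsP[[p c'] [/= pp c's ->]] f inj.
have [f' inj' e] := perm_injective inj pp; exists f', c'; split=> //.
have /allP/(_ _ kk)/allP/(_ _ c's)/and4P[_ _ co _] := labels_ok.
by rewrite (embs_recoord co e).
Qed.

Section Elements.
Variable A : pred code.
Hypothesis A_valid : forall x, A x -> valid x.
Hypothesis noB2 : forall f, injective f -> ~~ all A (map (emb f) B2_codes).

Definition lineA x y z := [&& A x, A y, A z & lineb x y z].

Lemma no_has_B2 f L : injective f -> all A (map (emb f) L) -> ~~ has_B2 L.
Proof.
move=> inj AL; apply/negP=> /hasP[j _ /hasP[ i ]]; rewrite mem_iota add0n => /= ij.
case/and5P=> m1 m2 m3 m4 _.
have [|g ginj gE] := @extend_inj 2 (nth 0 [:: f i; f j]).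
  by move=> [|[|]] // [|[|]] //= _ _ /inj e; move: ij; rewrite ?e ?ltnn // -e ltnn.
case/negP: (noB2 ginj); apply/allP=> _ /mapP[x xB ->].
have AE y : y \in L -> A (emb f y) by move=> yL; apply: (allP AL); exact: map_f.
have e0 := gE 0 isT; have e1 := gE 1 isT; rewrite /= in e0 e1.
move: xB; rewrite !inE /emb => /or4P[]/eqP-> /=; rewrite ?e0 ?e1.
- exact: AE m1.
- exact: AE m2.
- exact: AE m3.
exact: AE m4.
Qed.

Lemma lineA_neq x y z : lineA x y z -> x != y.
Proof. by case/and4P=> _ _ _ /lineb_neq[]. Qed.

Lemma lineA_rot x y z : lineA x y z = lineA y z x.
Proof.
rewrite /lineA; have [Ax|] := boolP (A x); last by rewrite !andbF.
have [Ay|] := boolP (A y) => //=; have [Az|] := boolP (A z) => //=.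
by have [] := triple_facts (A_valid Ax) (A_valid Ay) (A_valid Az).
Qed.

Lemma lineA_swap x y z : lineA x y z = lineA x z y.
Proof.
rewrite /lineA; have [Ax|] := boolP (A x) => //=.
have [Ay|] := boolP (A y) => //=; last by rewrite andbF.
have [Az|] := boolP (A z) => //=.
by have [] := triple_facts (A_valid Ax) (A_valid Ay) (A_valid Az).
Qed.

Lemma cover_line x y z : lineA x y z ->
  size (vcover [:: x; y; z]) \in [:: 2; 3] /\ {subset ends z <= ends x ++ ends y}.
Proof.
case/and4P=> Ax Ay Az l.
have [_ _ h] := triple_facts (A_valid Ax) (A_valid Ay) (A_valid Az); exact: h.
Qed.

Lemma size_cover_cat X Y : size (vcover (X ++ Y)) <= size (vcover X) + size (vcover Y).
Proof.
rewrite /vcover map_cat flatten_cat undup_cat size_cat leq_add2r size_filter.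
exact: count_size.
Qed.

Lemma cover_sub X Y : {subset Y <= flatten (map ends X)} -> size (undup Y) <= size (vcover X).
Proof.
move=> sub; apply: uniq_leq_size; rewrite ?undup_uniq // => v; rewrite !mem_undup; exact: sub.
Qed.

Lemma size_cover1 x : size (vcover [:: x]) <= 2.
Proof. exact: (size_undup_flatten [:: x]). Qed.

Lemma lineA_third x y z w : lineA x y z -> lineA x y w -> z = w.
Proof.
move=> l l'; have /and4P[Ax Ay Az lb] := l; have /and4P[_ _ Aw lb'] := l'.
have [|f [inj [Y eX /allP YX]]] := @transfer [:: x; y; z; w]; first by rewrite /= !A_valid.
have le5 : size (vcover [:: x; y; z; w]) <= 5.
  apply: leq_trans (size_cover_cat [:: x; y; z] [:: w]) _.
  have [c3 _] := cover_line l; have := size_cover1 w.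
  by move: c3; rewrite !inE => /orP[]/eqP->; lia.
case: Y eX YX => [|x' [|y' [|z' [|w' [|]]]]] //= [ex ey ez ew] YX.
have in5 v : v \in [:: x'; y'; z'; w'] -> v \in codes 5 by move=> /YX; exact: codesW.
have [X5 Y5 Z5 W5] : [/\ x' \in codes 5, y' \in codes 5, z' \in codes 5 & w' \in codes 5].
  by split; apply: in5; rewrite !in_cons eqxx ?orbT.
have /allP/(_ _ X5)/allP/(_ _ Y5)/allP/(_ _ Z5) := third_ok.
have [vX vY] := conj (codes_valid X5) (codes_valid Y5).
have [vZ vW] := conj (codes_valid Z5) (codes_valid W5).
move: lb lb'; rewrite ex ey ez ew !lineb_emb //.
move=> -> lb' /allP/(_ _ W5); rewrite lb' => /orP[/eqP->//|].
move=> hB; have /negP[] // : ~~ has_B2 [:: x'; y'; z'; w'].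
by apply: (no_has_B2 inj); rewrite /= -ex -ey -ez -ew Ax Ay Az Aw.
Qed.

Lemma lineA_conf x y z : lineA x y z ->
  exists k f c, [/\ k \in [:: 0; 3; 4], injective f, c \in switchings k,
    all A (map (emb f) c) & all (mem (map (emb f) c)) [:: x; y; z]].
Proof.
move=> l; have /and4P[Ax Ay Az lb] := l.
have [|f [inj [Y eX /allP YX]]] := @transfer [:: x; y; z]; first by rewrite /= !A_valid.
have [c23 _] := cover_line l; set n := size (vcover _) in c23 YX.
case: Y eX YX => [|x' [|y' [|z' [|]]]] //= [ex ey ez] YX.
have [Xn Yn Zn] : [/\ x' \in codes n, y' \in codes n & z' \in codes n].
  by split; apply: YX; rewrite !in_cons eqxx ?orbT.
have /allP/(_ _ c23)/allP/(_ _ Xn)/allP/(_ _ Yn)/allP/(_ _ Zn) := line_kind_ok.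
have -> : size (vcover [:: x'; y'; z']) = n.
  by rewrite /n ex ey ez (@size_cover_embs f [:: x'; y'; z']).
have [vX vY vZ] := And3 (codes_valid Xn) (codes_valid Yn) (codes_valid Zn).
move: lb; rewrite ex ey ez lineb_emb //.
move=> ->; rewrite eqxx => /hasP[k kk /andP[_ /hasP[c ck /andP[/allP c1 /allP c2]]]].
have kk' : k \in kinds by move: kk; rewrite !inE => /or3P[]/eqP->.
have [f' [c' [inj' c's e]]] := imagesP kk' ck inj.
exists k, f', c'; split=> //; rewrite -e.
  apply/allP=> _ /mapP[v /c2 + ->].
  by rewrite !inE => /or3P[]/eqP->; rewrite -?ex -?ey -?ez.
have c1' v : v \in [:: x'; y'; z'] -> emb f v \in map (emb f) c by move=> /c1; exact: map_f.
by rewrite /= !c1' // !in_cons eqxx ?orbT.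
Qed.

Lemma switchings_span k c x y z : k \in kinds -> c \in switchings k ->
  x \in c -> y \in c -> z \in c -> x != y -> x != z -> y != z ->
  lineb x y z = is_line_kind k -> {subset iota 0 (kind_order k) <= flatten (map ends [:: x; y; z])}.
Proof.
move=> kk ck xc yc zc xy xz yz l v vk.
have /allP/(_ _ kk)/allP/(_ _ ck)/allP/(_ _ xc)/allP/(_ _ yc)/allP/(_ _ zc) := span_ok.
by rewrite xy xz yz l eqxx /= => /allP/(_ _ vk).
Qed.

Lemma switchings_codes k c : k \in kinds -> c \in switchings k ->
  [/\ size c = npts (kind_model k), uniq c & all (mem (codes (kind_order k))) c].
Proof.
by move=> kk ck; have /allP/(_ _ kk)/allP/(_ _ ck)/and4P[/eqP-> -> -> _] := labels_ok.
Qed.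

(** The common triple meets all vertices of both configurations, so the two
relabellings have the same range and differ by a permutation (recoord); then
overlap_check applies. *)
Lemma overlap k k' f f' c c' x y z :
  k \in kinds -> k' \in kinds -> injective f -> injective f' ->
  c \in switchings k -> c' \in switchings k' ->
  all A (map (emb f) c) -> all A (map (emb f') c') ->
  all (mem (map (emb f) c)) [:: x; y; z] -> all (mem (map (emb f') c')) [:: x; y; z] ->
  x != y -> x != z -> y != z ->
  lineb x y z = is_line_kind k -> lineb x y z = is_line_kind k' ->
  [\/ k = k' /\ map (emb f) c =i map (emb f') c',
      k \in [:: 2; 6] /\ exists g d, [/\ injective g, d \in switchings 7,
        all A (map (emb g) d) & {subset map (emb f) c <= map (emb g) d}]
    | k' \in [:: 2; 6] /\ exists g d, [/\ injective g, d \in switchings 7,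
        all A (map (emb g) d) & {subset map (emb f') c' <= map (emb g) d}]].
Proof.
move=> kk kk' inj inj' ck ck' Ac Ac' xyz xyz' xy xz yz l l'.
have [_ _ co] := switchings_codes kk ck; have [_ _ co'] := switchings_codes kk' ck'.
have ranges k0 f0 c0 : k0 \in kinds -> injective f0 -> c0 \in switchings k0 ->
    all (mem (map (emb f0) c0)) [:: x; y; z] -> lineb x y z = is_line_kind k0 ->
    flatten (map ends [:: x; y; z]) =i map f0 (iota 0 (kind_order k0)).
  move=> kk0 inj0 ck0 /and4P[/mapP[x0 xc ex] /mapP[y0 yc ey] /mapP[z0 zc ez] _] l0.
  have [_ _ /allP co0] := switchings_codes kk0 ck0.
  have [v1 v2 v3] := And3 (codes_valid (co0 _ xc)) (codes_valid (co0 _ yc)) (codes_valid (co0 _ zc)).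
  have ne a b : emb f0 a != emb f0 b -> a != b by apply: contraNneq => ->.
  have sp := switchings_span kk0 ck0 xc yc zc.
  rewrite ex ey ez in xy xz yz l0; rewrite lineb_emb // in l0.
  have {}sp := sp (ne _ _ xy) (ne _ _ xz) (ne _ _ yz) l0.
  move=> v; rewrite ex ey ez (perm_mem (ends_embs f0 [:: x0; y0; z0])).
  apply/mapP/mapP => -[w wi ->]; exists w => //; last exact: sp.
  have [u uu] := flatten_mapP wi; have : u \in codes (kind_order k0).
    by move: uu; rewrite !inE => /or3P[]/eqP->; exact: co0.
  rewrite mem_codes mem_iota add0n => /andP[/andP[le _] lt].
  by rewrite !inE => /orP[]/eqP->; rewrite //=; exact: leq_ltn_trans le lt.
have r := ranges k f c kk inj ck xyz l; have r' := ranges k' f' c' kk' inj' ck' xyz' l'.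
have rr : map f (iota 0 (kind_order k)) =i map f' (iota 0 (kind_order k')).
  by move=> v; rewrite -r r'.
have ekk : kind_order k = kind_order k'.
  have : perm_eq (map f (iota 0 (kind_order k))) (map f' (iota 0 (kind_order k'))).
    by apply: uniq_perm; rewrite ?map_inj_uniq ?iota_uniq.
  by move/perm_size; rewrite !size_map !size_iota.
have [|p pp pE] := @recoord (kind_order k) f f' inj inj'.
  move=> i ik; have : f' i \in map f' (iota 0 (kind_order k')).
    by rewrite map_f // mem_iota add0n -ekk.
  by rewrite -rr => /mapP[j]; rewrite mem_iota add0n => jk ->; exists j.
rewrite ekk in pE pp; set d := map (emb (nth 0 p)) c'.
have eS : map (emb f') c' = map (emb f) d by rewrite (embs_recoord co' pE).
have dk : d \in images k' by apply/allpairsP; exists (p, c').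
have vd : {subset d <= valid}.
  move=> _ /mapP[v vc ->]; have := allP co' _ vc => /=; case: v {vc} => [[a b] s].
  rewrite mem_codes => /andP[/andP[/= ab /implyP h] bk]; apply: norm_valid => /= e.
  apply: h; apply/eqP/inj'; rewrite -!pE //; last exact: leq_ltn_trans ab bk.
  by rewrite e.
have vc : {subset c <= valid} by move=> v /(allP co)/codes_valid.
have both v : v \in [:: x; y; z] -> exists2 w, v = emb f w & (w \in c) && (w \in d).
  move=> vx; have /mapP[w wc ew] := allP xyz _ vx; have := allP xyz' _ vx.
  rewrite /= eS => /mapP[w' wd ew']; exists w => //; rewrite wc.
  have e : w = w' by apply: (emb_inj inj); [exact: vc | exact: vd | rewrite -ew].
  by rewrite e.
have [x0 ex /andP[x0c x0d]] : exists2 w, x = emb f w & (w \in c) && (w \in d) by apply: both; rewrite !inE eqxx.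
have [y0 ey /andP[y0c y0d]] : exists2 w, y = emb f w & (w \in c) && (w \in d) by apply: both; rewrite !inE eqxx ?orbT.
have [z0 ez /andP[z0c z0d]] : exists2 w, z = emb f w & (w \in c) && (w \in d) by apply: both; rewrite !inE eqxx ?orbT.
have ll : is_line_kind k = is_line_kind k' by rewrite -l -l'.
have Acd : all A (map (emb f) (c ++ d)) by rewrite map_cat all_cat Ac -eS Ac'.
have /allP/(_ _ kk)/allP/(_ _ kk') := overlap_ok.
rewrite ekk ll !eqxx /= => /allP/(_ _ ck)/allP/(_ _ dk).
case: ifP => [/and3P[/eqP ek /allP dc /allP cd] _|_].
  apply: Or31; split=> //.
  by move=> v; rewrite eS; apply/mapP/mapP => -[w ws ->]; exists w => //; [exact: cd|exact: dc].
rewrite (negbTE (no_has_B2 inj Acd)); case: ifP => [_|/negP no]; last first.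
  case: no; apply/hasP; exists x0; first by rewrite mem_filter x0c x0d.
  apply/hasP; exists y0; first by rewrite mem_filter y0c y0d.
  apply/hasP; exists z0; first by rewrite mem_filter z0c z0d.
  have ne a b : emb f a != emb f b -> a != b by apply: contraNneq => ->.
  move: xy xz yz l; rewrite ex ey ez => /ne-> /ne-> /ne->.
  have [v1 v2 v3] : [/\ valid x0, valid y0 & valid z0] by split; exact: vc.
  by rewrite lineb_emb //= => ->; rewrite ll.
have fin e : has (fun d0 => all (mem (c ++ d)) d0 && all (mem d0) e) (images 7) ->
    exists g d0, [/\ injective g, d0 \in switchings 7,
        all A (map (emb g) d0) & {subset map (emb f) e <= map (emb g) d0}].
  case/hasP=> d0 d0i /andP[/allP sub /allP sub'].
  have [g [d1 [ginj d1s eg]]] := @imagesP 7 d0 isT d0i f inj.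
  exists g, d1; split=> //; rewrite -eg.
    by apply/allP=> _ /mapP[v /sub vs ->]; apply: (allP Acd); exact: map_f.
  by move=> _ /mapP[v /sub' vs ->]; exact: map_f.
case: ifP => [k26 /fin h|_]; first by apply: Or32.
by case: ifP => [k26 /fin h|//]; apply: Or33; rewrite eS.
Qed.

End Elements.

(** * The support of a syzygy *)

Lemma emb_preimage f k w : injective f -> valid w -> {subset ends w <= map f (iota 0 k)} ->
  exists2 w', w' \in codes k & w = emb f w'.
Proof.
case: w => [[a b] s] inj vw sub.
have [ i ] : exists2 i, i \in iota 0 k & a = f i by apply/mapP/sub; rewrite inE eqxx.
have [j] : exists2 j, j \in iota 0 k & b = f j by apply/mapP/sub; rewrite !inE eqxx orbT.
rewrite !mem_iota !add0n /= => jk ej ik ei; exists (norm (i, j, s)).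
  rewrite mem_codes norm_valid /=; first by rewrite /norm; case: ifP.
  by move=> e; have /andP[_ /implyP] := vw; apply; rewrite /= ei ej e.
by rewrite emb_norm /emb /= -ei -ej norm_id.
Qed.

Section Cover.
Variable A : pred code.
Hypothesis A_valid : forall x, A x -> valid x.
Hypothesis noB2 : forall f, injective f -> ~~ all A (map (emb f) B2_codes).
Variables (K : fieldType) (C : code -> code -> code -> K).
Hypothesis sC : syzygy A (lineA A) C.

Local Notation on_line := (lineA A).

(** In the three-term relation at x, a, b a second term is nonzero, and its pair
lies on a line. *)
Lemma syzygy_neighbour x a b : C x a b != 0%R ->
  exists w, on_line x a w || on_line x b w.
Proof.
have [anti nz _ cyc] := sC; move=> n0.
have [e|/nz[_ [w l]]] := eqVneq (C a b x) 0%R; last first.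
  by exists w; rewrite (lineA_rot A_valid x b) (lineA_swap A_valid b) l orbT.
have := cyc x a b; rewrite e addr0 => e2; have : C b x a != 0%R.
  by apply: contraNneq n0 => e3; rewrite e3 addr0 in e2; rewrite e2.
by case/nz=> _ [w l]; exists w; rewrite l.
Qed.

Definition covered x y z u := exists k f c, [/\ k \in conf_kinds, injective f, c \in switchings k,
  all A (map (emb f) c) & all (mem (map (emb f) c)) [:: x; y; z; u]].

(** The slice C x has the same nonzero value at the three cyclic pairs of the line,
and syzygy_neighbour applied to each of them provides the lines through x that
spread_check needs.  Their third points have no new vertices. *)
Lemma cover_spread x y z u : C x y z != 0%R -> on_line y z u -> x \notin [:: y; z; u] ->
  size (vcover [:: x; y; z; u]) \in [:: 1; 2; 4; 5] -> covered x y z u.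
Proof.
move=> nz l xn; set n := size _ => n_in; have [anti nzC th _] := sC.
have [Ax _] := nzC _ _ _ nz; have /and4P[Ay Az Au lb] := l.
have e1 : C x z u = C x y z by exact: th.
have e2 : C x u y = C x z u by apply: th; rewrite -(lineA_rot A_valid).
have [w1 l1] := syzygy_neighbour nz.
have [w2 l2] : exists w, on_line x z w || on_line x u w by apply: syzygy_neighbour; rewrite e1.
have [w3 l3] : exists w, on_line x u w || on_line x y w by apply: syzygy_neighbour; rewrite e2 e1.
have Aw a b w : on_line x a w || on_line x b w -> A w by case/orP=> /and4P[].
have sub_w a b w : a \in [:: y; z; u] -> b \in [:: y; z; u] -> on_line x a w || on_line x b w ->
    {subset ends w <= flatten (map ends [:: x; y; z; u])}.
  move=> ai bi h v vw.
  have [a' ai' va] : exists2 a', a' \in [:: y; z; u] & v \in ends x ++ ends a'.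
    by case/orP: h => /(cover_line A_valid)[_ /(_ v vw) ?]; [exists a|exists b].
  apply/flatten_mapP; move: va; rewrite mem_cat => /orP[va|va]; [exists x|exists a'] => //.
    by rewrite mem_head.
  by rewrite in_cons ai' orbT.
have [|f [inj [Y eX /allP YX]]] := @transfer [:: x; y; z; u; w1; w2; w3].
  by rewrite /= !A_valid // (Aw _ _ _ l1, Aw _ _ _ l2, Aw _ _ _ l3).
have len : size (vcover [:: x; y; z; u; w1; w2; w3]) <= n.
  apply: cover_sub => v /flatten_mapP[w + vw].
  have old : w \in [:: x; y; z; u] -> v \in flatten (map ends [:: x; y; z; u]).
    by move=> wi; apply/flatten_mapP; exists w.
  rewrite -[[:: x, y, z, u & _]]/([:: x; y; z; u] ++ [:: w1; w2; w3]) mem_cat => /orP[/old//|].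
  have [yi zi ui] : [/\ y \in [:: y; z; u], z \in [:: y; z; u] & u \in [:: y; z; u]].
    by rewrite !inE !eqxx ?orbT.
  move=> wi; have : [|| w == w1, w == w2 | w == w3] by rewrite !inE in wi.
  case/or3P=> /eqP ew; rewrite ew in vw.
  - exact: sub_w yi zi l1 v vw.
  - exact: sub_w zi ui l2 v vw.
  - exact: sub_w ui yi l3 v vw.
case: Y eX YX => [|x' [|y' [|z' [|u' [|w1' [|w2' [|w3' [|]]]]]]]] //.
case=> ex ey ez eu ew1 ew2 ew3 YX.
have inn v : v \in [:: x'; y'; z'; u'; w1'; w2'; w3'] -> v \in codes n.
  by move=> /YX; exact: codesW.
have [Xn Yn Zn Un] : [/\ x' \in codes n, y' \in codes n, z' \in codes n & u' \in codes n].
  by split; apply: inn; rewrite !in_cons eqxx ?orbT.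
have [W1n W2n W3n] : [/\ w1' \in codes n, w2' \in codes n & w3' \in codes n].
  by split; apply: inn; rewrite !in_cons eqxx ?orbT.
have val v : v \in codes n -> valid v by exact: codes_valid.
have /allP/(_ _ n_in)/allP/(_ _ Yn)/allP/(_ _ Zn)/allP/(_ _ Un) := spread_ok.
have lE a b c : a \in codes n -> b \in codes n -> c \in codes n ->
    on_line (emb f a) (emb f b) (emb f c) -> lineb a b c.
  by move=> an bn cn /and4P[_ _ _]; rewrite lineb_emb // val.
have -> : lineb y' z' u' by apply: lE => //; rewrite -ey -ez -eu.
move=> /allP/(_ _ Xn).
have -> : size (vcover [:: x'; y'; z'; u']) = n.
  by rewrite /n ex ey ez eu (@size_cover_embs f [:: x'; y'; z'; u']).
have -> : x' \notin [:: y'; z'; u'].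
  by apply: contra xn => h; rewrite ex ey ez eu (@map_f _ _ (emb f) [:: y'; z'; u']).
rewrite eqxx [_ && _]/=; case: ifP => [_ hB|_].
  have /negP[] // : ~~ has_B2 [:: x'; y'; z'; u'].
  by apply: (no_has_B2 noB2 inj); rewrite /= -ex -ey -ez -eu Ax Ay Az Au.
have T a b w : a \in codes n -> b \in codes n -> w \in codes n ->
    on_line x (emb f a) (emb f w) || on_line x (emb f b) (emb f w) ->
    w \in [seq w <- codes n | lineb x' a w || lineb x' b w].
  move=> an bn wn h; rewrite mem_filter wn andbT.
  by case/orP: h; rewrite ex => /lE->; rewrite ?orbT.
have t1 := T _ _ _ Yn Zn W1n; have t2 := T _ _ _ Zn Un W2n; have t3 := T _ _ _ Un Yn W3n.
rewrite -ew1 -ew2 -ew3 -ey -ez -eu in t1 t2 t3.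
move=> /allP/(_ _ (t1 l1))/allP/(_ _ (t2 l2))/allP/(_ _ (t3 l3)) /andP[_ /hasP[c ck]].
case/andP=> /allP c1 /allP c2; exists 1, f, c; split=> //.
  apply/allP=> _ /mapP[v /c1 + ->].
  rewrite /= !in_cons in_nil orbF.
  move=> /orP[/eqP->|/orP[/eqP->|/orP[/eqP->|/orP[/eqP->|/or3P[]/eqP->]]]];
    rewrite -?ex -?ey -?ez -?eu -?ew1 -?ew2 -?ew3 //; exact: Aw l1 || exact: Aw l2 || exact: Aw l3.
have c2' v : v \in [:: x'; y'; z'; u'] -> emb f v \in map (emb f) c by move=> /c2; exact: map_f.
by rewrite ex ey ez eu /= !c2' // !in_cons eqxx ?orbT.
Qed.

(** The edges and loops on the three vertices in question form one of the 512 masks;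
propagation on the mask is sound for C because the third point of a line through
two of these codes has no new vertex. *)
Lemma cover_plane x y z u : C x y z != 0%R -> on_line y z u -> x \notin [:: y; z; u] ->
  size (vcover [:: x; y; z; u]) = 3 -> covered x y z u.
Proof.
move=> nz l xn n3; have [anti nzC th cyc] := sC.
have [Ax _] := nzC _ _ _ nz; have /and4P[Ay Az Au lb] := l.
have [|f [inj [Y eX]]] := @transfer [:: x; y; z; u]; first by rewrite /= !A_valid.
rewrite n3; case: Y eX => [|x' [|y' [|z' [|u' [|]]]]] //.
case=> ex ey ez eu /and5P[/= X3 Y3 Z3 U3 _].
pose c a := nth (0, 0, true) (codes 3) a.
have sz : size (codes 3) = 9 by [].
have cI v : v \in codes 3 -> index v (codes 3) < 9 /\ c (index v (codes 3)) = v.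
  by move=> v3; rewrite -{1}sz index_mem v3 /c nth_index.
have c3 i : i < 9 -> c i \in codes 3 by move=> i9; rewrite mem_nth.
have cval i : i < 9 -> valid (c i) by move=> /c3/codes_valid.
pose mask := map (fun v => A (emb f v)) (codes 3).
have mE i : i < 9 -> nth false mask i = A (emb f (c i)).
  by move=> i9; rewrite (nth_map (0, 0, true)) ?sz.
have maskP : mask \in bools 9 by rewrite mem_bools size_map.
have := allP masks_ok _ maskP; rewrite /mask_check.
have LA v : v \in mask_codes mask -> A (emb f v).
  by rewrite mem_filter => /andP[+ /cI[i9 ei]]; rewrite mE // ei.
have -> : has_B2 (mask_codes mask) = false.
  by apply/negbTE; apply: (no_has_B2 noB2 inj); apply/allP=> _ /mapP[v /LA Av ->].
pose third := table_third (mask_table mask).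
have thirdE j l0 : j < 9 -> l0 < 9 -> third j l0 = mask_third mask j l0.
  by move=> j9 l9; rewrite /third /table_third /mask_table nth_mkseq // nth_mkseq.
have lin3 i j k : i < 9 -> j < 9 -> k < 9 -> lookup lines3 i j k = lineb (c i) (c j) (c k).
  by move=> i9 j9 k9; rewrite /lookup /lines3 /tabulate !nth_mkseq.
have thirdP j l0 : j < 9 -> l0 < 9 ->
    if third j l0 is Some w then w < 9 /\ on_line (emb f (c j)) (emb f (c l0)) (emb f (c w))
    else forall w, ~~ on_line (emb f (c j)) (emb f (c l0)) w.
  move=> j9 l9; rewrite thirdE // /mask_third.
  case e : [seq _ <- _ | _] => [|w r] /=.
    move=> w; apply/negP=> lw; have /and4P[Aj Al Aw _] := lw.
    have [w' w3 ew] : exists2 w', w' \in codes 3 & w = emb f w'.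
      apply: emb_preimage => //; first exact: A_valid.
      have [_ sub] := cover_line A_valid lw; move=> v /sub.
      have in3 a : a \in codes 3 -> {subset ends (emb f a) <= map f (iota 0 3)}.
        move=> a3 t; rewrite (perm_mem (ends_emb f a)) => /mapP[b ba ->]; apply: map_f.
        rewrite mem_iota add0n; move: a3; rewrite mem_codes => /andP[/andP[le _] lt].
        by move: ba; rewrite !inE => /orP[]/eqP->; rewrite //=; exact: leq_ltn_trans le lt.
      by rewrite mem_cat => /orP[]; apply: in3; exact: c3.
    have [i9 ei] := cI _ w3.
    suff : index w' (codes 3) \in [::] by [].
    rewrite -e mem_filter mem_iota add0n i9 !mE // lin3 // ei -ew Aj Al Aw.
    suff -> : lineb (c j) (c l0) w' by [].
    by move: lw; rewrite /lineA ew lineb_emb ?cval ?(codes_valid w3) // => /and4P[].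
  have : w \in w :: r by rewrite mem_head.
  rewrite -e mem_filter mem_iota add0n => /andP[/and4P[mj ml mw lw] /= w9]; split=> //.
  by rewrite !mE // in mj ml mw; rewrite /lineA mj ml mw lineb_emb ?cval // -lin3.
set Z := mask_zeros mask.
have Zv i j k : lookup Z i j k -> C (emb f (c i)) (emb f (c j)) (emb f (c k)) = 0%R.
  apply: (propagateP (n := 9) (third := third) (fuel := 8) (Z := mask_zero mask) (v := fun i j k => C (emb f (c i)) (emb f (c j)) (emb f (c k)))).
    move=> a b d a9 b9 d9; split; [exact: anti | | exact: cyc].
    have := thirdP b d b9 d9; case: (third b d) => [w [w9 lw]|no]; first exact: th.
    by apply/eqP/negPn/negP=> /nzC[_ [w lw]]; have := no w; rewrite lw.
  move=> a b d /lookup_tabulate[a9 _ _]; rewrite mE // => nA.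
  by apply/eqP/negPn/negP=> /nzC[Aa _]; rewrite Aa in nA.
have [ix cx] := cI _ X3; have [iy cy] := cI _ Y3; have [iz cz] := cI _ Z3; have [iu cu] := cI _ U3.
set j := index y' _ in iy cy; set k := index z' _ in iz cz.
set i := index x' _ in ix cx.
have in9 w : w < 9 -> w \in iota 0 9 by rewrite mem_iota.
move=> /allP/(_ _ (in9 _ iy))/allP/(_ _ (in9 _ iz)).
rewrite -thirdE //; have := thirdP j k iy iz; case: (third j k) => [w [w9 lw]|no]; last first.
  by have := no u; rewrite cy cz -ey -ez l.
have {lw}cw : c w = u'.
  have := lineA_third A_valid noB2 l; rewrite ey ez eu => h.
  by rewrite cy cz in lw; apply: (emb_inj inj); rewrite ?cval ?(codes_valid U3) // -(h _ lw).
move=> /allP/(_ _ (in9 _ ix)); case/or4P=> [|h|/Zv e0|].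
- by rewrite mE // cx -ex Ax.
- case/negP: xn; rewrite ex -cx; move: h.
  by rewrite !in_cons in_nil orbF => /or3P[]/eqP->; rewrite ?cy ?cz ?cw -?ey -?ez -?eu eqxx ?orbT.
- by rewrite cx cy cz -ex -ey -ez in e0; rewrite e0 eqxx in nz.
case/hasP=> d; rewrite mem_filter => /andP[/allP dL dc] /and5P[dx dy dz du _].
rewrite -/(c i) -/(c j) -/(c k) -/(c w) cx cy cz cw in dx dy dz du.
have /flatten_mapP[q qk dq] := dc.
have qk' : q \in kinds by move: qk; rewrite !inE => /or4P[]/eqP->.
have [g [d' [ginj d's e]]] := imagesP qk' dq inj.
exists q, g, d'; split=> //; first by move: qk; rewrite !inE => /or4P[]/eqP->.
  by rewrite -e; apply/allP=> _ /mapP[v /dL/LA Av ->].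
by rewrite -e /= ex ey ez eu !map_f.
Qed.

(** The line has two or three vertices and x has at most two, so at most five
vertices occur. *)
Theorem syzygy_covered x y z u : C x y z != 0%R -> on_line y z u -> x \notin [:: y; z; u] ->
  covered x y z u.
Proof.
move=> nz l xn; have [c23 _] := cover_line A_valid l.
have le5 : size (vcover [:: x; y; z; u]) <= 5.
  apply: leq_trans (size_cover_cat [:: x] [:: y; z; u]) _.
  by have := size_cover1 x; move: c23; rewrite !inE => /orP[]/eqP->; lia.
have ge1 : 0 < size (vcover [:: x; y; z; u]).
  by rewrite -has_predT; apply/hasP; exists x.1.1 => //; rewrite mem_undup mem_head.
have [n3|n3] := eqVneq (size (vcover [:: x; y; z; u])) 3; first exact: cover_plane.
apply: cover_spread => //; move: le5 ge1 n3; case: (size _) => [|[|[|[|[|[|]]]]]] //.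
Qed.

End Cover.

Local Open Scope ring_scope.

(** * Linear dependence of the forms of signed edges *)

Definition root_coef (x : code) (v : nat) : int :=
  if x.1.1 == x.1.2 then (v == x.1.1)%:R
  else if v == x.1.1 then 1
  else if v == x.1.2 then (if x.2 then 1 else -1) else 0.

Definition minor (x y z : code) (u v w : nat) : int :=
  root_coef x u * (root_coef y v * root_coef z w - root_coef y w * root_coef z v)
  - root_coef x v * (root_coef y u * root_coef z w - root_coef y w * root_coef z u)
  + root_coef x w * (root_coef y u * root_coef z v - root_coef y v * root_coef z u).

(** Integers that are nonzero in every field of characteristic other than 2. *)
Definition small_units : seq int := [:: 1; -1; 2; -2].

(** Computed by value, the disjunction in has would evaluate both of its arguments;
this search stops at the first success. *)
Fixpoint lazy_has (T : Type) (p : pred T) (s : seq T) : bool :=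
  if s is x :: s' then if p x then true else lazy_has p s' else false.

Lemma lazy_hasE (T : Type) (p : pred T) s : lazy_has p s = has p s.
Proof. by elim: s => //= x s ->; case: (p x). Qed.

(** Three codes have at most six ends.  A line satisfies a relation with
coefficients 1, -1, 2, -2, and any other triple of distinct codes has a 3 x 3
minor equal to one of these numbers. *)
Definition rank_check : bool :=
  all (fun x => all (fun y => all (fun z =>
    if lineb x y z then
      has (fun a => has (fun b => has (fun c =>
        all (fun v => a * root_coef x v + b * root_coef y v + c * root_coef z v == 0) (iota 0 6))
        small_units) small_units) small_units
    else if (x == y) || (x == z) || (y == z) then true else
      lazy_has (fun u => lazy_has (fun v => lazy_has (fun w =>
        minor x y z u v w \in small_units) (iota 0 v)) (iota 0 u)) (iota 0 6))
    (codes 6)) (codes 6)) (codes 6).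

Lemma rank_ok : rank_check. Proof. by vm_compute. Qed.

(** The sign e is needed since relabelling may exchange the ends of a positive edge,
and x_i - x_j changes sign with them. *)
Lemma root_coef_emb f x : injective f ->
  exists2 e : int, e * e = 1 & forall v, root_coef (emb f x) (f v) = e * root_coef x v.
Proof.
move=> inj; case: x => [[a b] s]; rewrite /emb /norm /=; have I u v : (f u == f v) = (u == v) by rewrite inj_eq.
case: (leqP (f a) (f b)) => _.
  by exists 1; rewrite // => v; rewrite /root_coef /= !I mul1r.
exists (if a == b then 1 else if s then 1 else -1); first by do 2?case: ifP.
move=> v; rewrite /root_coef /= !I (eq_sym b); case: (eqVneq a b) => [->|ab]; first by rewrite mul1r.
case: (eqVneq v a) => [e|va]; case: (eqVneq v b) => [e'|vb]; case: s => //;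
  by case/eqP: ab; rewrite -e -e'.
Qed.

Lemma root_coef_out x v : v \notin ends x -> root_coef x v = 0.
Proof.
by rewrite !inE negb_or /root_coef => /andP[/negPf-> /negPf->]; case: ifP.
Qed.

Lemma lineb_relation x y z : valid x -> valid y -> valid z -> lineb x y z ->
  exists a b c : int, a \in small_units /\
    forall v, a * root_coef x v + b * root_coef y v + c * root_coef z v = 0.
Proof.
move=> vx vy vz l.
have [|f [inj [Y eX /allP YX]]] := @transfer [:: x; y; z]; first by rewrite /= vx vy vz.
have le6 : (size (vcover [:: x; y; z]) <= 6)%N by exact: (size_undup_flatten [:: x; y; z]).
case: Y eX YX => [|x' [|y' [|z' [|]]]] // [ex ey ez] YX.
have in6 w : w \in [:: x'; y'; z'] -> w \in codes 6 by move=> /YX; exact: codesW.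
have [X6 Y6 Z6] : [/\ x' \in codes 6, y' \in codes 6 & z' \in codes 6].
  by split; apply: in6; rewrite ?mem_head // !in_cons eqxx ?orbT.
have /allP/(_ _ X6)/allP/(_ _ Y6)/allP/(_ _ Z6) := rank_ok.
have [v1 v2 v3] := And3 (codes_valid X6) (codes_valid Y6) (codes_valid Z6).
move: l; rewrite ex ey ez lineb_emb // => -> /hasP[a a_s /hasP[b _ /hasP[c _ /allP rel]]].
have [ea ea1 xE] := root_coef_emb x' inj.
have [eb eb1 yE] := root_coef_emb y' inj.
have [ec ec1 zE] := root_coef_emb z' inj.
exists (a * ea), (b * eb), (c * ec); split.
  have : ea \in [:: 1; -1] by rewrite !inE -sqrf_eq1 expr2 ea1.
  by move: a_s; rewrite !inE => /or4P[]/eqP-> /orP[]/eqP->.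
move=> v; have [/hasP[i i6 /eqP->]|no] := boolP (has (fun i => v == f i) (iota 0 6)).
  have /eqP := rel i i6.
  have red p e q : e * e = 1 -> p * e * (e * q) = p * q :> int.
    by move=> h; rewrite mulrA -(mulrA p) h mulr1.
  by rewrite xE yE zE !red.
have out w : w \in codes 6 -> root_coef (emb f w) v = 0.
  rewrite mem_codes => /andP[/andP[le _] lt]; apply: root_coef_out.
  rewrite (perm_mem (ends_emb f w)); apply: contra no => /mapP[i iw ->].
  apply/hasP; exists i => //; rewrite mem_iota add0n.
  by move: iw; rewrite !inE => /orP[]/eqP->; rewrite //=; exact: leq_ltn_trans le lt.
by rewrite !out // !mulr0 !addr0.
Qed.

Lemma nonline_minor x y z : valid x -> valid y -> valid z -> ~~ lineb x y z ->
  x != y -> x != z -> y != z -> exists u v w, minor x y z u v w \in small_units.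
Proof.
move=> vx vy vz l xy xz yz.
have [|f [inj [Y eX /allP YX]]] := @transfer [:: x; y; z]; first by rewrite /= vx vy vz.
have le6 : (size (vcover [:: x; y; z]) <= 6)%N by exact: (size_undup_flatten [:: x; y; z]).
case: Y eX YX => [|x' [|y' [|z' [|]]]] // [ex ey ez] YX.
have in6 w : w \in [:: x'; y'; z'] -> w \in codes 6 by move=> /YX; exact: codesW.
have [X6 Y6 Z6] : [/\ x' \in codes 6, y' \in codes 6 & z' \in codes 6].
  by split; apply: in6; rewrite ?mem_head // !in_cons eqxx ?orbT.
have /allP/(_ _ X6)/allP/(_ _ Y6)/allP/(_ _ Z6) := rank_ok.
have [v1 v2 v3] := And3 (codes_valid X6) (codes_valid Y6) (codes_valid Z6).
have ne a b : emb f a != emb f b -> a != b by apply: contraNneq => ->.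
move: l xy xz yz; rewrite ex ey ez lineb_emb // => /negPf -> /ne/negPf-> /ne/negPf-> /ne/negPf->.
rewrite !orbF lazy_hasE => /hasP[u _]; rewrite lazy_hasE => /hasP[v _]; rewrite lazy_hasE => /hasP[w _ m].
have [ea ea1 xE] := root_coef_emb x' inj.
have [eb eb1 yE] := root_coef_emb y' inj.
have [ec ec1 zE] := root_coef_emb z' inj.
exists (f u), (f v), (f w); rewrite /minor !xE !yE !zE.
set M := minor x' y' z' u v w in m.
have -> : ea * root_coef x' u * (eb * root_coef y' v * (ec * root_coef z' w) - eb * root_coef y' w * (ec * root_coef z' v))
  - ea * root_coef x' v * (eb * root_coef y' u * (ec * root_coef z' w) - eb * root_coef y' w * (ec * root_coef z' u))
  + ea * root_coef x' w * (eb * root_coef y' u * (ec * root_coef z' v) - eb * root_coef y' v * (ec * root_coef z' u))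
  = ea * eb * ec * M by rewrite /M /minor; ring.
have S e : e * e = 1 -> e \in [:: 1; -1 : int] by rewrite !inE -sqrf_eq1 expr2 => ->.
move: m (S _ ea1) (S _ eb1) (S _ ec1); rewrite !inE.
by move=> /or4P[]/eqP-> /orP[]/eqP-> /orP[]/eqP-> /orP[]/eqP->.
Qed.

Lemma free3P (K : fieldType) (V : vectType K) (a b c : V) :
  free [:: a; b; c] <->
  (forall x y z : K, x *: a + y *: b + z *: c = 0 -> [/\ x = 0, y = 0 & z = 0]).
Proof.
split=> [/(@freeP _ _ 3 [tuple a; b; c]) F x y z e|F].
  pose k (i : 'I_3) := nth 0 [:: x; y; z] i.
  have {}F := F k; rewrite !big_ord_recl big_ord0 /= addr0 in F.
  have {}F := F _; rewrite /k /= addrA in F.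
  by have h := F e; split; [exact: (h 0) | exact: (h 1) | exact: (h (Ordinal (isT : (2 < 3)%N)))].
apply/(@freeP _ _ 3 [tuple a; b; c]) => k.
rewrite !big_ord_recl big_ord0 /= addr0 addrA => /F[k0 k1 k2] [[|[|[|//]]] i3].
- by rewrite -k0; congr k; apply: val_inj.
- by rewrite -k1; congr k; apply: val_inj.
- by rewrite -k2; congr k; apply: val_inj.
Qed.

Section Forms.
Variables (K : fieldType) (l : nat).
(* In characteristic 2 the two forms of a double edge coincide. *)
Hypothesis char2 : (2 : K) != 0.

Definition form_at (v : nat) : 'Hom('rV[K]_l, K^o) :=
  if insub v is Some i then coordinate K i else 0.

Definition root_form (x : code) : 'Hom('rV[K]_l, K^o) :=
  if x.1.1 == x.1.2 then form_at x.1.1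
  else if x.2 then form_at x.1.1 + form_at x.1.2 else form_at x.1.1 - form_at x.1.2.

Lemma coordinateE (i : 'I_l) (u : 'rV[K]_l) : coordinate K i u = u 0 i.
Proof.
rewrite /coordinate; pose g := (fun x : 'rV[K]_l => x 0 i : K^o).
have gl : linear g by move=> a x y; rewrite /g !mxE.
pose G := GRing.isLinear.Build _ _ _ _ g gl.
pose gL : {linear 'rV[K]_l -> K^o} := HB.pack g G.
by rewrite -/g -[g]/(gL : _ -> _) lfunE.
Qed.

Lemma form_atE v (i : 'I_l) : form_at v (delta_mx 0 i) = (v == i)%:R.
Proof.
rewrite /form_at; case: insubP => [j _ <-|nv].
  by rewrite coordinateE mxE eqxx.
by rewrite zero_lfunE; case: eqP nv => // ->; rewrite ltn_ord.
Qed.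

Lemma formE x (i : 'I_l) : root_form x (delta_mx 0 i) = (root_coef x i)%:~R.
Proof.
rewrite /root_form /root_coef; case: x => [[a b] s] /=; have [->|ab] := eqVneq a b.
  by rewrite form_atE eq_sym; case: eqP.
have [ia|ia] := eqVneq (i : nat) a.
  have ib : (b == i :> nat) = false by rewrite ia eq_sym (negPf ab).
  by case: s; rewrite !(add_lfunE, opp_lfunE) !form_atE ib -ia eqxx ?oppr0 addr0.
have ai : (a == i :> nat) = false by rewrite eq_sym (negPf ia).
rewrite (eq_sym (i : nat)); case: s; rewrite !(add_lfunE, opp_lfunE) !form_atE ai;
  by case: eqP => _; rewrite ?oppr0 ?addr0 ?add0r ?rmorphN1.
Qed.

Lemma form_eq0 (h : 'Hom('rV[K]_l, K^o)) : (forall i, h (delta_mx 0 i) = 0) -> h = 0.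
Proof.
move=> h0; apply/lfunP=> u; rewrite zero_lfunE [u]row_sum_delta linear_sum big1 // => i _.
by rewrite linearZ /= h0 scaler0.
Qed.

(** In a line the relation of lineb_relation is nontrivial, since 2 is invertible; in
any other case the minor of nonline_minor is invertible and Cramer's rule makes
all coefficients of a relation vanish. *)
Lemma free_forms x y z : valid x -> valid y -> valid z ->
  (x.1.2 < l)%N -> (y.1.2 < l)%N -> (z.1.2 < l)%N -> x != y -> x != z -> y != z ->
  free [:: root_form x; root_form y; root_form z] = ~~ lineb x y z.
Proof.
move=> vx vy vz xl yl zl xy xz yz; have [l3|nl] /= := boolP (lineb x y z).
  apply/negP=> /free3P F.
  have [a [b [c [au rel]]]] := lineb_relation vx vy vz l3.
  have /F[a0 _ _] : a%:~R *: root_form x + b%:~R *: root_form y + c%:~R *: root_form z = 0.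
    apply: form_eq0 => i; rewrite !(add_lfunE, scale_lfunE) !formE.
    by rewrite /GRing.scale /= -!rmorphM -!rmorphD /= rel.
  move: au char2; rewrite !inE => /or4P[]/eqP e; rewrite e in a0; move: a0 => /eqP.
  - by rewrite oner_eq0.
  - by rewrite rmorphN oppr_eq0 oner_eq0.
  - by move=> ->.
  - by rewrite rmorphN oppr_eq0 => ->.
apply/free3P=> a b c rel.
have [u [v [w m]]] := nonline_minor vx vy vz nl xy xz yz.
have at_ t : a * (root_coef x t)%:~R + b * (root_coef y t)%:~R + c * (root_coef z t)%:~R = 0 :> K.
  have [tl|lt] := ltnP t l.
    have := congr1 (fun h : 'Hom('rV[K]_l, K^o) => h (delta_mx 0 (Ordinal tl))) rel.
    by rewrite !(add_lfunE, scale_lfunE) !formE zero_lfunE.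
  have out p : valid p -> (p.1.2 < l)%N -> root_coef p t = 0.
    move=> /andP[le _] pl; apply: root_coef_out; rewrite !inE negb_or.
    by apply/andP; split; apply/negP=> /eqP e; lia.
  by rewrite !out // !mulr0 !addr0.
have mu : ((minor x y z u v w)%:~R : K) != 0.
  move: m char2; rewrite !inE => /or4P[]/eqP->; rewrite ?rmorphN ?oppr_eq0 ?oner_eq0 //.
have := at_ w; have := at_ v; have := at_ u; move: mu; rewrite /minor.
rewrite !(rmorphD, rmorphB, rmorphM, rmorphN) /=.
set xu := (root_coef x u)%:~R; set xv := (root_coef x v)%:~R; set xw := (root_coef x w)%:~R.
set yu := (root_coef y u)%:~R; set yv := (root_coef y v)%:~R; set yw := (root_coef y w)%:~R.
set zu := (root_coef z u)%:~R; set zv := (root_coef z v)%:~R; set zw := (root_coef z w)%:~R.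
pose D := xu * (yv * zw - yw * zv) - xv * (yu * zw - yw * zu) + xw * (yu * zv - yv * zu).
rewrite -/D => Dnz e1 e2 e3.
have cancel k : D * k = 0 -> k = 0 by move=> /eqP; rewrite mulf_eq0 (negPf Dnz) => /eqP.
split; apply: cancel; rewrite /D.
- transitivity ((a * xu + b * yu + c * zu) * (yv * zw - yw * zv)
    - (a * xv + b * yv + c * zv) * (yu * zw - yw * zu)
    + (a * xw + b * yw + c * zw) * (yu * zv - yv * zu)); first by ring.
  by rewrite e1 e2 e3 !mul0r subrr addr0.
- transitivity ((a * xu + b * yu + c * zu) * (xw * zv - xv * zw)
    + (a * xv + b * yv + c * zv) * (xu * zw - xw * zu)
    + (a * xw + b * yw + c * zw) * (xv * zu - xu * zv)); first by ring.
  by rewrite e1 e2 e3 !mul0r !addr0.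
transitivity ((a * xu + b * yu + c * zu) * (xv * yw - xw * yv)
    + (a * xv + b * yv + c * zv) * (xw * yu - xu * yw)
    + (a * xw + b * yw + c * zw) * (xu * yv - xv * yu)); first by ring.
by rewrite e1 e2 e3 !mul0r !addr0.
Qed.

End Forms.

Local Close Scope ring_scope.

(** * Signed graphs as sets of codes *)

Section Elem.
Variable l : nat.
Implicit Types (H G : sgraph 'I_l) (x : code) (i j : 'I_l).

Definition edges (s : bool) H := if s then neg_edges H else pos_edges H.

Definition elem H x : bool :=
  [exists i : 'I_l, exists j : 'I_l, [&& val i == x.1.1, val j == x.1.2 &
    if i == j then x.2 && (i \in loops H) else (i < j) && ([set i; j] \in edges x.2 H)]].

Lemma elem_edge H i j s : i < j -> elem H (val i, val j, s) = ([set i; j] \in edges s H).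
Proof.
move=> ij; apply/existsP/idP => [[i' /existsP[j' /and3P[/= /eqP/val_inj-> /eqP/val_inj->]]]|e].
  by rewrite -val_eqE /= ltn_eqF // ij.
by exists i; apply/existsP; exists j; rewrite /= !eqxx -val_eqE /= ltn_eqF // ij.
Qed.

Lemma elem_loop H i s : elem H (val i, val i, s) = s && (i \in loops H).
Proof.
apply/existsP/idP => [[i' /existsP[j' /and3P[/= /eqP/val_inj-> /eqP/val_inj->]]]|e].
  by rewrite eqxx.
by exists i; apply/existsP; exists i; rewrite /= !eqxx.
Qed.

Lemma elemP H x : elem H x ->
  (exists i j, [/\ i < j, x = (val i, val j, x.2) & [set i; j] \in edges x.2 H]) \/
  (exists i, x = (val i, val i, true) /\ i \in loops H).
Proof.
case: x => [[a b] s] /existsP[i /existsP[j /and3P[/= /eqP<- /eqP<-]]].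
case: eqP => [<-|_] /andP[]; first by case: s => // _ iL; right; exists i.
by move=> ij e; left; exists i, j.
Qed.

Lemma elem_valid H x : elem H x -> valid x && (x.1.2 < l).
Proof.
case/elemP=> [[i [j [ij -> _]]]|[i [-> _]]]; rewrite /valid /= ltn_ord andbT.
  by rewrite ltnW // ltn_eqF.
by rewrite leqnn eqxx.
Qed.

Lemma edgesP s H (e : {set 'I_l}) : e \in edges s H -> (#|e| == 2) && (e \subset vertices H).
Proof.
have := sgraphP H; rewrite /edges /neg_edges /pos_edges /vertices -[sgraph_val H]/(val H).
case: (val H) => [[[V Ep] Em] L] /= /and3P[/forall_inP hp /forall_inP hm _].
by case: s; [exact: hm | exact: hp].
Qed.

Lemma loops_sub H : loops H \subset vertices H.
Proof.
have := sgraphP H; rewrite /loops /vertices -[sgraph_val H]/(val H).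
by case: (val H) => [[[V Ep] Em] L] /= /and3P[].
Qed.

Lemma edge_set s H (e : {set 'I_l}) : e \in edges s H -> exists i j, i < j /\ e = [set i; j].
Proof.
move=> /edgesP/andP[/cards2P[i [j [ij ->]]] _]; move: ij; rewrite -val_eqE neq_ltn => /orP[lt|lt].
  by exists i, j.
by exists j, i; rewrite setUC.
Qed.

Lemma elem_subgraph H G : vertices H \subset vertices G ->
  (forall x, elem H x -> elem G x) -> subgraph H G.
Proof.
move=> vHG sub; rewrite /subgraph vHG.
have es s : edges s H \subset edges s G.
  apply/subsetP=> e eH; have [i [j [ij ee]]] := edge_set eH; rewrite ee in eH *.
  by rewrite -elem_edge //; apply: sub; rewrite elem_edge.
rewrite (es false) (es true) /=; apply/subsetP=> i iH.
by have := sub (val i, val i, true); rewrite !elem_loop; apply.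
Qed.

Lemma subgraph_elem H G x : subgraph H G -> elem H x -> elem G x.
Proof.
case/and4P=> _ /subsetP hp /subsetP hm /subsetP hl /elemP[[i [j [ij -> e]]]|[i [-> iH]]].
  by rewrite elem_edge //; case: x.2 e; [exact: hm | exact: hp].
by rewrite elem_loop; exact: hl.
Qed.

Lemma subgraph_anti H G : subgraph H G -> subgraph G H -> H = G.
Proof.
rewrite /subgraph /vertices /pos_edges /neg_edges /loops.
case: H G => [[[[V Ep] Em] L] wf] [[[[V' Ep'] Em'] L'] wf'] /=.
move=> /and4P[a b c d] /and4P[a' b' c' d']; apply: val_inj => /=.
by congr (_, _, _, _); apply/eqP; rewrite eqEsubset ?a ?b ?c ?d.
Qed.

End Elem.

Section Image.
Variables (k l : nat) (phi : 'I_k -> 'I_l).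
Hypothesis phi_inj : injective phi.
Implicit Type M : sgraph 'I_k.

Definition image_data M : sgraph_data 'I_l :=
  (phi @: vertices M, [set phi @: (e : {set 'I_k}) | e in pos_edges M],
   [set phi @: (e : {set 'I_k}) | e in neg_edges M], phi @: loops M).

Lemma image_wf M : sgraph_wf (image_data M).
Proof.
have E s (e : {set 'I_k}) : e \in edges s M ->
    (#|phi @: e| == 2) && (phi @: e \subset phi @: vertices M).
  by move=> /edgesP/andP[ce se]; rewrite card_imset // ce imsetS.
apply/and3P; split; last exact/imsetS/loops_sub.
  by apply/forall_inP=> _ /imsetP[e eM ->]; apply: (E false).
by apply/forall_inP=> _ /imsetP[e eM ->]; apply: (E true).
Qed.

Definition graph_image M : sgraph 'I_l := SGraph (image_wf M).

Lemma edges_image s M : edges s (graph_image M) = [set phi @: (e : {set 'I_k}) | e in edges s M].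
Proof. by case: s. Qed.

Lemma elem_image M f x : (forall i : 'I_k, f (val i) = val (phi i)) ->
  elem (graph_image M) x <-> exists2 y, elem M y & x = emb f y.
Proof.
move=> fE; split=> [/elemP[[i [j [ij ex]]]|[i [ex]]]|[y My ->]].
- rewrite edges_image => /imsetP[e /[dup] eM /edge_set[a [b [ab ee]]]].
  rewrite ee imsetU1 imset_set1 => eij.
  exists (val a, val b, x.2); first by rewrite elem_edge // -ee.
  rewrite {1}ex /emb /norm /= !fE.
  have ii : i \in [set phi a; phi b] by rewrite -eij !inE eqxx.
  have jj : j \in [set phi a; phi b] by rewrite -eij !inE eqxx orbT.
  move: ij; rewrite !inE in ii jj.
  case/orP: ii => /eqP->; case/orP: jj => /eqP-> /=; rewrite ?ltnn //.
    by move/ltnW => ->.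
  by rewrite ltnNge => /negbTE->.
- move=> /imsetP[a aM ei]; exists (val a, val a, true); first by rewrite elem_loop.
  by rewrite ex /emb /norm /= !fE leqnn ei.
case/elemP: My => [[a [b [ab ey eM]]]|[a [-> aM]]].
  have em : [set phi a; phi b] \in edges y.2 (graph_image M).
    rewrite edges_image; apply/imsetP; exists [set a; b] => //.
    by rewrite imsetU1 imset_set1.
  rewrite ey /emb /norm /= !fE; case: leqP => h.
    by rewrite elem_edge // ltn_neqAle h andbT val_eqE (inj_eq phi_inj) -val_eqE ltn_eqF.
  by rewrite elem_edge // setUC.
by rewrite /emb /norm /= !fE leqnn elem_loop; exact: imset_f.
Qed.

End Image.

Section Switch.
Variable k : nat.
Implicit Types (M : sgraph 'I_k) (sigma : {ffun 'I_k -> bool}).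

Definition sign_seq sigma : seq bool := map sigma (enum 'I_k).

Lemma nth_sign_seq sigma (i : 'I_k) : nth false (sign_seq sigma) (val i) = sigma i.
Proof.
rewrite /sign_seq (nth_map i); last by rewrite size_enum_ord; exact: ltn_ord.
by congr (sigma _); exact: nth_ord_enum.
Qed.

Lemma flips_edge sigma (i j : 'I_k) : i != j -> flips sigma [set i; j] = sigma i (+) sigma j.
Proof.
move=> ij; rewrite /flips.
have -> : #|[set x in [set i; j] | sigma x]| = (sigma i + sigma j)%N.
  rewrite [#|_|](cardsD1 i) [#|_ :\ i|](cardsD1 j) !inE !eqxx (eq_sym j) ij orbT /= addnA -[RHS]addn0.
  congr (_ + _)%N; apply: eq_card0 => x; rewrite !inE.
  by apply/negP=> /and4P[/negPf-> /negPf->].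
by rewrite oddD !oddb.
Qed.

Lemma twist_loop sg a s : twist sg (a, a, s) = (a, a, s).
Proof. by rewrite /twist /= -addbA addbb addbF. Qed.

Lemma elem_switch M sigma x : elem (switch sigma M) x = elem M (twist (sign_seq sigma) x).
Proof.
have main (i j : 'I_k) s : (i < j)%N -> elem (switch sigma M) (val i, val j, s)
    = elem M (val i, val j, s (+) sigma i (+) sigma j).
  move=> ij; rewrite !elem_edge //.
  have nij : i != j by rewrite -val_eqE ltn_eqF.
  rewrite /edges /switch /neg_edges /pos_edges /=.
  case: s; rewrite !inE flips_edge //; by case: (sigma i); case: (sigma j); rewrite /= ?andbT ?andbF ?orbF.
have loop (i : 'I_k) s : elem (switch sigma M) (val i, val i, s) = elem M (val i, val i, s).
  by rewrite !elem_loop.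
apply/idP/idP => h; have := h.
  case/elemP=> [[i [j [ij ex _]]]|[i [ex _]]]; move: h; rewrite ex.
    by rewrite main // /twist /= !nth_sign_seq.
  by rewrite loop twist_loop.
case: x h => [[a b] s] h; case/elemP=> [[i [j [ij []]]]|[i [[]]]] /=.
  by move=> ea eb _; move: h; rewrite ea eb /twist /= !nth_sign_seq main.
by move=> ea eb _; move: h; rewrite ea eb twist_loop loop.
Qed.

Lemma twistK sg x : twist sg (twist sg x) = x.
Proof. by case: x => [[a b] s]; rewrite /twist /= -!addbA; case: s; do 2!case: nth. Qed.

(** Switching exchanges the two edges of a double edge. *)
Lemma switch_double M sigma : pos_edges M = neg_edges M -> switch sigma M = M.
Proof.
move=> e; have U (E : {set {set 'I_k}}) :
    [set x in E | ~~ flips sigma x] :|: [set x in E | flips sigma x] = E.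
  by apply/setP=> x; rewrite !inE -andb_orr orNb andbT.
apply: val_inj; rewrite /= /switch_data -e !U {2}e.
by rewrite /vertices /pos_edges /neg_edges /loops -!surjective_pairing.
Qed.

End Switch.

(** * Isomorphism and switching on codes *)

Section Iso.
Variables (k l : nat).
Implicit Types (M : sgraph 'I_k.+1) (H G : sgraph 'I_l).

(** As M has all of 'I_k.+1 as vertices, the inverse of the isomorphism is an
injection phi. *)
Lemma iso_image H M : vertices M = [set: 'I_k.+1] -> sgraph_iso H M ->
  exists phi (phi_inj : injective phi), H = graph_image phi_inj M.
Proof.
move=> vM /existsP[g /and5P[/dinjectiveP ginj /eqP vg /eqP pg /eqP ng /eqP lg]].
have ex i : exists v, (v \in vertices H) && (g v == i).
  have : i \in g @: vertices H by rewrite vg vM inE.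
  by case/imsetP=> v vH ->; exists v; rewrite vH /=.
pose phi i := xchoose (ex i).
have phiP i : phi i \in vertices H /\ g (phi i) = i.
  by have /andP[-> /eqP->] := xchooseP (ex i).
have phiK v : v \in vertices H -> phi (g v) = v.
  by move=> vH; have [h1 h2] := phiP (g v); apply: ginj.
have phi_inj : injective phi by move=> i j e; have [_ <-] := phiP i; rewrite e; have [_ ->] := phiP j.
exists phi, phi_inj.
have im (e : {set 'I_l}) : e \subset vertices H -> phi @: (g @: e) = e.
  move=> /subsetP eH; rewrite -imset_comp -[RHS]imset_id; apply: eq_in_imset => v ve /=.
  by rewrite phiK ?eH.
have ims s (E : {set {set 'I_l}}) : E = edges s H ->
    E = [set phi @: (e : {set 'I_k.+1}) | e in [set g @: (e : {set 'I_l}) | e in E]].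
  move=> eE; rewrite -imset_comp -[LHS]imset_id; apply: eq_in_imset => e eH /=.
  by rewrite im //; rewrite eE in eH; have /andP[] := edgesP eH.
have vE : vertices (graph_image phi_inj M) = vertices H by rewrite {1}/vertices /= -vg im.
have pE : pos_edges (graph_image phi_inj M) = pos_edges H.
  by rewrite {1}/pos_edges /= -pg; apply/esym/(ims false).
have nE : neg_edges (graph_image phi_inj M) = neg_edges H.
  by rewrite {1}/neg_edges /= -ng; apply/esym/(ims true).
have lE : loops (graph_image phi_inj M) = loops H.
  by rewrite {1}/loops /= -lg im // loops_sub.
by apply: subgraph_anti; rewrite /subgraph vE pE nE lE !subxx.
Qed.

Lemma image_iso (phi : 'I_k.+1 -> 'I_l) (phi_inj : injective phi) M :
  sgraph_iso (graph_image phi_inj M) M.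
Proof.
apply/existsP; pose g := [ffun v => odflt ord0 [pick i | phi i == v]]; exists g.
have gK i : g (phi i) = i.
  rewrite ffunE; case: pickP => [j /eqP/phi_inj->//|/(_ i)]; by rewrite eqxx.
have im (e : {set 'I_k.+1}) : g @: (phi @: e) = e.
  by rewrite -imset_comp -[RHS]imset_id; apply: eq_imset => v /=; rewrite gK.
have ims (E : {set {set 'I_k.+1}}) :
    [set g @: (e : {set 'I_l}) | e in [set phi @: (e : {set 'I_k.+1}) | e in E]] = E.
  by rewrite -imset_comp -[RHS]imset_id; apply: eq_imset => e /=; rewrite im.
rewrite /vertices /pos_edges /neg_edges /loops /= !im !ims !eqxx !andbT.
by apply/dinjectiveP => _ _ /imsetP[i _ ->] /imsetP[j _ ->]; rewrite !gK => ->.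
Qed.

Lemma iso_bar_image H M : vertices M = [set: 'I_k.+1] ->
  sgraph_iso_bar H M <->
  exists phi (phi_inj : injective phi) sigma, H = graph_image phi_inj (switch sigma M).
Proof.
move=> vM; split=> [/existsP[M' /andP[/existsP[sigma /eqP->]]]|[phi [phi_inj [sigma ->]]]].
  by move=> /iso_image[//|phi [phi_inj ->]]; exists phi, phi_inj, sigma.
apply/existsP; exists (switch sigma M); rewrite image_iso andbT.
by apply/existsP; exists sigma.
Qed.

(** The graphs D_l, D_l^1 and B_l have only double edges, so that counting them up
to isomorphism agrees with counting them up to switching and isomorphism, as is
done for the other kinds. *)
Lemma iso_double H M : pos_edges M = neg_edges M -> sgraph_iso H M = sgraph_iso_bar H M.
Proof.
move=> e; apply/idP/existsP => [h|[M' /andP[/existsP[sigma /eqP->]]]].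
  exists M; rewrite h andbT; apply/existsP; exists [ffun=> false].
  by rewrite switch_double.
by rewrite switch_double.
Qed.

Definition copies M (Mc : seq code) (H : sgraph 'I_l) (f : nat -> nat) (sg : seq bool) : Prop :=
  (forall x, elem H x <-> x \in map (emb f) (map (twist sg) Mc)) /\
  (forall v : 'I_l, v \in vertices H <-> val v \in map f (iota 0 k.+1)).

Lemma image_copies (phi : 'I_k.+1 -> 'I_l) (phi_inj : injective phi) M Mc sigma f :
  vertices M = [set: 'I_k.+1] -> (forall y, elem M y = (y \in Mc)) ->
  (forall i : 'I_k.+1, f (val i) = val (phi i)) ->
  copies M Mc (graph_image phi_inj (switch sigma M)) f (sign_seq sigma).
Proof.
move=> vM eM fE; split=> [x|v].
  rewrite elem_image //; split=> [[y]|/mapP[_ /mapP[y yM ->] ->]].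
    rewrite elem_switch eM => yM ->; apply: map_f.
    by rewrite -[y](twistK (sign_seq sigma)); apply: map_f.
  by exists (twist (sign_seq sigma) y); rewrite // elem_switch twistK eM.
have -> : vertices (graph_image phi_inj (switch sigma M)) = phi @: vertices M by [].
rewrite vM; split=> [/imsetP[i _ ->]|/mapP[ i ]].
  by rewrite -fE map_f // mem_iota; exact: ltn_ord.
rewrite mem_iota add0n => /= ik e; apply/imsetP; exists (Ordinal ik); first by rewrite inE.
by apply: ord_inj; rewrite [LHS]e -[RHS]fE.
Qed.

Lemma iso_bar_copies H M Mc : vertices M = [set: 'I_k.+1] ->
  (forall y, elem M y = (y \in Mc)) -> sgraph_iso_bar H M ->
  exists f sg, [/\ injective f, size sg = k.+1 & copies M Mc H f sg].
Proof.
move=> vM eM /iso_bar_image[//|phi [phi_inj [sigma ->]]].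
have [|f finj fE] := @extend_inj k.+1 (fun i => val (phi (inord i))).
  move=> i j ik jk /val_inj/phi_inj e.
  by rewrite -(inordK ik) e inordK.
exists f, (sign_seq sigma); split=> //; first by rewrite size_map size_enum_ord.
apply: image_copies => // i; rewrite fE; first by rewrite inord_val.
exact: ltn_ord.
Qed.

Lemma copies_iso_bar G M Mc f sg : vertices G = [set: 'I_l] ->
  vertices M = [set: 'I_k.+1] -> (forall y, elem M y = (y \in Mc)) ->
  injective f -> size sg = k.+1 ->
  (forall i, i < k.+1 -> i \in flatten (map ends Mc)) ->
  all (elem G) (map (emb f) (map (twist sg) Mc)) ->
  exists2 H, subgraph H G & sgraph_iso_bar H M /\ copies M Mc H f sg.
Proof.
move=> vG vM eM finj sz spn AG.
have fl (i : 'I_k.+1) : f i < l.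
  have /flatten_mapP[y yM iy] := spn _ (ltn_ord i).
  have /elem_valid/andP[/andP[le _] lt] := allP AG _ (map_f (emb f) (map_f (twist sg) yM)).
  have : f i \in ends (emb f (twist sg y)).
    by rewrite (perm_mem (ends_emb f _)); apply: map_f.
  by rewrite !inE => /orP[]/eqP->; rewrite // (leq_ltn_trans le).
pose phi i := Ordinal (fl i).
have phi_inj : injective phi by move=> i j [/finj/val_inj].
pose sigma := [ffun i : 'I_k.+1 => nth false sg i].
have sE : sign_seq sigma = sg.
  apply: (@eq_from_nth _ false); first by rewrite size_map size_enum_ord sz.
  move=> i; rewrite size_map size_enum_ord => ik.
  by rewrite -[ i ]/(val (Ordinal ik)) nth_sign_seq ffunE.
have cp := @image_copies phi phi_inj M Mc sigma f vM eM (fun i => erefl); rewrite sE in cp.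
exists (graph_image phi_inj (switch sigma M)); last first.
  by split=> //; apply/iso_bar_image => //; exists phi, phi_inj, sigma.
apply: elem_subgraph; first by rewrite vG subsetT.
by move=> x /(cp.1 x); exact: (allP AG).
Qed.

End Iso.

Section FullGraphs.
Variables (k : nat) (Ep Em : {set {set 'I_k}}) (L : {set 'I_k}).
Hypotheses (Epc : Ep \subset complete_edges k) (Emc : Em \subset complete_edges k).

Lemma elem_full (ed : bool -> nat -> nat -> bool) (lp : nat -> bool) y :
  (forall s (i j : 'I_k), i < j -> ([set i; j] \in if s then Em else Ep) = ed s i j) ->
  (forall i, (i \in L) = lp i) ->
  elem (SGraph (full_wf L Epc Emc)) y
  = (y \in [seq x <- codes k | if x.1.1 == x.1.2 then lp x.1.1 else ed x.2 x.1.1 x.1.2]).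
Proof.
move=> hed hlp; rewrite mem_filter mem_codes.
apply/idP/andP => [|[]].
  move=> /[dup] /elem_valid-> /elemP[[i [j [ij -> e]]]|[i [-> iL]]]; split=> //=.
    by rewrite ltn_eqF // -hed //; case: y.2 e.
  by rewrite eqxx -hlp.
case: y => [[a b] s] /=; case: eqP => [<-|/eqP ab] h /andP[/andP[/= le /implyP hs] bk].
  have := elem_loop (SGraph (full_wf L Epc Emc)) (Ordinal bk) s => /= ->.
  by rewrite hs // [loops _]/= hlp.
have ab' : a < b by rewrite ltn_neqAle ab.
have ak := ltn_trans ab' bk.
have := @elem_edge _ (SGraph (full_wf L Epc Emc)) (Ordinal ak) (Ordinal bk) s ab' => /= ->.
by have := hed s (Ordinal ak) (Ordinal bk) ab'; rewrite /= h; case: (s).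
Qed.

End FullGraphs.

Lemma complete_edge k (i j : 'I_k) : i < j -> ([set i; j] \in complete_edges k) = true.
Proof.
have ne : (i < j) -> (i == j) = false by move=> ij; rewrite -val_eqE /= ltn_eqF.
by move=> /ne ij; rewrite inE cards2 ij.
Qed.

Lemma elem_K k y : elem (graph_K k) y = (y \in [seq x <- codes k | ~~ x.2]).
Proof.
rewrite (@elem_full _ _ _ _ _ _ (fun s _ _ => ~~ s) (fun=> false)).
- rewrite !mem_filter mem_codes; case: y => [[a b] [|]] /=; first by case: eqP.
  by case: eqP => // ->; rewrite /valid /= eqxx andbF.
- by case=> i j ij; [rewrite inE | rewrite complete_edge].
by move=> i; rewrite inE.
Qed.

Lemma elem_Kl k y : elem (graph_Kl k) y = (y \in [seq x <- codes k | (x.1.1 == x.1.2) || ~~ x.2]).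
Proof.
rewrite (@elem_full _ _ _ _ _ _ (fun s _ _ => ~~ s) (fun=> true)).
- by rewrite !mem_filter; congr (_ && _); case: eqP.
- by case=> i j ij; [rewrite inE | rewrite complete_edge].
by move=> i; rewrite inE.
Qed.

Lemma elem_D k y : elem (graph_D k) y = (y \in [seq x <- codes k | x.1.1 != x.1.2]).
Proof.
rewrite (@elem_full _ _ _ _ _ _ (fun _ _ _ => true) (fun=> false)).
- by rewrite !mem_filter; congr (_ && _); case: eqP.
- by move=> s i j ij; rewrite if_same complete_edge.
by move=> i; rewrite inE.
Qed.

Lemma elem_D1 k y : elem (graph_D1 k) y
  = (y \in [seq x <- codes k | (x.1.1 != x.1.2) || (x.1.1 == 0)]).
Proof.
rewrite (@elem_full _ _ _ _ _ _ (fun _ _ _ => true) (fun i => i == 0)).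
- by rewrite !mem_filter; congr (_ && _); case: eqP.
- by move=> s i j ij; rewrite if_same complete_edge.
by move=> i; rewrite inE.
Qed.

Lemma elem_B k y : elem (graph_B k) y = (y \in codes k).
Proof.
rewrite (@elem_full _ _ _ _ _ _ (fun _ _ _ => true) (fun i => true)).
- by rewrite !mem_filter if_same.
- by move=> s i j ij; rewrite if_same complete_edge.
by move=> i; rewrite inE.
Qed.

Lemma elem_Gcirc y : elem graph_Gcirc y
  = (y \in [seq x <- codes 3 | if x.1.1 == x.1.2 then x.1.1 == 1
                               else ~~ x.2 || (x.1.1 == 1) || (x.1.2 == 1)]).
Proof.
have i1 (i : 'I_3) : (i == inord 1) = (i == 1 :> nat) by rewrite -val_eqE /= inordK.
rewrite (@elem_full _ _ _ _ _ _ (fun s i j => ~~ s || (i == 1) || (j == 1)) (fun i => i == 1)) //.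
- case=> i j ij; last by rewrite complete_edge.
  by rewrite in_setI complete_edge // !inE ![inord 1 == _]eq_sym !i1.
by move=> i; rewrite inE i1.
Qed.

Local Open Scope ring_scope.

(** * The eight kinds of subgraphs *)

Section Kinds.
Local Open Scope nat_scope.
Variable l : nat.
Implicit Types (G H : sgraph 'I_l).

Definition kind_iso (k : nat) H : bool :=
  match k with
  | 0 => sgraph_iso_bar H (graph_K 3)
  | 1 => sgraph_iso_bar H (graph_K 4)
  | 2 => sgraph_iso H (graph_D 3)
  | 3 => sgraph_iso H (graph_D1 2)
  | 4 => sgraph_iso_bar H (graph_Kl 2)
  | 5 => sgraph_iso_bar H (graph_Kl 3)
  | 6 => sgraph_iso_bar H graph_Gcirc
  | 7 => sgraph_iso H (graph_D1 3)
  | _ => false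
  end.

(** The second condition excludes isolated vertices: a subgraph is then determined
by its edges and loops. *)
Definition realizes H (s : seq code) : Prop :=
  (forall x, elem H x <-> x \in s) /\
  (forall v : 'I_l, v \in vertices H -> exists2 x, elem H x & val v \in ends x).

Definition kind_graph_spec n (M : sgraph 'I_n.+1) (k : nat) : Prop :=
  [/\ vertices M = [set: 'I_n.+1], kind_order k = n.+1,
      forall y, elem M y = (y \in kind_codes k)
    & all (mem (flatten (map ends (kind_codes k)))) (iota 0 n.+1)].

Lemma kind_graphs :
  [/\ kind_graph_spec (graph_K 3) 0, kind_graph_spec (graph_K 4) 1,
      kind_graph_spec (graph_D 3) 2, kind_graph_spec (graph_D1 2) 3
    & [/\ kind_graph_spec (graph_Kl 2) 4, kind_graph_spec (graph_Kl 3) 5,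
          kind_graph_spec graph_Gcirc 6 & kind_graph_spec (graph_D1 3) 7]].
Proof.
do !split=> //; move=> y.
- by rewrite elem_K; apply: perm_mem; vm_compute.
- by rewrite elem_K; apply: perm_mem; vm_compute.
- by rewrite elem_D; apply: perm_mem; vm_compute.
- by rewrite elem_D1; apply: perm_mem; vm_compute.
- by rewrite elem_Kl; apply: perm_mem; vm_compute.
- by rewrite elem_Kl; apply: perm_mem; vm_compute.
- by rewrite elem_Gcirc; apply: perm_mem; vm_compute.
by rewrite elem_D1; apply: perm_mem; vm_compute.
Qed.

Lemma iso_bar_realizes n (M : sgraph 'I_n.+1) k H : kind_graph_spec M k -> sgraph_iso_bar H M ->
  exists f c, [/\ injective f, c \in switchings k & realizes H (map (emb f) c)].
Proof.
case=> vM ko eM /allP spn /(iso_bar_copies vM eM)[f [sg [finj sz [eH vH]]]].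
exists f, (map (twist sg) (kind_codes k)); split=> //.
  by apply/map_f; rewrite mem_bools ko sz.
split=> // v /vH /mapP[i /spn /flatten_mapP[y yM iy] ev].
exists (emb f (twist sg y)); first by apply/eH/map_f/map_f.
by rewrite ev (perm_mem (ends_emb f _)); apply: map_f.
Qed.

Lemma realizes_iso_bar n (M : sgraph 'I_n.+1) k G f c : kind_graph_spec M k ->
  vertices G = [set: 'I_l] -> injective f -> c \in switchings k ->
  all (elem G) (map (emb f) c) ->
  exists2 H, subgraph H G & sgraph_iso_bar H M /\ (forall x, elem H x <-> x \in map (emb f) c).
Proof.
case=> vM ko eM /allP spn vG finj /mapP[sg]; rewrite mem_bools ko => /eqP sz -> AG.
have spn' i : i < n.+1 -> i \in flatten (map ends (kind_codes k)).
  by move=> ik; apply: spn; rewrite mem_iota.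
have [H HG [iso [eH _]]] := copies_iso_bar vG vM eM finj sz spn' AG.
by exists H.
Qed.

Lemma kind_realizes k H : kind_iso k H ->
  exists f c, [/\ injective f, c \in switchings k & realizes H (map (emb f) c)].
Proof.
have [s0 s1 s2 s3 [s4 s5 s6 s7]] := kind_graphs.
case: k => [|[|[|[|[|[|[|[|//]]]]]]]] /=; rewrite ?iso_double //.
- exact: iso_bar_realizes s0.
- exact: iso_bar_realizes s1.
- exact: iso_bar_realizes s2.
- exact: iso_bar_realizes s3.
- exact: iso_bar_realizes s4.
- exact: iso_bar_realizes s5.
- exact: iso_bar_realizes s6.
exact: iso_bar_realizes s7.
Qed.

Lemma realizes_kind k G f c : k \in kinds -> vertices G = [set: 'I_l] -> injective f ->
  c \in switchings k -> all (elem G) (map (emb f) c) ->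
  exists2 H, subgraph H G & kind_iso k H /\ (forall x, elem H x <-> x \in map (emb f) c).
Proof.
have [s0 s1 s2 s3 [s4 s5 s6 s7]] := kind_graphs; move=> kk vG finj ck AG.
have done_ n (M : sgraph 'I_n.+1) : kind_graph_spec M k -> (forall H, sgraph_iso_bar H M = kind_iso k H) ->
    exists2 H, subgraph H G & kind_iso k H /\ (forall x, elem H x <-> x \in map (emb f) c).
  move=> sp e; have [H HG [iso eH]] := realizes_iso_bar sp vG finj ck AG.
  by exists H; rewrite // -e.
move: kk ck done_; rewrite mem_iota; case: k => [|[|[|[|[|[|[|[|//]]]]]]]] _ ck done_.
- exact: done_ s0 _.
- exact: done_ s1 _.
- by apply: done_ s2 _ => H; rewrite -iso_double.
- by apply: done_ s3 _ => H; rewrite -iso_double.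
- exact: done_ s4 _.
- exact: done_ s5 _.
- exact: done_ s6 _.
by apply: done_ s7 _ => H; rewrite -iso_double.
Qed.

Lemma elem_ends H x (v : 'I_l) : elem H x -> val v \in ends x -> v \in vertices H.
Proof.
case/elemP=> [[i [j [ij -> /edgesP/andP[_ /subsetP sub]]]]|[i [-> iL]]].
  by rewrite !inE => /orP[]/eqP/val_inj->; apply: sub; rewrite !inE eqxx ?orbT.
by rewrite !inE orbb => /eqP/val_inj->; exact: (subsetP (loops_sub H)).
Qed.

Lemma realizes_subgraph H H' s : realizes H s -> (forall x, x \in s -> elem H' x) -> subgraph H H'.
Proof.
case=> eH vH sub; apply: elem_subgraph => [|x /eH/sub//].
by apply/subsetP=> v /vH[x /eH/sub xs vx]; exact: elem_ends xs vx.
Qed.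

Lemma no_B2 G f : vertices G = [set: 'I_l] ->
  ~ (exists H, subgraph H G /\ sgraph_iso H (graph_B 2)) ->
  injective f -> ~~ all (elem G) (map (emb f) B2_codes).
Proof.
move=> vG noB finj; apply/negP=> AG; case: noB.
have eM y : elem (graph_B 2) y = (y \in B2_codes).
  by rewrite elem_B; apply: perm_mem; vm_compute.
have spn i : i < 2 -> i \in flatten (map ends B2_codes) by case: i => [|[|]].
have AG' : all (elem G) (map (emb f) (map (twist [:: false; false]) B2_codes)) by exact: AG.
have vM : vertices (graph_B 2) = [set: 'I_2] by [].
have sz : size [:: false; false] = 2 by [].
have [H HG [iso _]] := copies_iso_bar vG vM eM finj sz spn AG'.
by exists H; rewrite iso_double.
Qed.

End Kinds.

(** * The hyperplanes of a signed graphic arrangement *)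

Definition pair_check : bool :=
  all (fun x => all (fun y => (x == y) ||
    has (fun u => has (fun v =>
      root_coef x u * root_coef y v - root_coef x v * root_coef y u \in small_units)
    (iota 0 4)) (iota 0 4)) (codes 4)) (codes 4).

Lemma pair_ok : pair_check. Proof. by vm_compute. Qed.

Lemma distinct_minor x y : valid x -> valid y -> x != y ->
  exists u v, root_coef x u * root_coef y v - root_coef x v * root_coef y u \in small_units.
Proof.
move=> vx vy; have [|f [inj [Y eX /allP YX]]] := @transfer [:: x; y]; first by rewrite /= vx vy.
have le4 : (size (vcover [:: x; y]) <= 4)%N by exact: (size_undup_flatten [:: x; y]).
case: Y eX YX => [|x' [|y' [|]]] // [ex ey] YX xy.
have in4 w : w \in [:: x'; y'] -> w \in codes 4 by move=> /YX; exact: codesW.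
have [X4 Y4] : x' \in codes 4 /\ y' \in codes 4.
  by split; apply: in4; rewrite ?mem_head // !in_cons eqxx ?orbT.
have /allP/(_ _ X4)/allP/(_ _ Y4)/orP[/eqP e|] := pair_ok.
  by rewrite ex ey e eqxx in xy.
case/hasP=> u _ /hasP[v _ m].
have [ea ea1 xE] := root_coef_emb x' inj; have [eb eb1 yE] := root_coef_emb y' inj.
exists (f u), (f v); rewrite ex ey !xE !yE.
set M := (X in X \in small_units) in m.
have -> : ea * root_coef x' u * (eb * root_coef y' v) - ea * root_coef x' v * (eb * root_coef y' u)
  = ea * eb * M by rewrite /M; ring.
have S e : e * e = 1 -> e \in [:: 1; -1 : int] by rewrite !inE -sqrf_eq1 expr2 => ->.
move: m (S _ ea1) (S _ eb1); rewrite !inE.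
by move=> /or4P[]/eqP-> /orP[]/eqP-> /orP[]/eqP->.
Qed.

Lemma lker_proportional (K : fieldType) (V : vectType K) (f g : 'Hom(V, K^o)) :
  g != 0 -> lker f = lker g -> exists c : K, f = c *: g.
Proof.
move=> g0 e; have /subvPn[v _] : ~~ (fullv <= lker g)%VS.
  apply: contra g0 => /subvP sub; apply/eqP/lfunP=> v; rewrite zero_lfunE; apply/eqP.
  by rewrite -memv_ker sub ?memvf.
rewrite memv_ker => gv; exists (f v / g v); apply/lfunP=> u; rewrite scale_lfunE.
have : u - (g u / g v) *: v \in lker f.
  by rewrite e memv_ker linearB linearZ /= /GRing.scale /= divfK // subrr.
rewrite memv_ker linearB linearZ /= subr_eq0 => /eqP ->.
by rewrite /GRing.scale /= mulrAC [RHS]mulrAC (mulrC (f v)).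
Qed.

Section Arrangement.
Variables (K : fieldType) (l : nat) (G : sgraph 'I_l).
Hypothesis char2 : (2 : K) != 0.
Local Notation V := 'rV[K]_l.

Lemma form_at_ord (i : 'I_l) : form_at K l (val i) = coordinate K i.
Proof. by rewrite /form_at valK. Qed.

Lemma form_edge (i j : 'I_l) s : i != j ->
  root_form K l (val i, val j, s)
  = if s then coordinate K i + coordinate K j else coordinate K i - coordinate K j.
Proof. by move=> ij; rewrite /root_form /= (inj_eq val_inj) (negPf ij) !form_at_ord. Qed.

Lemma lkerN (W : vectType K) (f : 'Hom(W, K^o)) : lker (- f) = lker f.
Proof. by apply/vspaceP=> u; rewrite !memv_ker opp_lfunE oppr_eq0. Qed.

Lemma arrangement_forms (H : {vspace V}) :
  signed_graphic_arrangement G H <-> exists2 x, elem G x & H = lker (root_form K l x).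
Proof.
split=> [[[i [j [e ->]]]|[i [j [e ->]]]|[i [iL ->]]]|[x /elemP[[i [j [ij ex e]]]|[i [ex iL]]] ->]].
- have /andP[+ _] : (#|[set i; j]| == 2)%N && ([set i; j] \subset vertices G).
    exact: (@edgesP _ false G).
  rewrite cards2 => c2; have ij : i != j by case: (i != j) c2.
  case: (ltngtP i j) => h.
  + by exists (val i, val j, false); rewrite ?elem_edge // form_edge.
  + exists (val j, val i, false); first by rewrite elem_edge // setUC.
    by rewrite form_edge 1?eq_sym // -lkerN opprB.
  + by case/eqP: ij; apply: ord_inj.
- have /andP[+ _] : (#|[set i; j]| == 2)%N && ([set i; j] \subset vertices G).
    exact: (@edgesP _ true G).
  rewrite cards2 => c2; have ij : i != j by case: (i != j) c2.
  case: (ltngtP i j) => h.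
  + by exists (val i, val j, true); rewrite ?elem_edge // form_edge.
  + exists (val j, val i, true); first by rewrite elem_edge // setUC.
    by rewrite form_edge 1?eq_sym // addrC.
  + by case/eqP: ij; apply: ord_inj.
- exists (val i, val i, true); first by rewrite elem_loop.
  by rewrite /root_form /= eqxx form_at_ord.
- have ne : i != j by rewrite -val_eqE /= ltn_eqF.
  rewrite ex form_edge //; move: e; case: x.2 => e; [apply: Or32 | apply: Or31];
    by exists i, j.
by apply: Or33; exists i; rewrite ex /root_form /= eqxx form_at_ord.
Qed.

Lemma root_coef_lt x u : (u < l)%N = false -> valid x -> (x.1.2 < l)%N -> root_coef x u = 0.
Proof.
move=> ul /andP[le _] xl; apply: root_coef_out; rewrite !inE negb_or.
by apply/andP; split; apply/negP=> /eqP e; lia.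
Qed.

Lemma form_neq0 x : elem G x -> root_form K l x != 0.
Proof.
move=> /elem_valid/andP[/[dup] vx /andP[le _] xl].
have xl' : (x.1.1 < l)%N by exact: leq_ltn_trans le xl.
apply/eqP=> /lfunP/(_ (delta_mx 0 (Ordinal xl'))).
rewrite formE zero_lfunE /root_coef /= eqxx; case: eqP => _; by apply/eqP; rewrite oner_eq0.
Qed.

Lemma small_unit_neq0 m : m \in small_units -> (m%:~R : K) != 0.
Proof.
by move: char2; rewrite !inE => c2 /or4P[]/eqP->; rewrite ?rmorphN ?oppr_eq0 ?oner_eq0.
Qed.

Lemma form_lker_inj x y : elem G x -> elem G y -> lker (root_form K l x) = lker (root_form K l y) -> x = y.
Proof.
move=> Gx Gy e; apply/eqP/negPn/negP=> xy.
have /andP[vx xl] := elem_valid Gx; have /andP[vy yl] := elem_valid Gy.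
have [c fc] := lker_proportional (form_neq0 Gy) e.
have rc u : ((root_coef x u)%:~R : K) = c * (root_coef y u)%:~R.
  case ul : (u < l)%N; last by rewrite !root_coef_lt // mulr0.
  by have := congr1 (fun h : 'Hom(V, K^o) => h (delta_mx 0 (Ordinal ul))) fc;
    rewrite scale_lfunE !formE.
have [u [v /small_unit_neq0]] := distinct_minor vx vy xy.
rewrite rmorphB !rmorphM /= !rc => /eqP; apply.
by rewrite -!mulrA -mulrBr [X in X - _]mulrC subrr mulr0.
Qed.

Variables (n : nat) (alpha : 'I_n -> 'Hom(V, K^o)).
Hypothesis alphaG : defines_arrangement alpha (@signed_graphic_arrangement K l G).

(** A hyperplane determines its edge or loop by form_lker_inj, and a form is
determined by its kernel up to a nonzero scalar. *)
Lemma arrangement_labels : exists lam : 'I_n -> code,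
  [/\ injective lam, forall x, elem G x <-> exists i, x = lam i
    & forall i, exists2 c : K, c != 0 & alpha i = c *: root_form K l (lam i)].
Proof.
have [ainj aP] := alphaG.
have /fin_all_exists[lam lamP] : forall i, exists x, elem G x /\ lker (alpha i) = lker (root_form K l x).
  move=> i; have /arrangement_forms[x Gx e] : signed_graphic_arrangement G (lker (alpha i)).
    by apply/aP; exists i.
  by exists x.
exists lam; split=> [i j e|x|i].
- by apply: ainj; rewrite /= (lamP i).2 (lamP j).2 e.
- split=> [Gx|[i ->]]; last by case: (lamP i).
  have /aP[i e] : signed_graphic_arrangement G (lker (root_form K l x)) by apply/arrangement_forms; exists x.
  by exists i; have [Gi ei] := lamP i; apply: form_lker_inj; rewrite // e.
have [Gi ei] := lamP i; have [c e] := lker_proportional (form_neq0 Gi) ei.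
exists c => //; apply/eqP=> c0; move: ei; rewrite e c0 scale0r => ek.
case/eqP: (form_neq0 Gi); apply/lfunP=> u; rewrite zero_lfunE; apply/eqP.
by rewrite -memv_ker -ek memv_ker zero_lfunE.
Qed.

End Arrangement.

(** * Lines of the arrangement *)

Section Dependence.
Variables (K : fieldType) (V : vectType K) (n : nat) (alpha : 'I_n -> 'Hom(V, K^o)).
Hypothesis alpha_inj : injective (fun i => lker (alpha i)).
Hypothesis alpha_neq0 : forall i, alpha i != 0.

Lemma lkerZ (c : K) (f : 'Hom(V, K^o)) : c != 0 -> lker (c *: f) = lker f.
Proof.
by move=> c0; apply/vspaceP=> u; rewrite !memv_ker scale_lfunE scaler_eq0 (negPf c0).
Qed.

Lemma mem_dependent (S : {set 'I_n}) (s : seq 'I_n) : perm_eq (enum S) s ->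
  (S \in dependent_sets alpha) = ~~ free [seq alpha i | i <- s].
Proof. by move=> p; rewrite inE (perm_free (perm_map alpha p)). Qed.

(** Forms with distinct kernels are pairwise independent. *)
Lemma dependent_large (S : {set 'I_n}) : S \in dependent_sets alpha -> (2 < #|S|)%N.
Proof.
rewrite inE cardE; have := enum_uniq S; case: (enum S) => [|i [|j [|]]] //=.
- by rewrite nil_free.
- by rewrite seq1_free alpha_neq0.
rewrite inE andbT => ij; rewrite free_cons seq1_free alpha_neq0 andbT span_seq1 negbK.
case/vlineP=> c e; case/eqP: ij; apply: alpha_inj; rewrite /= e lkerZ //.
by apply: contraNneq (alpha_neq0 i) => c0; rewrite e c0 scale0r.
Qed.

Lemma free3Z (f g h : 'Hom(V, K^o)) (a b c : K) : a != 0 -> b != 0 -> c != 0 ->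
  free [:: a *: f; b *: g; c *: h] = free [:: f; g; h].
Proof.
move=> a0 b0 c0; apply/idP/idP=> /free3P F; apply/free3P=> x y z e.
  have [|x0 y0 z0] := F (x / a) (y / b) (z / c); first by rewrite !scalerA !divfK.
  split; apply/eqP.
  - by move/eqP: x0; rewrite mulf_eq0 invr_eq0 (negPf a0) orbF.
  - by move/eqP: y0; rewrite mulf_eq0 invr_eq0 (negPf b0) orbF.
  by move/eqP: z0; rewrite mulf_eq0 invr_eq0 (negPf c0) orbF.
rewrite !scalerA in e; have [x0 y0 z0] := F _ _ _ e; split; apply/eqP.
- by move/eqP: x0; rewrite mulf_eq0 (negPf a0) orbF.
- by move/eqP: y0; rewrite mulf_eq0 (negPf b0) orbF.
by move/eqP: z0; rewrite mulf_eq0 (negPf c0) orbF.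
Qed.

Lemma enum_set3 (i j k : 'I_n) : i != j -> i != k -> j != k ->
  perm_eq (enum [set i; j; k]) [:: i; j; k].
Proof.
move=> ij ik jk; apply: uniq_perm; rewrite ?enum_uniq //=.
  by rewrite !inE negb_or ij ik jk.
by move=> x; rewrite mem_enum !inE orbA.
Qed.

End Dependence.

Section Lines.
Variables (K : fieldType) (l : nat) (G : sgraph 'I_l).
Hypothesis char2 : (2 : K) != 0.
Hypothesis noB2 : forall f, injective f -> ~~ all (elem G) (map (emb f) B2_codes).
Variables (n : nat) (alpha : 'I_n -> 'Hom('rV[K]_l, K^o)) (lam : 'I_n -> code).
Hypotheses (alpha_inj : injective (fun i => lker (alpha i)))
  (lam_inj : injective lam) (lamP : forall x, elem G x <-> exists i, x = lam i)
  (alphaE : forall i, exists2 c : K, c != 0 & alpha i = c *: root_form K l (lam i)).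

Local Notation A := (elem G).

Lemma A_valid x : A x -> valid x. Proof. by move/elem_valid/andP=> []. Qed.

Lemma A_lam i : A (lam i). Proof. by apply/lamP; exists i. Qed.

Lemma alpha_neq0 i : alpha i != 0.
Proof.
have [c c0 ->] := alphaE i; rewrite scaler_eq0 negb_or c0.
exact: (form_neq0 (G := G) K (A_lam i)).
Qed.

(** Rescaling the forms does not affect independence, so free_forms decides. *)
Lemma line3_lam i j k : line3 alpha i j k = lineA A (lam i) (lam j) (lam k).
Proof.
rewrite /line3 /line_of /lineA card_set3 !A_lam /=.
have [ij|] /= := boolP (i != j); last first.
  rewrite negbK => /eqP->; apply/esym/negbTE/negP=> /lineb_neq[].
  by rewrite eqxx.
have [ik|] /= := boolP (i != k); last first.
  rewrite negbK => /eqP->; apply/esym/negbTE/negP=> /lineb_neq[_].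
  by rewrite eqxx.
have [jk|] /= := boolP (j != k); last first.
  rewrite negbK => /eqP->; apply/esym/negbTE/negP=> /lineb_neq[_ _].
  by rewrite eqxx.
rewrite (mem_dependent _ (enum_set3 ij ik jk)) /=.
have [a a0 ->] := alphaE i; have [b b0 ->] := alphaE j; have [c c0 ->] := alphaE k.
have /andP[vi li] := elem_valid (A_lam i); have /andP[vj lj] := elem_valid (A_lam j).
have /andP[vk lk] := elem_valid (A_lam k).
by rewrite free3Z // (free_forms char2) ?negbK // (inj_eq lam_inj).
Qed.

(** The third point on a line through two given points is unique without a B_2. *)
Lemma lines_meet S S' : line_of alpha S -> line_of alpha S' -> (1 < #|S :&: S'|)%N -> S = S'.
Proof.
move=> lS lS' /card_gt1P[a [b [aI bI ab]]].
have third (T : {set 'I_n}) : line_of alpha T -> a \in T -> b \in T ->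
    exists2 c, T = [set a; b; c] & line3 alpha a b c.
  move=> lT aT bT; have cT : #|T| = 3%N by case/andP: lT => /eqP.
  have [c [_ _ eT]] := card3_third cT aT bT ab.
  by exists c; rewrite // /line3 -eT.
move: aI bI; rewrite !inE => /andP[aS aS'] /andP[bS bS'].
have [c -> l1] := third S lS aS bS; have [c' -> l2] := third S' lS' aS' bS'.
move: l1 l2; rewrite !line3_lam => l1 l2.
by rewrite (lam_inj (lineA_third A_valid noB2 l1 l2)).
Qed.

Definition index_of (x : code) : option 'I_n := [pick i | lam i == x].

Lemma index_of_lam i : index_of (lam i) = Some i.
Proof.
rewrite /index_of; case: pickP => [j /eqP/lam_inj->//|/(_ i)]; by rewrite eqxx.
Qed.

Lemma index_ofP x : if index_of x is Some i then x = lam i else ~~ A x.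
Proof.
rewrite /index_of; case: pickP => [j /eqP->//|no]; apply/negP=> /lamP[i e].
by have := no i; rewrite e eqxx.
Qed.

(** Turns a function of indices of hyperplanes into a function of codes, vanishing
outside of the graph, where the configurations live. *)
Definition extend (C : 'I_n -> 'I_n -> 'I_n -> K) (x y z : code) : K :=
  if index_of x is Some i then if index_of y is Some j then
    if index_of z is Some k then C i j k else 0 else 0 else 0.

Lemma extend_lam C i j k : extend C (lam i) (lam j) (lam k) = C i j k.
Proof. by rewrite /extend !index_of_lam. Qed.

Lemma extend_out C x y z : ~~ [&& A x, A y & A z] -> extend C x y z = 0.
Proof.
rewrite /extend; have := index_ofP x; case: (index_of x) => // i ->; rewrite A_lam.
have := index_ofP y; case: (index_of y) => // j ->; rewrite A_lam.
by have := index_ofP z; case: (index_of z) => // k ->; rewrite A_lam.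
Qed.

Lemma extend_syzygy C : syzygy xpredT (line3 alpha) C -> syzygy A (lineA A) (extend C).
Proof.
case=> anti nz th cyc.
have cases x y z : (exists i j k, [/\ x = lam i, y = lam j & z = lam k]) \/ ~~ [&& A x, A y & A z].
  have [/and3P[/lamP[i ->] /lamP[j ->] /lamP[k ->]]|no] := boolP [&& A x, A y & A z]; last by right.
  by left; exists i, j, k.
split.
- move=> x y z; have [[i [j [k [-> -> ->]]]]|no] := cases x y z; first by rewrite !extend_lam.
  rewrite !extend_out ?oppr0 //; apply: contra no; by case/and3P=> -> -> ->.
- move=> x y z; have [[i [j [k [-> -> ->]]]]|no] := cases x y z.
    rewrite extend_lam => /nz[_ [u l3]]; split; first exact: A_lam.
    by exists (lam u); rewrite -line3_lam.
  by rewrite extend_out // eqxx.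
- move=> x y z u /[dup] lu /and4P[/lamP[j ey] /lamP[k ez] /lamP[w eu] _]; subst.
  have [[i [_ [_ [-> _ _]]]]|no] := cases x (lam j) (lam k).
    by rewrite !extend_lam; apply: th; rewrite line3_lam.
  rewrite !extend_out //; apply: contra no; case/and3P=> -> _ _; by rewrite !A_lam.
move=> x y z; have [[i [j [k [-> -> ->]]]]|no] := cases x y z; first by rewrite !extend_lam.
rewrite !extend_out ?addr0 //; apply: contra no; by case/and3P=> -> -> ->.
Qed.

Lemma restrict_syzygy (C : code -> code -> code -> K) : syzygy A (lineA A) C ->
  syzygy xpredT (line3 alpha) (fun i j k => C (lam i) (lam j) (lam k)).
Proof.
case=> anti nz th cyc; split=> [i j k|i j k /nz[_ [u l3]]|i j k w l3|i j k] //.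
  split=> //; have /and4P[_ _ /lamP[w ew] _] := l3.
  by exists w; rewrite line3_lam -ew.
by apply: th; rewrite -line3_lam.
Qed.

Lemma extend_restrict (C : code -> code -> code -> K) : syzygy A (lineA A) C ->
  forall x y z, extend (fun i j k => C (lam i) (lam j) (lam k)) x y z = C x y z.
Proof.
move=> sC x y z; have [/and3P[/lamP[i ->] /lamP[j ->] /lamP[k ->]]|no] := boolP [&& A x, A y & A z].
  by rewrite extend_lam.
rewrite extend_out //; apply/esym/eqP; apply: contraNT no => nz.
by have [_ /(_ _ _ _ nz)[-> [u /and4P[-> -> _ _]]]] := sC.
Qed.

Lemma extend_linear a C C' x y z :
  extend (fun i j k => a * C i j k + C' i j k) x y z = a * extend C x y z + extend C' x y z.
Proof.
by rewrite /extend; do 3?case: index_of => [?|]; rewrite ?mulr0 ?addr0.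
Qed.

Lemma eq_extend C C' : (forall i j k, C i j k = C' i j k) ->
  forall x y z, extend C x y z = extend C' x y z.
Proof. by move=> e x y z; rewrite /extend; do 3?case: index_of => [?|] //. Qed.

End Lines.

(** * The decomposition of the Falk kernel and the count *)

Lemma kind_models_ok : all (fun k => model_ok (kind_model k)) kinds.
Proof. by vm_compute. Qed.

Lemma kind_model_ok k : k \in kinds -> model_ok (kind_model k).
Proof. by move=> kk; exact: (allP kind_models_ok). Qed.

Section Configurations.
Variables (K : fieldType) (l : nat) (G : sgraph 'I_l).
Hypothesis vG : vertices G = [set: 'I_l].
Hypothesis noB2 : forall f, injective f -> ~~ all (elem G) (map (emb f) B2_codes).

Local Notation A := (elem G).
Local Notation J := ('I_8 * sgraph 'I_l)%type.

(** A D_3 or G_circ inside a D_3^1 is left out: its syzygies are among the five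
counted for the D_3^1. *)
Definition is_config (j : J) : bool :=
  [&& subgraph j.2 G, kind_iso j.1 j.2
    & ((j.1 : nat) \in [:: 2; 6]%N) ==> ~~ in_D31 G j.2].

Definition configs : {set J} := [set j | is_config j].

Definition config_model (j : J) : model := kind_model j.1.

(** The list s j enumerates the edges and loops of j.2 in the order of kind_codes, so
that their positions are the points of the model. *)
Definition labelling (s : J -> seq code) : Prop := forall j, j \in configs ->
  exists f c, [/\ injective f, c \in switchings j.1, s j = map (emb f) c & realizes j.2 (s j)].

Lemma labelling_exists : exists s, labelling s.
Proof.
apply: (fin_all_exists (P := fun j s => j \in configs -> exists f c,
  [/\ injective f, c \in switchings j.1, s = map (emb f) c & realizes j.2 s])) => j.
have [|no] := boolP (j \in configs); last by exists [::].
rewrite inE => /and3P[_ /kind_realizes[f [c [finj cs r]]] _].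
by exists (map (emb f) c) => _; exists f, c.
Qed.

Variable s : J -> seq code.
Hypothesis sP : labelling s.

Lemma config_kind (j : J) : (j.1 : nat) \in kinds.
Proof. by rewrite mem_iota ltn_ord. Qed.

Lemma config_mem j x : j \in configs -> (x \in s j) = elem j.2 x.
Proof. by move=> /sP[f [c [_ _ _ [eH _]]]]; apply/idP/idP => /eH. Qed.

Lemma config_sub j : j \in configs -> {subset s j <= A}.
Proof.
move=> jJ x; rewrite config_mem // => xj; move: jJ; rewrite inE => /and3P[sub _ _].
exact: subgraph_elem sub xj.
Qed.

Lemma config_uniq j : j \in configs -> uniq (s j) /\ size (s j) = npts (config_model j).
Proof.
move=> /sP[f [c [finj cs -> _]]].
have [sz u /allP co] := switchings_codes (config_kind j) cs.
rewrite size_map sz map_inj_in_uniq // => x y xc yc.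
by apply: emb_inj; rewrite // (codes_valid (co _ _)).
Qed.

Lemma config_line j : j \in configs -> {in s j & &, forall x y z,
  lineA A x y z = mline (config_model j) (index x (s j)) (index y (s j)) (index z (s j))}.
Proof.
move=> jJ x y z xs ys zs.
have [Ax Ay Az] : [/\ A x, A y & A z] by split; exact: (config_sub jJ).
rewrite /lineA Ax Ay Az /=.
have [us sz] := config_uniq jJ.
have [f [c [finj cs es _]]] := sP jJ.
have [sc uc /allP co] := switchings_codes (config_kind j) cs.
have dec w : w \in s j -> (index w (s j) < npts (config_model j))%N /\
    w = emb f (nth (0, 0, true)%N c (index w (s j))).
  move=> ws; have ws' := ws; rewrite -index_mem sz in ws'; split=> //.
  rewrite -(nth_map (0, 0, true)%N (0, 0, true)%N) -?es ?nth_index //.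
  by rewrite sc; exact: ws'.
have [ix ex] := dec x xs; have [iy ey] := dec y ys; have [iz ez] := dec z zs.
have /allP/(_ _ (config_kind j))/allP/(_ _ cs)/and4P[_ _ _] := labels_ok.
move=> /all_iotaP/(_ _ ix)/all_iotaP/(_ _ iy)/all_iotaP/(_ _ iz)/eqP <-.
have val i : (i < npts (config_model j))%N -> valid (nth (0, 0, true)%N c i).
  by move=> ij; apply: (codes_valid (co _ _)); apply: mem_nth; rewrite sc.
rewrite {1}ex {1}ey {1}ez lineb_emb //; exact: val.
Qed.

Lemma in_D31I H H' : subgraph H' G -> kind_iso 7 H' -> subgraph H H' -> in_D31 G H.
Proof. by move=> a b c; apply/existsP; exists H'; apply/and3P. Qed.

Lemma config_of_line x y z : lineA A x y z ->
  exists2 j, j \in configs & is_line_model (config_model j) /\ [/\ x \in s j, y \in s j & z \in s j].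
Proof.
move=> l3; have [k [f [c [kk finj cs Ac xyz]]]] := lineA_conf (@A_valid l G) l3.
have k8 : (k < 8)%N by move: kk; rewrite !inE => /or3P[]/eqP->.
have k_kind : k \in kinds by rewrite mem_iota.
have [H HG [iso eH]] := realizes_kind k_kind vG finj cs Ac.
have jJ : (Ordinal k8, H) \in configs.
  by rewrite inE /is_config HG iso /=; move: kk; rewrite !inE => /or3P[]/eqP->.
exists (Ordinal k8, H) => //; split; first by move: kk; rewrite /config_model !inE /= => /or3P[]/eqP->.
by case/and4P: xyz => a b d _; rewrite !config_mem //; split; apply/eH.
Qed.

(** A subgraph of kind D_3 or G_circ covering the triple may lie in a D_3^1, which
then takes its place. *)
Lemma config_cover (C : code -> code -> code -> K) x y z u : syzygy A (lineA A) C ->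
  C x y z != 0 -> lineA A y z u -> x \notin [:: y; z; u] ->
  exists2 j, j \in configs & ~~ is_line_model (config_model j) /\
    [/\ x \in s j, y \in s j, z \in s j & u \in s j].
Proof.
move=> sC nz l3 xn.
have [k [f [c [kk finj cs Ac xyz]]]] := syzygy_covered (@A_valid l G) noB2 sC nz l3 xn.
have k8 : (k < 8)%N by move: kk; rewrite !inE => /or4P[|||/orP[]]/eqP->.
have k_kind : k \in kinds by rewrite mem_iota.
have [H HG [iso eH]] := realizes_kind k_kind vG finj cs Ac.
have {}xyz : {in [:: x; y; z; u], forall w, elem H w} by move=> w /(allP xyz)/eH.
have [xH yH zH uH] : [/\ elem H x, elem H y, elem H z & elem H u].
  by split; apply: xyz; rewrite !inE eqxx ?orbT.
have [/andP[k26 /existsP[H' /and3P[HG' iso' sub]]]|ok] := boolP ((k \in [:: 2; 6]%N) && in_D31 G H).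
  have k7 : (7 < 8)%N by [].
  have jJ : (Ordinal k7, H') \in configs by rewrite inE /is_config HG' /= iso'.
  exists (Ordinal k7, H') => //; split=> //.
  by rewrite !config_mem //; split; apply: subgraph_elem sub _.
have jJ : (Ordinal k8, H) \in configs by rewrite inE /is_config HG iso /= implybE -negb_and.
exists (Ordinal k8, H) => //; split; last by rewrite !config_mem.
by move: kk; rewrite /config_model !inE /= => /or4P[|||/orP[]]/eqP->.
Qed.

(** Of the alternatives in overlap, those involving a D_3^1 around one of the two
configurations contradict is_config. *)
Lemma config_unique i j x y z : i \in configs -> j \in configs ->
  [/\ x \in s i, y \in s i & z \in s i] -> [/\ x \in s j, y \in s j & z \in s j] ->
  [/\ x != y, x != z & y != z] ->
  lineA A x y z = is_line_model (config_model i) ->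
  lineA A x y z = is_line_model (config_model j) -> i = j.
Proof.
move=> iJ jJ [xi yi zi] [xj yj zj] [xy xz yz].
have [Ax Ay Az] : [/\ A x, A y & A z] by split; exact: (config_sub iJ).
rewrite /lineA Ax Ay Az /= => li lj.
have [f [c [finj cs es rs]]] := sP iJ; have [g [d [ginj ds et rt]]] := sP jJ.
have Ac : all A (map (emb f) c) by rewrite -es; apply/allP; exact: config_sub.
have Ad : all A (map (emb g) d) by rewrite -et; apply/allP; exact: config_sub.
have xyz : all (mem (map (emb f) c)) [:: x; y; z] by rewrite /= -es xi yi zi.
have xyz' : all (mem (map (emb g) d)) [:: x; y; z] by rewrite /= -et xj yj zj.
have no_D31 t h (e : seq code) : t \in configs -> (t.1 : nat) \in [:: 2; 6]%N ->
    (exists g' d', [/\ injective g', d' \in switchings 7, all A (map (emb g') d')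
       & {subset map (emb h) e <= map (emb g') d'}]) ->
    s t = map (emb h) e -> realizes t.2 (s t) -> False.
  move=> tJ t26 [g' [d' [g'inj d's Ad' sub]]] est rt'; move: (tJ); rewrite inE.
  case/and3P=> _ _; rewrite t26 /= => /negP; apply.
  have [H HG [iso eH]] := realizes_kind (k := 7) isT vG g'inj d's Ad'.
  apply: (in_D31I HG iso); apply: realizes_subgraph rt' _ => w.
  by rewrite est => /sub/eH.
case: (overlap noB2 (config_kind i) (config_kind j) finj ginj cs ds Ac Ad xyz xyz' xy xz yz li lj).
- case=> ek eq_s.
  have emem w : elem i.2 w = elem j.2 w by rewrite -!config_mem // es et eq_s.
  have eH : i.2 = j.2.
    apply: subgraph_anti.
      by apply: realizes_subgraph rs _ => w; rewrite config_mem // emem.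
    by apply: realizes_subgraph rt _ => w; rewrite config_mem // emem.
  by case: (i) (j) ek eH => [a H] [b H'] /= /ord_inj-> ->.
- by case=> k26 h; case: (no_D31 i f c).
by case=> k26 h; case: (no_D31 j g d).
Qed.

End Configurations.

Section Formula.
Variables (K : fieldType) (l : nat) (G : sgraph 'I_l).
Hypothesis char2 : (2 : K) != 0.
Hypothesis vG : vertices G = [set: 'I_l].
Hypothesis G_noB2 : ~ exists H, subgraph H G /\ sgraph_iso H (graph_B 2).
Variables (n : nat) (alpha : 'I_n -> 'Hom('rV[K]_l, K^o)).
Hypothesis alphaG : defines_arrangement alpha (@signed_graphic_arrangement K l G).

Definition kind_dim (k : nat) : nat := size (mfuns (kind_model k)).

(** The family of all tables of all configurations is dual to the family of all
evaluations, and the evaluations separate syzygies.  A configuration has at most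
five tables, whence the index type 'I_5. *)
Lemma falk_configs : falk_invariant alpha = \sum_(j in configs G) kind_dim j.1.
Proof.
have noB2 f : injective f -> ~~ all (elem G) (map (emb f) B2_codes) by exact: no_B2.
have [alpha_inj _] := alphaG.
have [lam [lam_inj lamP alphaE]] := arrangement_labels char2 alphaG.
have an0 := alpha_neq0 lamP alphaE.
have simple S : S \in dependent_sets alpha -> (2 < #|S|)%N by exact: dependent_large.
have meet := lines_meet char2 noB2 lam_inj lamP alphaE.
have [s sP] := labelling_exists G.
pose A := elem G; pose p0 : code := (0%N, 0%N, true).
pose B := [set b : ('I_8 * sgraph 'I_l) * 'I_5 | (b.1 \in configs G) && (b.2 < kind_dim b.1.1)%N].
have unif j : j \in configs G -> uniq (s j) by move=> jJ; have [] := config_uniq sP jJ.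
have size_s j : j \in configs G -> size (s j) = npts (config_model j).
  by move=> jJ; have [] := config_uniq sP jJ.
have ok j : j \in configs G -> model_ok (config_model j).
  by move=> _; apply/kind_model_ok/config_kind.
pose vect j a := @conf_vect K code _ (@config_model l) s j a.
pose eval j a := @conf_eval K code p0 _ (@config_model l) s j a.
have lineP := line3_lam char2 lam_inj lamP alphaE.
have syz j a : j \in configs G -> (a < kind_dim j.1)%N -> syzygy A (lineA A) (vect j a).
  move=> jJ aj; apply: conf_vect_syzygy (config_sub sP) (config_line sP) _ _ _ _ => //.
  - exact: (lineA_rot (@A_valid l G)).
  - exact: (lineA_third (@A_valid l G) noB2).
have /fin_all_exists[v vP] : forall b : ('I_8 * sgraph 'I_l) * 'I_5, exists t, b \in B ->
    t \in syzygy_space alpha /\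
    forall i j k, coef t i j k = vect b.1 b.2 (lam i) (lam j) (lam k).
  move=> b; have [|no] := boolP (b \in B); last by exists 0.
  rewrite inE => /andP[jJ aj].
  have [t tS tE] := syzygy_coef simple meet (restrict_syzygy char2 lam_inj lamP alphaE (syz _ _ jJ aj)).
  by exists t.
have vS b : b \in B -> v b \in syzygy_space alpha by move=> /vP[].
pose ev (b : ('I_8 * sgraph 'I_l) * 'I_5) t := eval b.1 b.2 (extend lam (coef t)).
have ext_v b : b \in B -> forall x y z, extend lam (coef (v b)) x y z = vect b.1 b.2 x y z.
  move=> bB x y z; have [_ e] := vP b bB.
  move: bB; rewrite inE => /andP[jJ aj].
  by rewrite (eq_extend lam e) (extend_restrict lam_inj lamP (syz _ _ jJ aj)).
have eq_eval j a C C' : (forall x y z, C x y z = C' x y z) -> eval j a C = eval j a C'.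
  by move=> e; rewrite /eval /conf_eval; case: (nth _ _ _) => [[x y] z].
have -> : falk_invariant alpha = #|B|.
  apply: (dim_dual_family (ev := ev) (v := v)) => [b a x y||b b'|t tS ev0] //.
  - rewrite /ev /eval /conf_eval; case: (nth _ _ _) => [[i j] k].
    by rewrite -extend_linear; apply: eq_extend => i' j' k'; exact: coef_linear.
  - move=> /[dup] bB + /[dup] bB'; rewrite {1}inE => /andP[jJ aj]; rewrite {1}inE => /andP[jJ' aj'].
    rewrite /ev (eq_eval _ _ _ _ (ext_v _ bB')) /eval /vect.
    rewrite (conf_eval_vect K p0 (lineA_rot (@A_valid l G)) ok unif size_s (config_line sP) (config_unique vG noB2 sP) jJ aj jJ' aj').
    by case: b b' {bB bB' jJ aj jJ' aj'} => [j a] [j' a']; rewrite -[in RHS]pair_eqE.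
  apply: (coef_eq0 simple meet tS) => i j k; rewrite -(extend_lam lam_inj (coef t)).
  have sC := extend_syzygy char2 lam_inj lamP alphaE (coef_syzygy simple meet tS).
  apply: (conf_separate (p0 := p0) (@lineA_neq A) (lineA_rot (@A_valid l G))
    (lineA_swap (@A_valid l G)) (lineA_third (@A_valid l G) noB2) ok unif size_s (config_line sP)
    (config_of_line vG sP) (config_cover vG noB2 sP) (config_unique vG noB2 sP) sC).
  move=> j' a jJ aj; have a5 : (a < 5)%N.
    apply: leq_trans aj _; have := config_kind j'.
    by rewrite /config_model; case: (nat_of_ord _) => [|[|[|[|[|[|[|[|]]]]]]]].
  by have := ev0 (j', Ordinal a5); rewrite inE /= jJ aj; apply.
rewrite -sum1_card (eq_bigl (fun b : ('I_8 * sgraph 'I_l) * 'I_5 =>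
  (b.1 \in configs G) && (b.2 < kind_dim b.1.1)%N)); last by move=> b; rewrite inE.
rewrite -(pair_big_dep (fun j => j \in configs G) (fun j (a : 'I_5) => (a < kind_dim j.1)%N)
  (fun _ _ => 1%N)) /=.
apply: eq_bigr => j _; have le5 : (kind_dim j.1 <= 5)%N.
  have := config_kind j; rewrite /kind_dim.
  by case: (nat_of_ord _) => [|[|[|[|[|[|[|[|]]]]]]]].
by rewrite (big_ord_narrow le5) sum1_card card_ord.
Qed.

Lemma count_configs (k : 'I_8) (P : pred (sgraph 'I_l)) :
  (forall H, (k, H) \in configs G = subgraph H G && P H) ->
  (\sum_(H | (k, H) \in configs G) kind_dim k = kind_dim k * count_subgraphs G P)%N.
Proof.
move=> e; rewrite sum_nat_const mulnC; congr (_ * _)%N; rewrite /count_subgraphs.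
by apply: eq_card => H; rewrite [RHS]inE -e.
Qed.

Theorem falk_formula : falk_invariant alpha =
    (2 * (nb_K G 3 + nb_K G 4 + nb_D3 G + nb_D1 G 2 + nb_Kl G 2 + nb_Kl G 3
          + nb_Gcirc G)
     + 5 * nb_D1 G 3)%N.
Proof.
rewrite falk_configs.
rewrite (eq_bigl (fun j : 'I_8 * sgraph 'I_l => true && ((j.1, j.2) \in configs G))); last by case.
rewrite -(pair_big_dep xpredT (fun k H => (k, H) \in configs G) (fun k _ => kind_dim k)) /=.
pose nb k := nth 0%N [:: nb_K G 3; nb_K G 4; nb_D3 G; nb_D1 G 2; nb_Kl G 2; nb_Kl G 3;
  nb_Gcirc G; nb_D1 G 3] k.
have nbE (k : 'I_8) : (\sum_(H | (k, H) \in configs G) kind_dim k = kind_dim k * nb k)%N.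
  case: k => -[|[|[|[|[|[|[|[|//]]]]]]]] k8; apply: count_configs => H;
    by rewrite inE /is_config /= ?andbT.
rewrite (eq_bigr _ (fun k _ => nbE k)) -(big_mkord xpredT (fun k => kind_dim k * nb k)%N).
rewrite !big_nat_recr //= big_geq // /nb /kind_dim /=.
by lia.
Qed.

End Formula.

Theorem theorem4p1 (R : realType) (l : nat) (G : sgraph 'I_l)
    (vertices_G : vertices G = [set: 'I_l])
    (G_noB2 : ~ exists H : sgraph 'I_l, subgraph H G /\ sgraph_iso H (graph_B 2))
    (n : nat) (alpha : 'I_n -> 'Hom('rV[R[i]]_l, R[i]^o))
    (alphaG : defines_arrangement alpha (@signed_graphic_arrangement R[i] l G)) :
  falk_invariant alpha =
    (2 * (nb_K G 3 + nb_K G 4 + nb_D3 G + nb_D1 G 2 + nb_Kl G 2 + nb_Kl G 3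
          + nb_Gcirc G)
     + 5 * nb_D1 G 3)%N.
Proof. by apply: falk_formula; rewrite ?pnatr_eq0. Qed.
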